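(* Let $k$ be an algebraically closed field of characteristic $2$. Then every $A_4$-Galois extension $k[[z]]/k[[s]]$ lifts to characteristic zero. That is, for every action of the alternating group $A_4$ on $k[[z]]$ by $k$-automorphisms with fixed ring $k[[s]]$, there exist a discrete valuation ring $R$ of characteristic zero with residue field $k$ and an $A_4$-Galois extension $R[[Z]]/R[[S]]$ (i.e. $A_4$ acts on $R[[Z]]$ by $R$-automorphisms with fixed ring $R[[S]]$) whose reduction modulo the maximal ideal of $R$ is $A_4$-equivariantly isomorphic to $k[[z]]/k[[s]]$. In other words, $A_4$ is a local Oort group for $p=2$. *)

(* Defs.v *)
From HB Require Import structures.
From mathcomp Require Import all_boot all_order all_algebra all_fingroup all_solvable.
Set Implicit Arguments. Unset Strict Implicit. Unset Printing Implicit Defensive.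
Import GRing.Theory.
Local Open Scope ring_scope.

(* Formal power series A[[X]] over a commutative ring A, as coefficient
   sequences: f n is the coefficient of X^n. *)
Definition ps (A : Type) := nat -> A.

Section PS.
Variable A : comNzRingType.
Definition ps_add (f g : ps A) : ps A := fun n => f n + g n.
Definition ps_mul (f g : ps A) : ps A := fun n => \sum_(i < n.+1) f i * g (n - i)%N.
Definition ps_C (c : A) : ps A := fun n => if n == 0%N then c else 0.
Definition ps_scale (c : A) (f : ps A) : ps A := fun n => c * f n.
End PS.

Definition ps_alg_hom (A : comNzRingType) (phi : ps A -> ps A) : Prop :=
  [/\ forall f g, phi (ps_add f g) = ps_add (phi f) (phi g),
      forall f g, phi (ps_mul f g) = ps_mul (phi f) (phi g),
      phi (ps_C 1) = ps_C 1 &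
      forall c f, phi (ps_scale c f) = ps_scale c (phi f)].

Notation A4 := ('Alt_('I_4))%g.

Definition faithful_A4_action (A : comNzRingType)
    (rho : {perm 'I_4} -> ps A -> ps A) : Prop :=
  [/\ rho 1%g = id,
      (forall g h, g \in A4 -> h \in A4 -> rho (g * h)%g = rho g \o rho h),
      (forall g, g \in A4 -> ps_alg_hom (rho g)) &
      (forall g, g \in A4 -> rho g = id -> g = 1%g)].

Definition fixed_ring_is_ps (A : comNzRingType)
    (rho : {perm 'I_4} -> ps A -> ps A) : Prop :=
  exists psi : ps A -> ps A,
    [/\ ps_alg_hom psi, injective psi &
        forall f, (forall g, g \in A4 -> rho g f = f) <-> exists h, psi h = f].

Definition A4_galois_ps (A : comNzRingType)
    (rho : {perm 'I_4} -> ps A -> ps A) : Prop :=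
  faithful_A4_action rho /\ fixed_ring_is_ps rho.

Definition is_dvr (R : idomainType) : Prop :=
  exists pi : R, [/\ pi != 0, pi \isn't a GRing.unit &
    forall x : R, x != 0 -> exists u n, u \is a GRing.unit /\ x = u * pi ^+ n].

Definition residue_map (R : idomainType) (k : fieldType) (red : {rmorphism R -> k})
  : Prop :=
  (forall y : k, exists x : R, red x = y) /\
  (forall x : R, red x = 0 <-> x \isn't a GRing.unit).

Definition ps_map (A B : Type) (f : A -> B) (F : ps A) : ps B := fun n => f (F n).

Definition ps_alg_iso (k : fieldType) (phi : ps k -> ps k) : Prop :=
  ps_alg_hom phi /\ bijective phi.

(* Main.v *)
(* Choose a uniformizer t of the Klein group invariants in k[[z]] on which the
   3-cycle s acts by t |-> l t, with l a primitive cube root of unity.  The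
   biquadratic extension k((z))/k((t)) is generated by w, s w, s^2 w, where
   w^2 + t^n w = q(t), w + l^(2n) s w + l^n s^2 w = 0, the series q has odd
   exponents only, and n is minimal.  Minimality of n bounds the ramification:
   v(a x - x) >= v(x) + 2n - 1 for an involution a.
   Let R be a complete discrete valuation ring with uniformizer p, p^16 = 2, and
   residue field k.  In S = R[[T]], with s T = z T, explicit formulas produce
   lifts G and H of t^n and Phi of q with (s G)(s^2 G) = H^2 + 4 Phi.  The square
   roots Y_i of the products (s^(i+1) G)(s^(i+2) G) generate an A_4-extension,
   and W_i = (H_i - Y_i) / 2 lifts s^i w; let A be the integral closure of S in it.
   If x0 in A is negated by a and generates the elements with this property,
   then x0^2 divides G up to a power of 2, since s G and s^2 G are coprime up to
   a power of 2; hence v(x0 mod p) <= 2n.  Since x0 = Z - a Z for some Z in A,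
   the ramification bound shows that Z reduces to a uniformizer of k[[z]], up to
   a constant, and so A = R[[Z]]. *)
Require Import Defs.
From HB Require Import structures.
From mathcomp Require Import all_boot all_order all_algebra all_fingroup all_solvable.
From mathcomp Require Import boolp ring zify.
Set Implicit Arguments. Unset Strict Implicit. Unset Printing Implicit Defensive.
Import GRing.Theory.
Local Open Scope ring_scope.


(** The equation for [G], [H], [Phi] makes [W^2 = H W + Phi] lift the equation of [w]; the linear
    relation between the conjugates of [w] lifts because [G H - (s H)(s^2 H)] is also divisible by
    [2p]. With [G] and [H] written as perturbations of one series [K] such that [s K = z^n K], both
    conditions follow from [K c - b^2 = p^6 q] modulo [p^7], where [b] and [c] have no exponent
    congruent to [n] modulo 3. [K = T^n] alone would only produce the terms of [q] of degree at
    least [n]. For the lower ones [K] receives extra monomials with small coefficients, and [b] is a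
    square root modulo 2 of the unwanted products; such roots need even exponents, hence two cases
    according to the parity of the quotient of [n] by 3. The equation [p^16 = 2] leaves room for
    these powers of [p]: [4 = p^32] and [32 = 26 + 6]. No generators of [A] are given: it is cut out
    by conditions at [p] and away from [p], and each element carries its reduction in [k[[z]]]. Two
    facts then suffice: an element of [A] with zero reduction is divisible by [p] in [A], and [A] is
    [p]-adically complete. *)

HB.instance Definition _ (A : choiceType) := Choice.copy (ps A) (nat -> A).

(** * The ring of formal power series *)

Section PowerSeriesRing.
Variable A : comNzRingType.
Implicit Types f g h : ps A.

Definition ps_opp f : ps A := fun n => - f n.
Definition ps_zero : ps A := fun=> 0.

Lemma ps_addA : associative (@ps_add A).
Proof. by move=> f g h; apply: funext => n; rewrite /ps_add addrA. Qed.
Lemma ps_addC : commutative (@ps_add A).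
Proof. by move=> f g; apply: funext => n; rewrite /ps_add addrC. Qed.
Lemma ps_add0 : left_id ps_zero (@ps_add A).
Proof. by move=> f; apply: funext => n; rewrite /ps_add add0r. Qed.
Lemma ps_addN : left_inverse ps_zero ps_opp (@ps_add A).
Proof. by move=> f; apply: funext => n; rewrite /ps_add addNr. Qed.

HB.instance Definition _ := GRing.isZmodule.Build (ps A)
  ps_addA ps_addC ps_add0 ps_addN.

Definition trunc n f : {poly A} := \poly_(i < n) f i.

(** Truncation hands the ring axioms over to polynomials, which avoids reindexing double sums. *)
Lemma ps_mul_trunc f g n N : (n < N)%N ->
  ps_mul f g n = (trunc N f * trunc N g)`_n.
Proof.
move=> ltnN; rewrite coefM; apply: eq_bigr => i _.
have := ltn_ord i; rewrite ltnS => lein.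
rewrite !coef_poly (leq_ltn_trans lein ltnN).
by rewrite (leq_ltn_trans (leq_subr i n) ltnN).
Qed.

Lemma ps_mulC : commutative (@ps_mul A).
Proof.
by move=> f g; apply: funext => n; rewrite !(@ps_mul_trunc _ _ n n.+1) // mulrC.
Qed.

Lemma ps_mulA : associative (@ps_mul A).
Proof.
have E (f g h : ps A) n : ps_mul (ps_mul f g) h n =
    (trunc n.+1 f * trunc n.+1 g * trunc n.+1 h)`_n.
  rewrite coefM; apply: eq_bigr => i _.
  have := ltn_ord i; rewrite ltnS => lein.
  rewrite (@ps_mul_trunc f g i n.+1) // coef_poly.
  by rewrite ltnS leq_subr.
by move=> f g h; apply: funext => n; rewrite ps_mulC !E mulrC mulrA.
Qed.

Lemma ps_mul1 : left_id (ps_C 1) (@ps_mul A).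
Proof.
move=> f; apply: funext => n; rewrite /ps_mul big_ord_recl /= /ps_C /= mul1r subn0.
by rewrite big1 ?addr0 // => i _; rewrite mul0r.
Qed.

Lemma ps_mulDl : left_distributive (@ps_mul A) (@ps_add A).
Proof.
move=> f g h; apply: funext => n; rewrite /ps_mul /ps_add -big_split /=.
by apply: eq_bigr => i _; rewrite mulrDl.
Qed.

Lemma ps_oner_neq0 : ps_C 1 != 0 :> ps A.
Proof.
apply/eqP => /(congr1 (fun f : ps A => f 0%N)); rewrite /ps_C /=.
exact/eqP/oner_neq0.
Qed.

HB.instance Definition _ := GRing.Zmodule_isComNzRing.Build (ps A)
  ps_mulA ps_mulC ps_mul1 ps_mulDl ps_oner_neq0.

Lemma psDE f g n : (f + g) n = f n + g n. Proof. by []. Qed.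
Lemma psNE f n : (- f) n = - f n. Proof. by []. Qed.
Lemma ps0E n : (0 : ps A) n = 0. Proof. by []. Qed.
Lemma ps1E n : (1 : ps A) n = (n == 0%N)%:R.
Proof. by rewrite /GRing.one /= /ps_C; case: eqP. Qed.
Lemma psME f g n : (f * g) n = \sum_(i < n.+1) f i * g (n - i)%N.
Proof. by []. Qed.
Lemma psM_trunc f g n N : (n < N)%N -> (f * g) n = (trunc N f * trunc N g)`_n.
Proof. exact: ps_mul_trunc. Qed.
Lemma ps_sumE I (r : seq I) (P : pred I) (F : I -> ps A) n :
  (\sum_(i <- r | P i) F i) n = \sum_(i <- r | P i) F i n.
Proof. by elim/big_rec2: _ => // i x y _ <-. Qed.

Lemma ps_C_additive : zmod_morphism (@ps_C A).
Proof.
move=> a b; apply: funext => n; rewrite psDE psNE /ps_C.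
by case: eqP; rewrite ?subr0.
Qed.
HB.instance Definition _ := GRing.isZmodMorphism.Build A (ps A) (@ps_C A) ps_C_additive.

Lemma psCM c f n : (ps_C c * f) n = c * f n.
Proof.
rewrite psME big_ord_recl /= /ps_C /= subn0 big1 ?addr0 // => i _.
by rewrite mul0r.
Qed.

Lemma ps_C_monoid : monoid_morphism (@ps_C A).
Proof.
split=> // a b; apply: funext => n; rewrite psCM /ps_C.
by case: eqP; rewrite ?mulr0.
Qed.
HB.instance Definition _ := GRing.isMonoidMorphism.Build A (ps A) (@ps_C A) ps_C_monoid.

Lemma ps_scaleE c f : ps_scale c f = ps_C c * f.
Proof. by apply: funext => n; rewrite psCM. Qed.

Lemma ps_M0E f g : (f * g) 0%N = f 0%N * g 0%N.
Proof. by rewrite psME big_ord_recl big_ord0 addr0. Qed.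

Definition ps_ev0 f : A := f 0%N.
Lemma ps_ev0_additive : zmod_morphism ps_ev0. Proof. by []. Qed.
HB.instance Definition _ := GRing.isZmodMorphism.Build (ps A) A ps_ev0 ps_ev0_additive.
Lemma ps_ev0_monoid : monoid_morphism ps_ev0.
Proof. by split=> [|f g]; [rewrite /ps_ev0 ps1E | exact: ps_M0E]. Qed.
HB.instance Definition _ := GRing.isMonoidMorphism.Build (ps A) A ps_ev0 ps_ev0_monoid.

(** X-adic filtration *)

Definition psX : ps A := fun n => (n == 1%N)%:R.
Definition vge n f : Prop := forall i, (i < n)%N -> f i = 0.
Definition drop n f : ps A := fun i => f (i + n)%N.

Lemma psXnE m n : (psX ^+ m) n = (n == m)%:R.
Proof.
elim: m n => [|m IH] n; first by rewrite expr0 ps1E.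
rewrite exprS psME; case: n => [|n]; first by rewrite big_ord_recl big_ord0 mul0r addr0.
rewrite !big_ord_recl /= /psX /= mul0r add0r mul1r subn1 /= IH eqSS.
by rewrite big1 ?addr0 // => i _; rewrite mul0r.
Qed.

Lemma psXnM m f n : (psX ^+ m * f) n = if (n < m)%N then 0 else f (n - m)%N.
Proof.
rewrite psME; case: ltnP => [ltnm|lemn].
  rewrite big1 // => i _; rewrite psXnE; case: eqP => [e|]; last by rewrite mul0r.
  by have := ltn_ord i; rewrite e ltnS leqNgt ltnm.
have ltmn : (m < n.+1)%N by [].
rewrite (bigD1 (Ordinal ltmn)) //= psXnE eqxx mul1r big1 ?addr0 // => i /eqP ne.
by rewrite psXnE; case: eqP => [e|]; [case: ne; apply: val_inj | rewrite mul0r].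
Qed.

Lemma vgeW m n f : (m <= n)%N -> vge n f -> vge m f.
Proof. by move=> le H i Hi; apply: H; apply: leq_trans Hi le. Qed.
Lemma vgeD n f g : vge n f -> vge n g -> vge n (f + g).
Proof. by move=> Hf Hg i Hi; rewrite psDE Hf ?Hg ?addr0. Qed.
Lemma vgeN n f : vge n f -> vge n (- f).
Proof. by move=> Hf i Hi; rewrite psNE Hf ?oppr0. Qed.
Lemma vgeB n f g : vge n f -> vge n g -> vge n (f - g).
Proof. by move=> Hf Hg; apply/vgeD/vgeN. Qed.
Lemma vge_zero n : vge n 0. Proof. by []. Qed.
Lemma vgeM m n f g : vge m f -> vge n g -> vge (m + n) (f * g).
Proof.
move=> Hf Hg i Hi; rewrite psME big1 // => j _.
case: (ltnP j m) => Hj; first by rewrite Hf ?mul0r.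
by rewrite Hg ?mulr0 //; have := ltn_ord j; lia.
Qed.
Lemma vgeMl n f g : vge n g -> vge n (f * g).
Proof. by move=> Hg; apply: (@vgeM 0%N n). Qed.
Lemma vgeMr n f g : vge n f -> vge n (f * g).
Proof. by move=> Hf; rewrite mulrC; apply: vgeMl. Qed.
Lemma vge_exp m n f : vge m f -> vge (m * n) (f ^+ n).
Proof.
move=> Hf; elim: n => [|n IH]; first by rewrite muln0.
by rewrite exprS mulnS; apply: vgeM.
Qed.
Lemma vge_X n : vge n (psX ^+ n).
Proof. by move=> i Hi; rewrite psXnE ltn_eqF. Qed.
Lemma vge_sum I (r : seq I) (P : pred I) (F : I -> ps A) n :
  (forall i, P i -> vge n (F i)) -> vge n (\sum_(i <- r | P i) F i).
Proof. by move=> H; elim/big_rec: _ => // i x Pi Hx; apply: vgeD => //; apply: H. Qed.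

Lemma vge_drop n f : vge n f -> f = psX ^+ n * drop n f.
Proof.
move=> H; apply: funext => i; rewrite psXnM /drop; case: ltnP => Hi; first exact: H.
by rewrite subnK.
Qed.
Lemma vge_divX n f : vge n f -> exists g, f = psX ^+ n * g.
Proof. by move/vge_drop => e; exists (drop n f). Qed.
Lemma vge_all f : (forall n, vge n f) -> f = 0.
Proof. by move=> H; apply: funext => n; apply: (H n.+1). Qed.
Lemma vge_all_eq f g : (forall n, vge n (f - g)) -> f = g.
Proof. by move=> H; apply/eqP; rewrite -subr_eq0; apply/eqP/vge_all. Qed.
Lemma vgeS n f : vge n.+1 f <-> vge n f /\ f n = 0.
Proof.
split=> [H|[H e] i]; first by split; [apply: vgeW H | apply: H].
by rewrite ltnS leq_eqVlt => /orP[/eqP->|/H].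
Qed.
Lemma vge1_C f : vge 1 (f - ps_C (f 0%N)).
Proof. by move=> i; rewrite ltnS leqn0 => /eqP ->; rewrite psDE psNE /ps_C subrr. Qed.

(** An infinite sum without limits: the terms with [i > n] do not reach degree [n]. *)
Definition sumX (u : nat -> ps A) : ps A :=
  fun n => (\sum_(i < n.+1) psX ^+ i * u i) n.

Lemma sumXP u n : vge n (sumX u - \sum_(i < n) psX ^+ i * u i).
Proof.
move=> j ltjn; rewrite psDE psNE /sumX !ps_sumE.
apply/eqP; rewrite subr_eq0; apply/eqP.
rewrite -(big_mkord xpredT (fun i => (psX ^+ i * u i) j)).
rewrite -(big_mkord xpredT (fun i => (psX ^+ i * u i) j)).
rewrite (@big_cat_nat _ _ _ j.+1 0 n) //= [X in _ + X]big_nat_cond.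
rewrite [X in _ + X]big1 ?addr0 // => i; rewrite andbT => /andP[ltji _].
by rewrite psXnM ltji.
Qed.

Lemma geometric f : (1 - psX * f) * sumX (fun i => f ^+ i) = 1.
Proof.
apply: vge_all_eq => n; set s := sumX _.
have -> : (1 - psX * f) * s - 1 =
   (1 - psX * f) * (s - \sum_(i < n) psX ^+ i * f ^+ i) - (psX * f) ^+ n.
  have -> : \sum_(i < n) psX ^+ i * f ^+ i = \sum_(i < n) (psX * f) ^+ i.
    by apply: eq_bigr => i _; rewrite exprMn.
  move: (subrX1 (psX * f) n); move: (\sum_(i < n) _) (_ ^+ n) => S a E.
  have -> : a = (psX * f - 1) * S + 1 by rewrite -E subrK.
  by ring.
apply: vgeB; first by apply: vgeMl; apply: sumXP.
rewrite exprMn; apply: vgeMr; exact: vge_X.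
Qed.

Lemma ps_unit f c : f 0%N * c = 1 -> exists g, f * g = 1.
Proof.
move=> e; have [g eg] : exists g, f * ps_C c - 1 = psX ^+ 1 * g.
  apply: vge_divX => i; rewrite ltnS leqn0 => /eqP ->.
  by rewrite psDE psNE ps_M0E ps1E /ps_C /= e subrr.
exists (ps_C c * sumX (fun i => (- g) ^+ i)).
have E := geometric (- g); rewrite mulrA.
have -> : f * ps_C c = 1 - psX * - g by rewrite mulrN opprK -(subrK 1 (f * _)) eg expr1 addrC.
exact: E.
Qed.

End PowerSeriesRing.

(** * Change of coefficients, rescaling of the variable, derivatives *)

Section PowerSeriesMaps.
Variables (A B : comNzRingType) (phi : {rmorphism A -> B}).

Lemma ps_map_additive : zmod_morphism (ps_map phi).
Proof. by move=> f g; apply: funext => n; rewrite /ps_map !psDE !psNE rmorphB. Qed.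
HB.instance Definition _ :=
  GRing.isZmodMorphism.Build (ps A) (ps B) (ps_map phi) ps_map_additive.
Lemma ps_map_monoid : monoid_morphism (ps_map phi).
Proof.
split=> [|f g]; apply: funext => n; rewrite /ps_map.
  by rewrite !ps1E rmorph_nat.
by rewrite !psME rmorph_sum; apply: eq_bigr => i _; rewrite rmorphM.
Qed.
HB.instance Definition _ :=
  GRing.isMonoidMorphism.Build (ps A) (ps B) (ps_map phi) ps_map_monoid.

Lemma ps_mapE f n : ps_map phi f n = phi (f n). Proof. by []. Qed.
Lemma ps_map_C c : ps_map phi (ps_C c) = ps_C (phi c).
Proof. by apply: funext => n; rewrite ps_mapE /ps_C; case: eqP; rewrite ?rmorph0. Qed.
Lemma ps_map_X : ps_map phi (psX A) = psX B.
Proof. by apply: funext => n; rewrite ps_mapE /psX rmorph_nat. Qed.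

End PowerSeriesMaps.

Section Scaling.
Variables (A : comNzRingType) (z : A).

(** The substitution [X -> z X]. *)
Definition ps_sub (f : ps A) : ps A := fun n => z ^+ n * f n.
Lemma ps_sub_additive : zmod_morphism ps_sub.
Proof. by move=> f g; apply: funext => n; rewrite /ps_sub !psDE !psNE mulrBr. Qed.
HB.instance Definition _ :=
  GRing.isZmodMorphism.Build (ps A) (ps A) ps_sub ps_sub_additive.
Lemma ps_sub_monoid : monoid_morphism ps_sub.
Proof.
split=> [|f g]; apply: funext => n; rewrite /ps_sub.
  by rewrite !ps1E; case: n => [|n]; rewrite ?expr0 ?mulr1 ?mulr0.
rewrite !psME mulr_sumr; apply: eq_bigr => i _.
have -> : z ^+ n = z ^+ i * z ^+ (n - i).
  by rewrite -exprD subnKC //; have := ltn_ord i.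
by ring.
Qed.
HB.instance Definition _ :=
  GRing.isMonoidMorphism.Build (ps A) (ps A) ps_sub ps_sub_monoid.
Lemma ps_sub_C c : ps_sub (ps_C c) = ps_C c.
Proof.
apply: funext => n; rewrite /ps_sub /ps_C; case: eqP => [->|]; first by rewrite mul1r.
by rewrite mulr0.
Qed.
Lemma ps_sub_X : ps_sub (psX A) = ps_C z * psX A.
Proof.
apply: funext => n; rewrite psCM /ps_sub /psX.
by case: eqP => [->|]; rewrite ?expr1 ?mulr0.
Qed.
Lemma ps_sub3 : z ^+ 3 = 1 -> forall f, ps_sub (ps_sub (ps_sub f)) = f.
Proof.
move=> z3 f; apply: funext => n; rewrite /ps_sub !mulrA -!exprD.
have -> : (n + n + n = 3 * n)%N by lia.
by rewrite exprM z3 expr1n mul1r.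
Qed.
End Scaling.

Lemma ps_map_sub (A B : comNzRingType) (phi : {rmorphism A -> B}) z f :
  ps_map phi (ps_sub z f) = ps_sub (phi z) (ps_map phi f).
Proof. by apply: funext => n; rewrite /ps_map /ps_sub rmorphM rmorphXn. Qed.

Section Derivative.
Variable A : comNzRingType.
Definition ps_deriv (f : ps A) : ps A := fun n => f n.+1 *+ n.+1.
Lemma ps_derivD f g : ps_deriv (f + g) = ps_deriv f + ps_deriv g.
Proof. by apply: funext => n; rewrite /ps_deriv !psDE mulrnDl. Qed.
Lemma trunc_deriv n f : (trunc n.+1 f)^`() = trunc n (ps_deriv f).
Proof.
apply/polyP => i; rewrite coef_deriv !coef_poly ltnS.
by case: ltnP; rewrite ?mul0rn.
Qed.
Lemma ps_derivM f g : ps_deriv (f * g) = ps_deriv f * g + f * ps_deriv g.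
Proof.
apply: funext => n; rewrite /ps_deriv psDE.
rewrite (@psM_trunc _ f g n.+1 n.+2) // -coef_deriv derivM coefD.
rewrite !trunc_deriv; congr (_ + _); rewrite !coefM psME; apply: eq_bigr => i _;
  have := ltn_ord i; rewrite ltnS => lein; rewrite !coef_poly.
  by rewrite !ifT //; lia.
by rewrite !ifT //; lia.
Qed.
End Derivative.

(** * Valuations of power series over domains and fields *)

Section Valuation.
Variable A : idomainType.
Implicit Types f g h : ps A.

(** A relation rather than a function, so that the zero series needs no conventional value. *)
Definition has_val n f : Prop := vge n f /\ f n <> 0.

Lemma coef_min (R : comNzRingType) (f g : ps R) m n :
  vge m f -> vge n g -> (f * g) (m + n)%N = f m * g n.
Proof.
move=> /vge_drop -> /vge_drop ->; rewrite !psXnM !ltnn !subnn.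
have -> : psX R ^+ m * drop m f * (psX R ^+ n * drop n g) =
  psX R ^+ (m + n) * (drop m f * drop n g) by rewrite exprD; ring.
by rewrite psXnM ltnn subnn ps_M0E.
Qed.

Lemma has_val_ex f : f <> 0 -> exists n, has_val n f.
Proof.
move=> nz; have ex : exists n, f n != 0.
  apply: contrapT => H; apply: nz; apply: funext => n; apply/eqP.
  by apply: contrapT => /negP Hn; apply: H; exists n.
case: (ex_minnP ex) => n Hn Hmin; exists n; split; last exact/eqP.
by move=> i; apply: contraTeq => /Hmin; rewrite -leqNgt.
Qed.
Lemma has_val_neq0 n f : has_val n f -> f <> 0.
Proof. by move=> [_ H] e; rewrite e in H. Qed.
Lemma has_valM m n f g : has_val m f -> has_val n g -> has_val (m + n) (f * g).
Proof.
move=> [Hf /eqP nf] [Hg /eqP ng]; split; first exact: vgeM.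
by rewrite coef_min //; apply/eqP; rewrite mulf_neq0.
Qed.
Lemma has_val_exp m n f : has_val m f -> has_val (m * n) (f ^+ n).
Proof.
move=> H; elim: n => [|n IH].
  by rewrite muln0 expr0; split=> //; rewrite ps1E; apply/eqP/oner_neq0.
by rewrite exprS mulnS; apply: has_valM.
Qed.
Lemma has_val_uniq m n f : has_val m f -> has_val n f -> m = n.
Proof.
move=> [Hm nm] [Hn nn]; case: (ltngtP m n) => // [/Hn|/Hm] //.
Qed.
Lemma vge_has_val m n f : vge m f -> has_val n f -> (m <= n)%N.
Proof. by move=> Hm [_ nn]; rewrite leqNgt; apply/negP => /Hm. Qed.
Lemma ps_mulf_eq0 f g : f * g = 0 -> f = 0 \/ g = 0.
Proof.
move=> e; apply: contrapT => /not_orP[/has_val_ex[m Hm] /has_val_ex[n Hn]].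
by apply: (has_val_neq0 (has_valM Hm Hn)).
Qed.
Lemma ps_mulfI f g h : f <> 0 -> f * g = f * h -> g = h.
Proof.
move=> nz /eqP; rewrite -subr_eq0 -mulrBr => /eqP /ps_mulf_eq0[//|/eqP].
by rewrite subr_eq0 => /eqP.
Qed.
Lemma ps_expf_neq0 f n : f <> 0 -> f ^+ n <> 0.
Proof.
by move=> /has_val_ex[m Hm]; apply: has_val_neq0 (has_val_exp n Hm).
Qed.
Lemma has_val_cancel m n f g : has_val m f -> has_val (m + n) (f * g) -> has_val n g.
Proof.
move=> Hf H; have [e|/has_val_ex[j Hj]] := EM (g = 0).
  by case: (has_val_neq0 H); rewrite e mulr0.
by have /eqP := has_val_uniq H (has_valM Hf Hj); rewrite eqn_add2l => /eqP ->.
Qed.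
Lemma has_valX : has_val 1 (psX A).
Proof. by split; [rewrite -[psX A]expr1; apply: vge_X | apply/eqP/oner_neq0]. Qed.
Lemma has_valD m f g : has_val m f -> vge m.+1 g -> has_val m (f + g).
Proof.
move=> [Hf nf] Hg; split; first by apply: vgeD => //; apply: vgeW Hg.
by rewrite psDE Hg ?addr0.
Qed.
Lemma vge_or f n : vge n f \/ exists2 m, (m < n)%N & has_val m f.
Proof.
have [->|/has_val_ex[m Hm]] := EM (f = 0); first by left; apply: vge_zero.
case: (leqP n m) => H; first by left; apply: vgeW H Hm.1.
by right; exists m.
Qed.
End Valuation.

Section FieldSeries.
Variable k : fieldType.
Implicit Types f g : ps k.
Lemma ps_unit_field f : f 0%N <> 0 -> exists g, f * g = 1.
Proof. by move=> /eqP nz; apply: (@ps_unit _ _ (f 0%N)^-1); rewrite divff. Qed.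
Lemma ps_div m f g : has_val m f -> vge m g -> exists h, g = f * h.
Proof.
move=> [/vge_drop ef nf] /vge_drop eg.
have [|u eu] := @ps_unit_field (drop m f); first by rewrite /drop add0n.
exists (u * drop m g); rewrite ef eg.
have -> : psX k ^+ m * drop m f * (u * drop m (psX k ^+ m * drop m g)) =
  psX k ^+ m * (drop m f * u) * drop m (psX k ^+ m * drop m g) by ring.
by rewrite eu mulr1 -eg.
Qed.
End FieldSeries.

(** Expansions along an element *)

Section Expansion.
Variables (A E : comNzRingType) (iota : {rmorphism A -> E}) (Z : E) (K : E -> Prop).

Definition subring_prop : Prop :=
  [/\ K 1, forall x y, K x -> K y -> K (x - y) & forall x y, K x -> K y -> K (x * y)].

(** [F] is the Taylor series of [x] in powers of [Z]. Remainders are required to lie in [K] for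
    every order, which replaces any topology on [E]. *)
Definition expands (x : E) (F : ps A) : Prop :=
  forall n, exists2 r, K r & x = \sum_(i < n) iota (F i) * Z ^+ i + Z ^+ n * r.

Hypotheses (Ksub : subring_prop) (Kiota : forall c, K (iota c)) (KZ : K Z).

Lemma K0 : K 0. Proof. by have [K1 KB _] := Ksub; rewrite -(subrr 1); apply: KB. Qed.
Lemma KN x : K x -> K (- x).
Proof. by have [_ KB _] := Ksub => Kx; rewrite -sub0r; apply: KB => //; apply: K0. Qed.
Lemma KD x y : K x -> K y -> K (x + y).
Proof. by have [_ KB _] := Ksub => Kx Ky; rewrite -[y]opprK; apply/KB/KN. Qed.
Lemma KM x y : K x -> K y -> K (x * y).
Proof. by have [_ _ KM] := Ksub; apply: KM. Qed.
Lemma KX x n : K x -> K (x ^+ n).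
Proof. by case: Ksub => K1 _ KM Kx; elim: n => // n IH; rewrite exprS; apply: KM. Qed.
Lemma K_sum I (r : seq I) (P : pred I) (F : I -> E) :
  (forall i, P i -> K (F i)) -> K (\sum_(i <- r | P i) F i).
Proof.
by move=> H; elim/big_rec: _ => [|i x Pi Kx]; [exact: K0 | apply: KD => //; apply: H].
Qed.

Lemma expandsK x F : expands x F -> K x.
Proof. by move/(_ 0%N) => [r Kr ->]; rewrite big_ord0 add0r mul1r. Qed.
Lemma expandsD x y F G : expands x F -> expands y G -> expands (x + y) (F + G).
Proof.
move=> Hx Hy n; have [r Kr ->] := Hx n; have [u Ku ->] := Hy n.
exists (r + u); first exact: KD.
under [in RHS]eq_bigr => i _ do rewrite psDE rmorphD mulrDl.
by rewrite big_split mulrDr /=; ring.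
Qed.
Lemma expandsN x F : expands x F -> expands (- x) (- F).
Proof.
move=> Hx n; have [r Kr ->] := Hx n; exists (- r); first exact: KN.
under [in RHS]eq_bigr => i _ do rewrite psNE rmorphN mulNr.
by rewrite sumrN; ring.
Qed.
Lemma expandsC c : expands (iota c) (ps_C c).
Proof.
case=> [|n]; first by exists (iota c) => //; rewrite big_ord0 add0r mul1r.
exists 0; first exact: K0.
rewrite big_ord_recl big1 /ps_C /= ?mulr0 ?mulr1 ?addr0 // => i _.
by rewrite rmorph0 mul0r.
Qed.
Lemma expands1 : expands 1 1. Proof. by rewrite -(rmorph1 iota); apply: expandsC. Qed.
Lemma expandsZ : expands Z (psX A).
Proof.
case=> [|[|n]]; first by exists Z => //; rewrite big_ord0 add0r mul1r.
  exists 1; first by case: Ksub.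
  by rewrite big_ord_recl big_ord0 /psX /= rmorph0 mul0r !add0r mulr1.
exists 0; first exact: K0.
rewrite !big_ord_recl big1 => [|i _]; rewrite /psX /= ?rmorph0 ?rmorph1; first by ring.
by rewrite mul0r.
Qed.

Let ev (p : {poly A}) := (map_poly iota p).[Z].
Lemma ev_trunc n F : ev (trunc n F) = \sum_(i < n) iota (F i) * Z ^+ i.
Proof.
have -> : \sum_(i < n) iota (F i) * Z ^+ i = (\poly_(i < n) iota (F i)).[Z].
  by rewrite horner_poly.
rewrite /ev; apply: (congr1 (fun p : {poly E} => p.[Z])); apply/polyP => i.
rewrite coef_map !coef_poly; case: ltnP => _ /=; first by []. 
exact: rmorph0.
Qed.
Lemma K_ev p : K (ev p).
Proof.
rewrite /ev horner_coef; apply: K_sum => i _; apply: KM; last exact: KX.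
by rewrite coef_map; apply: Kiota.
Qed.
Lemma expandsM x y F G : expands x F -> expands y G -> expands (x * y) (F * G).
Proof.
move=> Hx Hy n; have [r Kr ->] := Hx n; have [u Ku ->] := Hy n.
have -> : \sum_(i < n) iota ((F * G) i) * Z ^+ i = ev (take_poly n (trunc n F * trunc n G)).
  rewrite -ev_trunc; congr (ev _); apply/polyP => i; rewrite coef_take_poly coef_poly.
  by case: ltnP => // ltin; rewrite -(@psM_trunc _ F G i n).
rewrite -!ev_trunc.
(* The remainder collects the part of degree at least [n] of the product of the truncations and the
   terms that contain [r] or [u]. *)
exists (ev (drop_poly n (trunc n F * trunc n G)) + ev (trunc n F) * u +
        r * (ev (trunc n G) + Z ^+ n * u)).
  have Kn := KX n KZ; have := K_ev.
  by move=> Kev; do ?[apply: KD | apply: KM].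
have evM p q : ev (p * q) = ev p * ev q by rewrite /ev rmorphM hornerM.
have E0 : ev (trunc n F * trunc n G) = ev (take_poly n (trunc n F * trunc n G)) +
    ev (drop_poly n (trunc n F * trunc n G)) * Z ^+ n.
  have evD p q : ev (p + q) = ev p + ev q by rewrite /ev rmorphD hornerD.
  have evX : ev 'X^n = Z ^+ n by rewrite /ev map_polyXn hornerXn.
  by rewrite -evX -evM -evD poly_take_drop.
move: E0; rewrite evM; move: (ev (trunc n F)) (ev (trunc n G)) (ev (take_poly _ _))
  (ev (drop_poly _ _)) (Z ^+ n) => a b c d e E0.
have -> : (a + e * r) * (b + e * u) = a * b + e * (a * u + r * (b + e * u)) by ring.
by rewrite E0; ring.
Qed.

Hypothesis Zreg : forall x y, K x -> K y -> Z * x = Z * y -> x = y.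

Lemma expands_step x F : expands x F ->
  exists2 y, x = iota (F 0%N) + Z * y & expands y (drop 1 F).
Proof.
move=> H; have [y Ky e] := H 1%N; rewrite big_ord_recl big_ord0 addr0 mulr1 expr1 in e.
exists y => // n; have [r Kr e2] := H n.+1; exists r => //.
move: e2; rewrite big_ord_recl /= mulr1 e -addrA => /addrI.
have -> : \sum_(i < n) iota (F (bump 0 i)) * Z ^+ bump 0 i =
  Z * \sum_(i < n) iota (drop 1 F i) * Z ^+ i.
  by rewrite mulr_sumr; apply: eq_bigr => i _; rewrite /drop addn1 exprS; ring.
rewrite exprS -mulrA -mulrDr => /Zreg; apply=> //.
apply: KD; last by apply: KM => //; apply: KX.
by apply: K_sum => i _; apply: KM => //; apply: KX.
Qed.

(** Constants divisible by [Z] vanish, so the constant terms agree; [Z] being regular, both tails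
    then expand the same element, and induction applies. *)
Lemma expands_uniq x F G :
  (forall c y, K y -> iota c = Z * y -> c = 0) ->
  expands x F -> expands x G -> F = G.
Proof.
move=> inj HF HG.
have H0 x' F' G' : expands x' F' -> expands x' G' -> F' 0%N = G' 0%N /\
    exists2 y, expands y (drop 1 F') & expands y (drop 1 G').
  move=> /expands_step[y e Hy] /expands_step[u e2 Hu].
  have E0 : iota (F' 0%N) = iota (G' 0%N) + Z * u - Z * y by rewrite -e2 e addrK.
  have E1 : F' 0%N = G' 0%N.
    apply/eqP; rewrite -subr_eq0; apply/eqP; apply: (inj _ (u - y)).
      by case: Ksub => _ KB _; apply: KB; [apply: expandsK Hu | apply: expandsK Hy].
    by rewrite rmorphB E0; ring.
  split=> //; exists y => //; suff -> : y = u by [].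
  apply: Zreg; [apply: expandsK Hy | apply: expandsK Hu|].
  by apply: (addrI (iota (F' 0%N))); rewrite -e {1}E1.
apply: funext => n; elim: n x F G HF HG => [|n IH] x F G HF HG.
  by have [] := H0 _ _ _ HF HG.
have [_ [y Hy Hu]] := H0 _ _ _ HF HG.
by have := IH _ _ _ Hy Hu; rewrite /drop !addn1.
Qed.

Lemma expands_inj x y F : (forall u, (forall n, exists2 r, K r & u = Z ^+ n * r) -> u = 0) ->
  expands x F -> expands y F -> x = y.
Proof.
move=> sep Hx Hy; apply/eqP; rewrite -subr_eq0; apply/eqP/sep => n.
have [r Kr ->] := Hx n; have [u Ku ->] := Hy n; exists (r - u).
  by case: Ksub => _ KB _; apply: KB.
by ring.
Qed.

End Expansion.

(** Once the division step is made a function by choice, its iterates give the coefficients and the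
    remainders together. *)
Lemma expands_ex (A E : comNzRingType) (iota : {rmorphism A -> E}) Z (K : E -> Prop) :
  (forall x, K x -> exists c, exists2 y, K y & x = iota c + Z * y) ->
  forall x, K x -> exists F, expands iota Z K x F.
Proof.
move=> H.
have [|f Hf] := @choice E (A * E)%type (fun x y => K x -> K y.2 /\ x = iota y.1 + Z * y.2).
  move=> x; have [Kx|nKx] := EM (K x); last by exists (0, 0).
  by have [c [y Ky e]] := H x Kx; exists (c, y).
move=> x Kx; pose u n := iter n (fun y => (f y).2) x; exists (fun n => (f (u n)).1) => n.
exists (u n); first by elim: n => //= n IH; have [] := Hf _ IH.
have Ku m : K (u m) by elim: m => //= m IH; have [] := Hf _ IH.
elim: n => [|n IH]; first by rewrite big_ord0 add0r mul1r.
rewrite big_ord_recr /= {1}IH exprS -addrA; congr (_ + _).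
by have [_ {1}->] := Hf _ (Ku n); rewrite -/(u n); ring.
Qed.

(** Composition of power series *)

Section Composition.
Variables (A : comNzRingType) (t : ps A).
Hypothesis t1 : vge 1 t.

(** The composite [f(t)]. As [t] has no constant term, [t = X * drop 1 t], so the term of index [i]
    is a multiple of [X^i] and [sumX] applies. *)
Definition ps_comp (f : ps A) : ps A := sumX (fun i => ps_C (f i) * drop 1 t ^+ i).

Lemma ps_comp_trunc f n : vge n (ps_comp f - \sum_(i < n) ps_C (f i) * t ^+ i).
Proof.
have -> : \sum_(i < n) ps_C (f i) * t ^+ i =
    \sum_(i < n) psX A ^+ i * (ps_C (f i) * drop 1 t ^+ i).
  apply: eq_bigr => i _; rewrite {1}(vge_drop t1) expr1 exprMn.
  by move: (ps_C _) (psX A ^+ i) (drop 1 t ^+ i) => x y z; ring.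
exact: sumXP.
Qed.

Lemma ps_comp_step f : ps_comp f = ps_C (f 0%N) + t * ps_comp (drop 1 f).
Proof.
apply: vge_all_eq => n.
have -> : ps_comp f - (ps_C (f 0%N) + t * ps_comp (drop 1 f)) =
  (ps_comp f - \sum_(i < n.+1) ps_C (f i) * t ^+ i) -
  t * (ps_comp (drop 1 f) - \sum_(i < n) ps_C (drop 1 f i) * t ^+ i).
  have -> : \sum_(i < n.+1) ps_C (f i) * t ^+ i =
     ps_C (f 0%N) + t * \sum_(i < n) ps_C (drop 1 f i) * t ^+ i.
    rewrite big_ord_recl mulr1; congr (_ + _); rewrite mulr_sumr.
    by apply: eq_bigr => i _; rewrite /drop addn1 exprS mulrCA.
  by ring.
apply: vgeB; first by exact: vgeW (leqnSn n) (@ps_comp_trunc f n.+1).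
by apply: vgeMl; apply: ps_comp_trunc.
Qed.

Lemma ps_comp_expands f : expands (@ps_C A) t (fun=> True) (ps_comp f) f.
Proof.
move=> n; exists (ps_comp (drop n f)) => //.
elim: n => [|n IH]; first by rewrite big_ord0 add0r mul1r /drop; congr ps_comp;
   apply: funext => i; rewrite addn0.
rewrite {1}IH big_ord_recr /= ps_comp_step /drop add0n exprSr -addrA mulrDr.
rewrite [ps_C _ * _]mulrC mulrA; congr (_ + (_ + _ * ps_comp _)).
by apply: funext => i; rewrite addn1 addSnnS.
Qed.

(** Characterized by its expansion, the composite inherits the morphism laws from [expandsD] and
    [expandsM]. *)
Lemma ps_comp_uniq x f : expands (@ps_C A) t (fun=> True) x f -> x = ps_comp f.
Proof.
move=> H; apply: vge_all_eq => n.
have [r _ ->] := H n; have [u _ ->] := ps_comp_expands f n.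
have -> (a b c d : ps A) : a + b * c - (a + b * d) = b * (c - d) by ring.
by apply: vgeMr; have := @vge_exp _ 1 n _ t1; rewrite mul1n.
Qed.

Let TT : subring_prop (fun=> True : Prop) (E := ps A). Proof. by []. Qed.

Lemma ps_comp_additive : zmod_morphism ps_comp.
Proof.
move=> f g; apply/esym/ps_comp_uniq/(expandsD TT); first exact: ps_comp_expands.
by apply/(expandsN TT)/ps_comp_expands.
Qed.
Lemma ps_comp_monoid : monoid_morphism ps_comp.
Proof.
split; first by apply/esym/ps_comp_uniq/expands1.
by move=> f g; apply/esym/ps_comp_uniq/(expandsM TT) => //; apply: ps_comp_expands.
Qed.
Lemma ps_comp_C c : ps_comp (ps_C c) = ps_C c.
Proof. by apply/esym/ps_comp_uniq/expandsC. Qed.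
Lemma ps_comp_X : ps_comp (psX A) = t.
Proof. by apply/esym/ps_comp_uniq/expandsZ. Qed.
End Composition.

Lemma has_val_comp (A : idomainType) (t f : ps A) m n :
  has_val m t -> (0 < m)%N -> has_val n f -> has_val (m * n) (ps_comp t f).
Proof.
move=> Ht m0 [Hf nf]; have t1 : vge 1 t by apply: vgeW Ht.1.
have [r _ e] := ps_comp_expands t1 f n.+1.
have {}e : ps_comp t f = ps_C (f n) * t ^+ n + t ^+ n.+1 * r.
  rewrite e big_ord_recr /= big1 ?add0r // => i _.
  by rewrite Hf ?rmorph0 ?mul0r.
rewrite e; apply: has_valD; last first.
  by apply: vgeMr; apply: (@vgeW _ _ (m * n.+1)); [rewrite mulnS; lia | apply: vge_exp Ht.1].
rewrite -[(m * n)%N]add0n; apply: has_valM; last exact: has_val_exp.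
by split=> //; rewrite /ps_C.
Qed.

Lemma ps_comp_inj (A : idomainType) (t : ps A) m f :
  has_val m t -> (0 < m)%N -> ps_comp t f = 0 -> f = 0.
Proof.
move=> Ht m0 e; apply: contrapT => /has_val_ex[n Hn].
by apply: (has_val_neq0 (has_val_comp Ht m0 Hn)).
Qed.
(** A complete discrete valuation ring with residue field k *)

(** The ring [C[Y]/(Y^2 - d)], with [(a, b)] standing for [a + b Y]; the parameter [d] only serves
    to select the ring structure. *)
Definition sqrt_ext (C : comNzRingType) (d : C) : Type := (C * C)%type.

Section SqrtExt.
Variables (C : comNzRingType) (d : C).
Local Notation Q := (sqrt_ext d).
HB.instance Definition _ := GRing.Zmodule.copy Q (C * C)%type.
Definition sqrt_mul (x y : Q) : Q :=
  (x.1 * y.1 + d * (x.2 * y.2), x.1 * y.2 + x.2 * y.1).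
Definition sqrt_one : Q := (1, 0).
Lemma sqrt_mulA : associative sqrt_mul.
Proof. by move=> [a b] [a' b'] [a'' b'']; congr pair; rewrite /=; ring. Qed.
Lemma sqrt_mulC : commutative sqrt_mul.
Proof. by move=> [a b] [a' b']; congr pair; rewrite /=; ring. Qed.
Lemma sqrt_mul1 : left_id sqrt_one sqrt_mul.
Proof. by move=> [a b]; congr pair; rewrite /=; ring. Qed.
Lemma sqrt_mulDl : left_distributive sqrt_mul +%R.
Proof. by move=> [a b] [a' b'] [a'' b'']; congr pair; rewrite /=; ring. Qed.
Lemma sqrt_one_neq0 : sqrt_one != 0.
Proof. by rewrite xpair_eqE negb_and oner_neq0. Qed.
HB.instance Definition _ := GRing.Zmodule_isComNzRing.Build Q
  sqrt_mulA sqrt_mulC sqrt_mul1 sqrt_mulDl sqrt_one_neq0.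
Lemma sqrt_mulE (x y : Q) :
  x * y = (x.1 * y.1 + d * (x.2 * y.2), x.1 * y.2 + x.2 * y.1).
Proof. by []. Qed.
End SqrtExt.

(* The ring Z[2^(1/2^j)], abstractly. *)
Lemma dyadic_root_ring j : exists (O : comNzRingType) (p : O),
  [/\ p ^+ (2 ^ j) = 2%:R,
      forall x, p * x = 0 -> x = 0,
      forall x, (exists y, x = p * y) \/ (exists y, x = 1 + p * y) &
      forall y, 1 <> p * y].
Proof.
elim: j => [|j [O [p [pj preg pres p1]]]].
  exists int, 2; split=> [//|x /eqP|x|y].
  - by rewrite mulf_eq0 => /orP[//|/eqP].
  - have [e|e] := boolP (2 %| x)%Z; [left | right].
      by have /dvdzP[y ->] := e; exists y; rewrite mulrC.
    have : (2 %| x - 1)%Z by lia.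
    by case/dvdzP=> y ey; exists y; rewrite [2 * _]mulrC -ey addrC subrK.
  - by lia.
(* Multiplication by this square root of [p] swaps the coordinates up to a factor [p], so residues
   modulo [q] are those of the first coordinate modulo [p]. *)
pose q : sqrt_ext p := (0, 1).
have q2 : q ^+ 2 = (p, 0).
  by rewrite expr2 sqrt_mulE /q /=; congr pair; ring.
have inj n (x : O) : ((x, 0) : sqrt_ext p) ^+ n = (x ^+ n, 0).
  by elim: n => // n IH; rewrite !exprS IH sqrt_mulE /=; congr pair; ring.
have qE (x : sqrt_ext p) : q * x = (p * x.2, x.1).
  by rewrite sqrt_mulE /=; congr pair; ring.
exists (sqrt_ext p), q; split.
- by rewrite expnS exprM q2 inj pj -[2]/(1 + 1) mulr2n; congr pair; rewrite /= addr0.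
- by move=> [a b]; rewrite qE => -[/= /preg -> ->].
- case=> a b; have [[y ->]|[y ->]] := pres a; [left | right]; exists (b, y); rewrite qE //=.
  by congr pair; rewrite /= ?add0r.
- by move=> [a b]; rewrite qE => -[/= /p1].
Qed.

(** * The monoid ring of [k] over [O] and its augmentation *)

Section MonoidRing.
Variables (O : comNzRingType) (k : fieldType).

Definition fin_sum (l : seq (O * k)) (phi : k -> O) : O :=
  \sum_(x <- l) x.1 * phi x.2.

(* The monoid ring O[k, *]; the element sum o_i [a_i] is encoded as the
   functional phi |-> sum o_i phi(a_i), so that the product is the
   convolution of functionals. *)
Definition mring : Type := {I : (k -> O) -> O | exists l, I = fin_sum l}.
HB.instance Definition _ := gen_eqMixin mring.
HB.instance Definition _ := gen_choiceMixin mring.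

Definition mval (x : mring) : (k -> O) -> O := sval x.
Lemma mval_inj (x y : mring) : mval x =1 mval y -> x = y.
Proof. by case: x y => [I HI] [J HJ] /= /funext e; apply: eq_exist. Qed.
Lemma mval_rep (x : mring) : exists l, mval x = fin_sum l.
Proof. by case: x. Qed.

Definition of_list (l : seq (O * k)) : mring := exist _ (fin_sum l) (ex_intro _ l erefl).
Lemma mring_rep (x : mring) : exists l, x = of_list l.
Proof. by have [l e] := mval_rep x; exists l; apply: mval_inj => phi; rewrite e. Qed.


Lemma madd_subproof (x y : mring) : exists l, (fun phi => mval x phi + mval y phi) = fin_sum l.
Proof.
have [l1 ->] := mval_rep x; have [l2 ->] := mval_rep y; exists (l1 ++ l2).
by apply: funext => phi; rewrite /fin_sum big_cat.
Qed.
Definition madd (x y : mring) : mring := exist _ _ (madd_subproof x y).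
Lemma mopp_subproof (x : mring) : exists l, (fun phi => - mval x phi) = fin_sum l.
Proof.
have [l ->] := mval_rep x; exists [seq (- i.1, i.2) | i <- l].
apply: funext => phi; rewrite /fin_sum big_map -sumrN.
by apply: eq_bigr => i _; rewrite mulNr.
Qed.
Definition mopp (x : mring) : mring := exist _ _ (mopp_subproof x).
Lemma mmul_subproof (x y : mring) :
  exists l, (fun phi => mval x (fun a => mval y (fun b => phi (a * b)))) = fin_sum l.
Proof.
have [l1 ->] := mval_rep x; have [l2 ->] := mval_rep y.
exists [seq (i.1 * j.1, i.2 * j.2) | i <- l1, j <- l2].
apply: funext => phi; rewrite /fin_sum big_allpairs_dep.
apply: eq_bigr => i _; rewrite mulr_sumr; apply: eq_bigr => j _.
by rewrite mulrA.
Qed.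
Definition mmul (x y : mring) : mring := exist _ _ (mmul_subproof x y).

Lemma maddA : associative madd.
Proof. by move=> x y z; apply: mval_inj => phi; rewrite /= addrA. Qed.
Lemma maddC : commutative madd.
Proof. by move=> x y; apply: mval_inj => phi; rewrite /= addrC. Qed.
Lemma madd0 : left_id (of_list [::]) madd.
Proof. by move=> x; apply: mval_inj => phi; rewrite /= /fin_sum big_nil add0r. Qed.
Lemma maddN : left_inverse (of_list [::]) mopp madd.
Proof. by move=> x; apply: mval_inj => phi; rewrite /= /fin_sum big_nil addNr. Qed.
HB.instance Definition _ := GRing.isZmodule.Build mring maddA maddC madd0 maddN.

Lemma mmulA : associative mmul.
Proof.
move=> x y z; apply: mval_inj => phi /=.
by congr (mval x); apply: funext => a; congr (mval y); apply: funext => b;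
   congr (mval z); apply: funext => c; rewrite mulrA.
Qed.
Lemma mmulC : commutative mmul.
Proof.
move=> x y; apply: mval_inj => phi /=.
have [l1 ->] := mval_rep x; have [l2 ->] := mval_rep y; rewrite /fin_sum.
under eq_bigr => i _ do rewrite mulr_sumr.
under [RHS]eq_bigr => i _ do rewrite mulr_sumr.
rewrite exchange_big /=; apply: eq_bigr => i _; apply: eq_bigr => j _.
by rewrite [X in phi X]mulrC; ring.
Qed.
Lemma mmul1 : left_id (of_list [:: (1, 1)]) mmul.
Proof.
move=> x; apply: mval_inj => phi /=; rewrite /fin_sum big_seq1 mul1r.
by congr (mval x); apply: funext => b; rewrite mul1r.
Qed.
Lemma mmulDl : left_distributive mmul madd.
Proof. by move=> x y z; apply: mval_inj => phi. Qed.
Lemma mone_neq0 : of_list [:: (1, 1)] != of_list [::].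
Proof.
apply/eqP => /(congr1 (fun x => mval x (fun=> 1))) /=.
by rewrite /fin_sum big_seq1 big_nil mulr1 => /eqP; rewrite oner_eq0.
Qed.
HB.instance Definition _ := GRing.Zmodule_isComNzRing.Build mring
  mmulA mmulC mmul1 mmulDl mone_neq0.

Definition teich (a : k) : mring := of_list [:: (1, a)].
Definition mscal (o : O) : mring := of_list [:: (o, 1)].

Lemma mvalM (x y : mring) phi :
  mval (x * y) phi = mval x (fun a => mval y (fun b => phi (a * b))).
Proof. by []. Qed.
Lemma mvalD (x y : mring) phi : mval (x + y) phi = mval x phi + mval y phi.
Proof. by []. Qed.
Lemma mval_scal o phi : mval (mscal o) phi = o * phi 1.
Proof. by rewrite /= /fin_sum big_seq1. Qed.
Lemma mval_teich a phi : mval (teich a) phi = phi a.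
Proof. by rewrite /= /fin_sum big_seq1 mul1r. Qed.
Lemma mval_scalM o x phi : mval (mscal o * x) phi = o * mval x phi.
Proof.
by rewrite mvalM mval_scal; congr (_ * mval x _); apply: funext => b; rewrite mul1r.
Qed.
Lemma teich1 : teich 1 = 1. Proof. by []. Qed.
Lemma teichM a b : teich (a * b) = teich a * teich b.
Proof. by apply: mval_inj => phi; rewrite mvalM !mval_teich. Qed.

Lemma mscal_additive : zmod_morphism mscal.
Proof.
move=> a b; apply: mval_inj => phi; rewrite mvalD mval_scal.
by rewrite [mval (- _) _]/= -/(mval _ phi) !(mval_scal, mulrBl) // /fin_sum big_seq1.
Qed.
HB.instance Definition _ := GRing.isZmodMorphism.Build O mring mscal mscal_additive.
Lemma mscal_monoid : monoid_morphism mscal.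
Proof.
by split=> // a b; apply: mval_inj => phi; rewrite mval_scalM !mval_scal mulrA.
Qed.
HB.instance Definition _ := GRing.isMonoidMorphism.Build O mring mscal mscal_monoid.

Lemma of_list_cons i l : of_list (i :: l) = mscal i.1 * teich i.2 + of_list l.
Proof.
apply: mval_inj => phi; rewrite mvalD mval_scalM mval_teich /=.
by rewrite /fin_sum big_cons.
Qed.

Lemma mring_ind (P : mring -> Prop) : P 0 ->
  (forall o a x, P x -> P (mscal o * teich a + x)) -> forall x, P x.
Proof.
move=> P0 PD x; have [l ->] := mring_rep x; elim: l => [//|i l IH].
by rewrite of_list_cons; apply: PD.
Qed.

Section PushForward.
Variable s : k -> k.
Hypotheses (sM : {morph s : a b / a * b}) (s1 : s 1 = 1).
Lemma mpush_subproof (x : mring) : exists l, (fun phi => mval x (phi \o s)) = fin_sum l.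
Proof.
have [l ->] := mval_rep x; exists [seq (i.1, s i.2) | i <- l].
by apply: funext => phi; rewrite /fin_sum big_map.
Qed.
(** The ring endomorphism [[a] -> [s a]]. Squaring on [k] and its inverse will give a Frobenius lift
    and its inverse. *)
Definition mpush (x : mring) : mring := exist _ _ (mpush_subproof x).
Lemma mval_push x phi : mval (mpush x) phi = mval x (phi \o s). Proof. by []. Qed.
Lemma mpush_additive : zmod_morphism mpush.
Proof. by move=> x y; apply: mval_inj. Qed.
Lemma mpush_monoid : monoid_morphism mpush.
Proof.
split=> [|x y]; apply: mval_inj => phi.
  by rewrite mval_push -teich1 !mval_teich /= s1.
rewrite mval_push !mvalM [in RHS]mval_push; congr (mval x); apply: funext => a.
by rewrite /comp mval_push; congr (mval y); apply: funext => b; rewrite /= sM.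
Qed.
Lemma mpush_scal o : mpush (mscal o) = mscal o.
Proof. by apply: mval_inj => phi; rewrite mval_push !mval_scal /= s1. Qed.
Lemma mpush_teich a : mpush (teich a) = teich (s a).
Proof. by apply: mval_inj => phi; rewrite mval_push !mval_teich. Qed.
End PushForward.

End MonoidRing.

Section Augmentation.
Variables (O : comNzRingType) (k : fieldType).
Local Notation mring := (mring O k).
Variable r : {rmorphism O -> k}.
Definition aug_list (l : seq (O * k)) : k := \sum_(i <- l) r i.1 * i.2.
(** The functional recovers the total coefficient at each point by evaluation on the indicator
    function of that point, so the augmentation does not depend on the list. *)
Lemma aug_list_eq l1 l2 : fin_sum l1 = fin_sum l2 -> aug_list l1 = aug_list l2.
Proof.
have H (s : seq k) l : uniq s -> {subset map snd l <= s} ->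
    aug_list l = \sum_(b <- s) r (fin_sum l (fun a => (a == b)%:R)) * b.
  move=> us sub; rewrite /aug_list big_seq.
  under [RHS]eq_bigr => b _ do rewrite /fin_sum rmorph_sum mulr_suml.
  rewrite exchange_big /= [RHS]big_seq; apply: eq_bigr => i il.
  rewrite (bigD1_seq i.2) //=; last by apply: sub; apply: map_f.
  rewrite eqxx mulr1 big1 ?addr0 // => b nb.
  by rewrite eq_sym (negPf nb) mulr0 rmorph0 mul0r.
move=> e; pose s := undup (map snd (l1 ++ l2)).
have us : uniq s by apply: undup_uniq.
rewrite (H s l1) // ?(H s l2) // ?e // => b; rewrite mem_undup map_cat mem_cat => ->.
  by rewrite orbT.
by [].
Qed.
Definition aug (x : mring) : k := aug_list (projT1 (cid (mval_rep x))).
Lemma aug_rep x l : mval x = fin_sum l -> aug x = aug_list l.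
Proof. by rewrite /aug; case: cid => l' /= e e'; apply: aug_list_eq; rewrite -e. Qed.
Lemma aug_additive : zmod_morphism aug.
Proof.
move=> x y; have [l1 e1] := mval_rep x; have [l2 e2] := mval_rep y.
rewrite (aug_rep e1) (aug_rep e2) (@aug_rep _ (l1 ++ [seq (- i.1, i.2) | i <- l2])).
  rewrite /aug_list big_cat big_map; congr (_ + _); rewrite -sumrN.
  by apply: eq_bigr => i _; rewrite rmorphN mulNr.
apply: funext => phi; rewrite mvalD /= e1 e2 /fin_sum big_cat big_map -sumrN.
by congr (_ + _); apply: eq_bigr => i _; rewrite mulNr.
Qed.
HB.instance Definition _ := GRing.isZmodMorphism.Build mring k aug aug_additive.
Lemma aug_teich a : aug (teich O a) = a.
Proof. by rewrite (@aug_rep _ [:: (1, a)]) // /aug_list big_seq1 rmorph1 mul1r. Qed.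
Lemma aug_scal o : aug (mscal k o) = r o.
Proof. by rewrite (@aug_rep _ [:: (o, 1)]) // /aug_list big_seq1 mulr1. Qed.
Lemma aug_monoid : monoid_morphism aug.
Proof.
split=> [|x y]; first by rewrite -(teich1 O k) aug_teich.
have [l1 e1] := mval_rep x; have [l2 e2] := mval_rep y.
rewrite (aug_rep e1) (aug_rep e2).
rewrite (@aug_rep _ [seq (i.1 * j.1, i.2 * j.2) | i <- l1, j <- l2]).
  rewrite /aug_list big_allpairs_dep mulr_suml; apply: eq_bigr => i _.
  by rewrite mulr_sumr; apply: eq_bigr => j _; rewrite /= rmorphM; ring.
apply: funext => phi; rewrite mvalM e1 e2 /fin_sum big_allpairs_dep.
by apply: eq_bigr => i _; rewrite mulr_sumr; apply: eq_bigr => j _; rewrite mulrA.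
Qed.
HB.instance Definition _ := GRing.isMonoidMorphism.Build mring k aug aug_monoid.
End Augmentation.

(** * Completion along the kernel of [th], by digit sequences *)

Section Digits.
Variables (A : comNzRingType) (k : fieldType) (p : A) (th : {rmorphism A -> k}).
Variables (te : k -> A) (F G : {rmorphism A -> A}).
Hypotheses (preg : forall x, p * x = 0 -> x = 0) (thp : th p = 0).
Hypotheses (thte : forall c, th (te c) = c) (te1 : te 1 = 1)
  (teM : forall a b, te (a * b) = te a * te b).
Hypotheses (Fp : F p = p) (FG : forall x, F (G x) = x) (GF : forall x, G (F x) = x)
  (Fsq : forall x, exists y, F x = x ^+ 2 + p * y) (p2 : exists c, 2%:R = p * c).

(* Powers of the ideal ker th. *)
Inductive Ip : nat -> A -> Prop :=
| Ip0 x : Ip 0 x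
| IpM n a b : th a = 0 -> Ip n b -> Ip n.+1 (a * b)
| IpD n x y : Ip n.+1 x -> Ip n.+1 y -> Ip n.+1 (x + y).

Lemma Ip_add n x y : Ip n x -> Ip n y -> Ip n (x + y).
Proof. by case: n => [|n] Hx Hy; [exact: Ip0 | apply: IpD]. Qed.
Lemma Ip_mull n x c : Ip n x -> Ip n (c * x).
Proof.
elim=> [y|m a b Ha _ IH|m y z _ IHy _ IHz]; first exact: Ip0.
  by rewrite mulrCA; apply: IpM.
by rewrite mulrDr; apply: IpD.
Qed.
Lemma Ip_mulr n x c : Ip n x -> Ip n (x * c).
Proof. by move=> H; rewrite mulrC; apply: Ip_mull. Qed.
Lemma Ip_pred n x : Ip n x -> Ip n.-1 x.
Proof.
elim=> [y|m a b Ha Hb _|[|m] y z _ IHy _ IHz] /=; try exact: Ip0.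
  exact: Ip_mull.
exact: IpD.
Qed.
Lemma Ip_W m n x : (m <= n)%N -> Ip n x -> Ip m x.
Proof.
move=> lemn; rewrite -(subnKC lemn); elim: (n - m)%N => [|j IH]; first by rewrite addn0.
by rewrite addnS => /Ip_pred.
Qed.
Lemma Ip_zero n : Ip n 0.
Proof. by case: n => [|n]; [exact: Ip0 | rewrite -(mul0r 0); elim: n => [|n IH]; 
  apply: IpM; rewrite ?rmorph0 //; [exact: Ip0 | rewrite -(mul0r 0)]]. Qed.
Lemma Ip_opp n x : Ip n x -> Ip n (- x).
Proof. by move=> H; rewrite -mulN1r; apply: Ip_mull. Qed.
Lemma Ip_mul m n x y : Ip m x -> Ip n y -> Ip (m + n) (x * y).
Proof.
move=> Hx Hy; elim: Hx => [z|j a b Ha _ IH|j z w _ IHz _ IHw].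
- exact: Ip_mull.
- by rewrite -mulrA; apply: IpM.
- by rewrite mulrDl; apply: IpD.
Qed.
Lemma Ip1_th x : Ip 1 x -> th x = 0.
Proof.
move=> H; have : forall m y, Ip m y -> m = 1%N -> th y = 0; last by apply; first exact: H.
move=> m y; elim=> [//|j a b Ha _ _ _|j z w _ IHz _ IHw e]; first by rewrite rmorphM Ha mul0r.
by rewrite rmorphD IHz ?IHw ?addr0.
Qed.
Lemma th_Ip1 x : th x = 0 -> Ip 1 x.
Proof. by move=> H; rewrite -[x]mulr1; apply: IpM => //; apply: Ip0. Qed.

Lemma thF x : th (F x) = th x ^+ 2.
Proof. by have [y ->] := Fsq x; rewrite rmorphD rmorphM thp mul0r addr0 rmorphXn. Qed.
Lemma thG x : th x = 0 -> th (G x) = 0.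
Proof. by rewrite -{1}[x]FG thF => /eqP; rewrite expf_eq0 => /eqP. Qed.

Lemma Ip_F n x : Ip n x -> Ip n (F x).
Proof.
elim=> [y|m a b Ha _ IH|m y z _ IHy _ IHz]; first exact: Ip0.
  by rewrite rmorphM; apply: IpM => //; rewrite thF Ha expr0n.
by rewrite rmorphD; apply: IpD.
Qed.
Lemma Ip_G n x : Ip n x -> Ip n (G x).
Proof.
elim=> [y|m a b Ha _ IH|m y z _ IHy _ IHz]; first exact: Ip0.
  by rewrite rmorphM; apply: IpM => //; apply: thG.
by rewrite rmorphD; apply: IpD.
Qed.

(* As k is perfect, x = F(G x) is congruent to the square of G x modulo p. *)
Lemma ker_decomp x : th x = 0 -> exists y z, x = p * y + z /\ Ip 2 z.
Proof.
move=> Hx; have [y ey] := Fsq (G x); exists y, (G x ^+ 2).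
rewrite FG in ey; split; first by rewrite addrC.
by rewrite expr2; apply: (@Ip_mul 1 1); apply/th_Ip1/thG.
Qed.
(** With [Ip_cancel] this makes [I^n / I^(n+1)] a line over [k] spanned by [p^n], where [I] is the
    kernel of [th]: hence the existence and the uniqueness of digits. *)
Lemma Ip_decomp n x : Ip n x -> exists y z, x = p ^+ n * y + z /\ Ip n.+1 z.
Proof.
elim=> [y|m a b Ha Hb [y [z [eb Hz]]]|m u v _ [y [z [eu Hz]]] _ [y' [z' [ev Hz']]]].
- by exists y, 0; rewrite expr0 mul1r addr0; split=> //; apply: Ip_zero.
- have [y' [z' [ea Hz']]] := ker_decomp Ha.
  exists (y' * y), (p * (y' * z) + z' * b); split; first by rewrite ea eb exprS; ring.
  apply: Ip_add; first by apply: IpM => //; apply: Ip_mull.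
  exact: (@Ip_mul 2 m).
- by exists (y + y'), (z + z'); rewrite eu ev; split; [ring | apply: IpD].
Qed.

Lemma p_inj x y : p * x = p * y -> x = y.
Proof.
by move=> e; apply/eqP; rewrite -subr_eq0; apply/eqP/preg; rewrite mulrBr e subrr.
Qed.

(* d = (F x - x^2)/p plays the role of a derivation. *)
Lemma Ip_delta m x : Ip m x -> forall d, p * d = F x - x ^+ 2 -> Ip m.-1 d.
Proof.
elim=> [y|n a b Ha Hb IH|n u v Hu IHu Hv IHv] d e /=; first exact: Ip0.
  have [da ea] := Fsq a; have [db eb] := Fsq b.
  have -> : d = da * F b + a ^+ 2 * db.
    by apply: p_inj; rewrite e rmorphM ea eb; ring.
  apply: Ip_add; first by apply/Ip_mull/Ip_F.
  case: n Hb IH => [|n] Hb IH; first exact: Ip0.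
  have Hdb : Ip n db by apply: IH; rewrite eb; ring.
  have H2 : Ip 2 (a ^+ 2) by rewrite expr2; apply: (@Ip_mul 1 1); apply: th_Ip1.
  by apply: (@Ip_W _ (2 + n)); [rewrite add2n | apply: Ip_mul].
have [du eu] := Fsq u; have [dv ev] := Fsq v; have [c ec] := p2.
have -> : d = du + dv - c * u * v.
  apply: p_inj; rewrite e rmorphD eu ev.
  have -> : (u + v) ^+ 2 = u ^+ 2 + v ^+ 2 + 2%:R * (u * v) by ring.
  by rewrite ec; ring.
apply: Ip_add; first apply: Ip_add.
- by apply: IHu; rewrite eu; ring.
- by apply: IHv; rewrite ev; ring.
- by rewrite -mulrA -mulNr; apply/Ip_mull/Ip_mull; apply: Ip_pred Hv.
Qed.

(** The derivation-like map sends [p x] to [F x - p x^2] and lowers the order by one at most. So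
    [F x], and with it [x = G (F x)], has order [n]. *)
Lemma Ip_cancel n x : Ip n.+1 (p * x) -> Ip n x.
Proof.
move=> H; rewrite -[x]GF; apply: Ip_G.
have -> : F x = (F x - p * x ^+ 2) + x * (p * x) by ring.
apply: Ip_add; last by apply/Ip_mull/(Ip_pred H).
by apply: (Ip_delta H); rewrite rmorphM Fp; ring.
Qed.
Lemma Ip_cancelX m n x : Ip (m + n) (p ^+ m * x) -> Ip n x.
Proof.
elim: m => [|m IH]; first by rewrite expr0 mul1r.
by rewrite addSn exprS -mulrA => /Ip_cancel.
Qed.
Lemma Ip_pX n x : Ip n (p ^+ n * x).
Proof.
apply: Ip_mulr; elim: n => [|n IH]; first exact: Ip0.
by rewrite exprS; apply: IpM.
Qed.

Definition partial n (a : nat -> k) : A := \sum_(i < n) p ^+ i * te (a i).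
Lemma partialS n a : partial n.+1 a = partial n a + p ^+ n * te (a n).
Proof. by rewrite /partial big_ord_recr. Qed.

Definition eqm n x y := Ip n (x - y).
Lemma eqm_refl n x : eqm n x x. Proof. by rewrite /eqm subrr; apply: Ip_zero. Qed.
Lemma eqm_sym n x y : eqm n x y -> eqm n y x.
Proof. by rewrite /eqm -opprB => H; rewrite -[_ - _]opprK; apply: Ip_opp. Qed.
Lemma eqm_trans n y x z : eqm n x y -> eqm n y z -> eqm n x z.
Proof. by move=> H1 H2; rewrite /eqm -(subrKA y); apply: Ip_add. Qed.
Lemma eqmD n x y z w : eqm n x y -> eqm n z w -> eqm n (x + z) (y + w).
Proof. by move=> H1 H2; rewrite /eqm opprD addrACA; apply: Ip_add. Qed.
Lemma eqmN n x y : eqm n x y -> eqm n (- x) (- y).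
Proof. by move=> H; rewrite /eqm -opprD; apply: Ip_opp. Qed.
Lemma eqmM n x y z w : eqm n x y -> eqm n z w -> eqm n (x * z) (y * w).
Proof.
move=> H1 H2; rewrite /eqm; have -> : x * z - y * w = (x - y) * z + y * (z - w) by ring.
by apply: Ip_add; [apply: Ip_mulr | apply: Ip_mull].
Qed.
Lemma eqmW m n x y : (m <= n)%N -> eqm n x y -> eqm m x y.
Proof. exact: Ip_W. Qed.

Lemma partial_eqm n a : eqm n (partial n.+1 a) (partial n a).
Proof. by rewrite /eqm partialS addrAC subrr add0r; apply: Ip_pX. Qed.

Lemma partial_inj a b : (forall n, eqm n (partial n a) (partial n b)) -> a = b.
Proof.
move=> H; apply: funext => n; elim/ltn_ind: n => n IH.
have := H n.+1; rewrite /eqm !partialS.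
have -> : partial n a = partial n b.
  by apply: eq_bigr => i _; rewrite IH.
have -> (u v w c : A) : u + w * v - (u + w * c) = w * (v - c) by ring.
rewrite -addn1 => /Ip_cancelX /Ip1_th; rewrite rmorphB !thte => /eqP.
by rewrite subr_eq0 => /eqP.
Qed.

Definition cauchy (x : nat -> A) := forall n, eqm n (x n.+1) (x n).
Lemma lim_ex x : cauchy x -> exists a, forall n, eqm n (partial n a) (x n).
Proof.
move=> Hx; have [|f Hf] := @choice (nat * A)%type k (fun ny c =>
    eqm ny.1 (x ny.1.+1) ny.2 -> eqm ny.1.+1 (x ny.1.+1) (ny.2 + p ^+ ny.1 * te c)).
  move=> [n y] /=; have [H|H] := EM (eqm n (x n.+1) y); last by exists 0.
  have [u [v [e Hv]]] := Ip_decomp H; exists (th u) => _.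
  rewrite /eqm opprD addrA e.
  have -> : p ^+ n * u + v - p ^+ n * te (th u) = p ^+ n * (u - te (th u)) + v by ring.
  apply: Ip_add => //; rewrite -addn1; apply: Ip_mul.
    by rewrite -[p ^+ n]mulr1; apply: Ip_pX.
  by apply: th_Ip1; rewrite rmorphB thte subrr.
(* Each digit depends on the partial sum reached so far, so the recursion carries the partial
   sum. *)
pose st := fix st n := if n is m.+1 then st m + p ^+ m * te (f (m, st m)) else 0.
exists (fun n => f (n, st n)) => n; apply: eqm_sym.
have -> : partial n (fun n => f (n, st n)) = st n.
  by elim: n => [|n IH]; [rewrite /partial big_ord0 | rewrite partialS IH].
elim: n => [|n IH]; first exact: Ip0.
by apply: (Hf (n, st n)); apply: eqm_trans (Hx n) IH.
Qed.

(** Digit sequences of [sum p^i te(a_i)]. The operations are not digitwise: each one is the limit of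
    the operation on partial sums. *)
Definition wring : Type := nat -> k.
HB.instance Definition _ := Choice.copy wring (nat -> k).

Definition lim (x : nat -> A) : wring :=
  if pselect (exists a, forall n, eqm n (partial n a) (x n)) is left e
  then projT1 (cid e) else fun=> 0.
Lemma limP x : cauchy x -> forall n, eqm n (partial n (lim x)) (x n).
Proof.
by move/lim_ex => e; rewrite /lim; case: pselect => // e'; case: (cid e').
Qed.

Definition w_add (a b : wring) : wring := lim (fun n => partial n a + partial n b).
Definition w_mul (a b : wring) : wring := lim (fun n => partial n a * partial n b).
Definition w_opp (a : wring) : wring := lim (fun n => - partial n a).
Definition w_of (x : A) : wring := lim (fun=> x).

Lemma w_addP a b n : eqm n (partial n (w_add a b)) (partial n a + partial n b).
Proof. by apply: (@limP (fun n => _)) => {}n; apply: eqmD; apply: partial_eqm. Qed.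
Lemma w_mulP a b n : eqm n (partial n (w_mul a b)) (partial n a * partial n b).
Proof. by apply: (@limP (fun n => _)) => {}n; apply: eqmM; apply: partial_eqm. Qed.
Lemma w_oppP a n : eqm n (partial n (w_opp a)) (- partial n a).
Proof. by apply: (@limP (fun n => _)) => {}n; apply: eqmN; apply: partial_eqm. Qed.
Lemma w_ofP x n : eqm n (partial n (w_of x)) x.
Proof. by apply: (@limP (fun n => _)) => {}n; apply: eqm_refl. Qed.

Lemma w_ext a b (x : nat -> A) : (forall n, eqm n (partial n a) (x n)) ->
  (forall n, eqm n (partial n b) (x n)) -> a = b.
Proof. by move=> Ha Hb; apply: partial_inj => n; apply: eqm_trans (Ha n) (eqm_sym (Hb n)). Qed.

Lemma w_addA : associative w_add.
Proof.
move=> a b c; apply: (@w_ext _ _ (fun n => partial n a + partial n b + partial n c)) => n.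
  rewrite -addrA; apply: eqm_trans (w_addP _ _ _) _.
  by apply: eqmD; [apply: eqm_refl | apply: w_addP].
apply: eqm_trans (w_addP _ _ _) _.
by apply: eqmD; [apply: w_addP | apply: eqm_refl].
Qed.
Lemma w_addC : commutative w_add.
Proof. by move=> a b; rewrite /w_add; congr lim; apply: funext => n; rewrite addrC. Qed.
Lemma w_add0 : left_id (w_of 0) w_add.
Proof.
move=> a; apply: (@w_ext _ _ (fun n => partial n a)) => n; last exact: eqm_refl.
rewrite -[X in eqm _ _ X]add0r; apply: eqm_trans (w_addP _ _ _) _.
by apply: eqmD; [apply: w_ofP | apply: eqm_refl].
Qed.
Lemma w_addN : left_inverse (w_of 0) w_opp w_add.
Proof.
move=> a; apply: (@w_ext _ _ (fun=> 0)) => n; last exact: w_ofP.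
rewrite -(addNr (partial n a)); apply: eqm_trans (w_addP _ _ _) _.
by apply: eqmD; [apply: w_oppP | apply: eqm_refl].
Qed.
HB.instance Definition _ := GRing.isZmodule.Build wring w_addA w_addC w_add0 w_addN.

Lemma w_mulA : associative w_mul.
Proof.
move=> a b c; apply: (@w_ext _ _ (fun n => partial n a * partial n b * partial n c)) => n.
  rewrite -mulrA; apply: eqm_trans (w_mulP _ _ _) _.
  by apply: eqmM; [apply: eqm_refl | apply: w_mulP].
apply: eqm_trans (w_mulP _ _ _) _.
by apply: eqmM; [apply: w_mulP | apply: eqm_refl].
Qed.
Lemma w_mulC : commutative w_mul.
Proof. by move=> a b; rewrite /w_mul; congr lim; apply: funext => n; rewrite mulrC. Qed.
Lemma w_mul1 : left_id (w_of 1) w_mul.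
Proof.
move=> a; apply: (@w_ext _ _ (fun n => partial n a)) => n; last exact: eqm_refl.
rewrite -[X in eqm _ _ X]mul1r; apply: eqm_trans (w_mulP _ _ _) _.
by apply: eqmM; [apply: w_ofP | apply: eqm_refl].
Qed.
Lemma w_mulDl : left_distributive w_mul w_add.
Proof.
move=> a b c; apply: (@w_ext _ _ (fun n => (partial n a + partial n b) * partial n c)) => n.
  apply: eqm_trans (w_mulP _ _ _) _.
  by apply: eqmM; [apply: w_addP | apply: eqm_refl].
rewrite mulrDl; apply: eqm_trans (w_addP _ _ _) _.
by apply: eqmD; apply: w_mulP.
Qed.

Definition w_red (a : wring) : k := a 0%N.
Lemma w_red_eqm a x : eqm 1 (partial 1 a) x -> w_red a = th x.
Proof.
rewrite /eqm => /Ip1_th; rewrite /partial big_ord_recl big_ord0 rmorphB expr0 mul1r addr0.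
by rewrite thte => /eqP; rewrite subr_eq0 => /eqP.
Qed.
Lemma w_red_of x : w_red (w_of x) = th x. Proof. exact/w_red_eqm/w_ofP. Qed.
Lemma th_partial a : th (partial 1 a) = w_red a.
Proof. by rewrite /partial big_ord_recl big_ord0 expr0 mul1r addr0 thte. Qed.

Lemma w_one_neq0 : w_of 1 != w_of 0.
Proof.
by apply/eqP => /(congr1 w_red); rewrite !w_red_of rmorph1 rmorph0 => /eqP; rewrite oner_eq0.
Qed.
HB.instance Definition _ := GRing.Zmodule_isComNzRing.Build wring
  w_mulA w_mulC w_mul1 w_mulDl w_one_neq0.

Lemma wD (a b : wring) n : eqm n (partial n (a + b)) (partial n a + partial n b).
Proof. exact: w_addP. Qed.
Lemma wM (a b : wring) n : eqm n (partial n (a * b)) (partial n a * partial n b).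
Proof. exact: w_mulP. Qed.

Lemma w_red_additive : zmod_morphism w_red.
Proof.
move=> a b; rewrite -(th_partial a) -(th_partial b) -rmorphB; apply: w_red_eqm.
by apply: eqm_trans (w_addP a (- b) 1) _; apply: eqmD; [apply: eqm_refl | apply: w_oppP].
Qed.
HB.instance Definition _ := GRing.isZmodMorphism.Build wring k w_red w_red_additive.
Lemma w_red_monoid : monoid_morphism w_red.
Proof.
split=> [|a b]; first by rewrite w_red_of rmorph1.
by rewrite -(th_partial a) -(th_partial b) -rmorphM; apply/w_red_eqm/wM.
Qed.
HB.instance Definition _ := GRing.isMonoidMorphism.Build wring k w_red w_red_monoid.

Lemma w_of_additive : zmod_morphism w_of.
Proof.
move=> x y; apply: (@w_ext _ _ (fun=> x - y)) => n; first exact: w_ofP.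
apply: eqm_trans (wD _ _ _) _; apply: eqmD; first exact: w_ofP.
by apply: eqm_trans (w_oppP _ _) _; apply/eqmN/w_ofP.
Qed.
HB.instance Definition _ := GRing.isZmodMorphism.Build A wring w_of w_of_additive.
Lemma w_of_monoid : monoid_morphism w_of.
Proof.
split=> // x y; apply: (@w_ext _ _ (fun=> x * y)) => n; first exact: w_ofP.
by apply: eqm_trans (wM _ _ _) _; apply: eqmM; apply: w_ofP.
Qed.
HB.instance Definition _ := GRing.isMonoidMorphism.Build A wring w_of w_of_monoid.

Local Notation pw := (w_of p).

Definition shift (a : wring) : wring := fun n => if n is m.+1 then a m else 0.
(** [te 0] need not be 0, since [[0]] is not 0 in a monoid ring; but it is an idempotent killed by
    [th], hence lies in all powers of the ideal. *)
Lemma Ip_te0 n : Ip n (te 0).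
Proof.
elim: n => [|n IH]; first exact: Ip0.
by rewrite -(mulr0 0) teM; apply: IpM.
Qed.
Lemma partial_shift n a : eqm n.+1 (partial n.+1 (shift a)) (p * partial n a).
Proof.
rewrite /eqm /partial big_ord_recl /= mulr_sumr -addrA -sumrB big1 ?addr0 //.
  by rewrite mul1r; apply: Ip_te0.
by move=> i _; rewrite exprS; ring.
Qed.
Lemma w_pM a : pw * a = shift a.
Proof.
apply: (@w_ext _ _ (fun n => p * partial n a)) => n.
  by apply: eqm_trans (wM _ _ _) _; apply: eqmM; [apply: w_ofP | apply: eqm_refl].
by apply: eqm_trans (eqm_sym (partial_eqm n _)) _; apply: eqmW (partial_shift n a).
Qed.
Lemma w_pXM n a i : (pw ^+ n * a : wring) i = if (i < n)%N then 0 else a (i - n)%N.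
Proof.
elim: n i => [|n IH] i; first by rewrite expr0 mul1r subn0.
by rewrite exprS -mulrA w_pM; case: i => //= i; rewrite IH.
Qed.
Lemma w0E i : (0 : wring) i = 0.
Proof. by rewrite -(mulr0 (pw ^+ i.+1)) w_pXM ltnS leqnn. Qed.
Lemma w_div n (a : wring) : (forall i, (i < n)%N -> a i = 0) -> exists b, a = pw ^+ n * b.
Proof.
move=> H; exists (fun i => a (i + n)%N : k); apply: funext => i; rewrite w_pXM.
by case: ltnP => [/H|/subnK ->].
Qed.
Lemma w_sep (a : wring) : (forall n, exists b, a = pw ^+ n * b) -> a = 0.
Proof.
move=> H; apply: partial_inj => n.
have [b ->] := H n; apply: eqm_trans (wM _ _ _) _.
apply: (eqm_trans (y := p ^+ n * partial n b)).
  by apply: eqmM; [rewrite -rmorphXn; apply: w_ofP | apply: eqm_refl].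
apply: (eqm_trans (y := 0)); last exact/eqm_sym/w_ofP.
by rewrite /eqm subr0; apply: Ip_pX.
Qed.

Definition w_sum (u : nat -> wring) : wring :=
  lim (fun n => \sum_(i < n) p ^+ i * partial n (u i)).
Lemma w_sum_step u : w_sum u = u 0%N + pw * w_sum (fun i => u i.+1).
Proof.
have H v n : eqm n (partial n (w_sum v)) (\sum_(i < n) p ^+ i * partial n (v i)).
  apply: (@limP (fun n => _)) => {}n; rewrite /eqm big_ord_recr /= addrAC -sumrB.
  apply: Ip_add; last exact: Ip_pX.
  elim/big_ind: _ => [|x y|i _]; [exact: Ip_zero | exact: Ip_add |].
  by rewrite -mulrBr; apply/Ip_mull/partial_eqm.
apply: (@w_ext _ _ (fun n => \sum_(i < n) p ^+ i * partial n (u i))) => n; first exact: H.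
apply: eqm_trans (wD _ _ _) _.
apply: (eqm_trans (y := partial n (u 0%N) + p * \sum_(i < n) p ^+ i * partial n (u i.+1))).
  apply: eqmD; first exact: eqm_refl.
  by apply: eqm_trans (wM _ _ _) _; apply: eqmM; [apply: w_ofP | apply: H].
case: n => [|n]; first exact: Ip0.
rewrite [X in eqm _ _ X]big_ord_recl mul1r; apply: eqmD; first exact: eqm_refl.
rewrite mulr_sumr big_ord_recr /= /eqm.
have -> : \sum_(i < n) p ^+ bump 0 i * partial n.+1 (u (bump 0 i)) =
  \sum_(i < n) p * (p ^+ i * partial n.+1 (u i.+1)).
  by apply: eq_bigr => i _; rewrite exprS mulrA.
by rewrite addrAC subrr add0r mulrA -exprS; apply: Ip_pX.
Qed.
Lemma w_complete (u : nat -> wring) : exists a, forall n, exists b,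
  a = \sum_(i < n) pw ^+ i * u i + pw ^+ n * b.
Proof.
exists (w_sum u) => n; elim: n u => [|n IH] u.
  by exists (w_sum u); rewrite big_ord0 add0r mul1r.
have [b e] := IH (fun i => u i.+1); exists b.
rewrite w_sum_step e big_ord_recl mul1r mulrDr mulr_sumr exprS -mulrA addrA.
congr (_ + _ + _); apply: eq_bigr => i _.
by rewrite exprS mulrA.
Qed.

(** The Teichmueller lift of the inverse digit inverts [a] modulo [p], and a geometric series in [p]
    corrects the error. *)
Lemma w_inv (a : wring) : a 0%N <> 0 -> exists b : wring, b * a = 1.
Proof.
move=> /eqP a0; pose b := w_of (te (a 0%N)^-1).
have [c ec] : exists c, a * b - 1 = pw ^+ 1 * c.
  apply: w_div => i; rewrite ltnS leqn0 => /eqP ->.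
  rewrite -[LHS]/(w_red (a * b - 1)) rmorphB rmorphM /= w_red_of thte w_red_of rmorph1 -[w_red a]/(a 0%N).
  by rewrite divff // subrr.
rewrite expr1 in ec; have [x Hx] := w_complete (fun i => (- c) ^+ i).
exists (b * x); rewrite mulrAC [b * a]mulrC.
apply/eqP; rewrite -subr_eq0; apply/eqP/w_sep => n; have [r er] := Hx n.
exists ((1 + pw * c) * r - (- c) ^+ n).
have -> : a * b = 1 + pw * c by rewrite -ec addrC subrK.
move: (subrX1 (- (pw * c)) n).
have -> : \sum_(i < n) (- (pw * c)) ^+ i = \sum_(i < n) pw ^+ i * (- c) ^+ i.
  by apply: eq_bigr => i _; rewrite -mulrN exprMn.
rewrite er -mulrN exprMn; move: (\sum_(i < n) _) (pw ^+ n) ((- c) ^+ n) => S y z E.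
have -> : (1 + pw * c) * (S + y * r) - 1 = - ((pw * - c - 1) * S) - 1 + (1 + pw * c) * (y * r).
  by ring.
by rewrite -E; ring.
Qed.

Lemma w_unit_decomp (a : wring) : a <> 0 -> exists n, exists2 u, a = pw ^+ n * u & u 0%N <> 0.
Proof.
move=> nz; have ex : exists n, a n != 0.
  apply: contrapT => H; apply/nz/w_sep => n; apply: w_div => i _.
  by apply: contrapT => /eqP Hi; apply: H; exists i.
case: (ex_minnP ex) => n Hn Hmin.
have [u eu] : exists u, a = pw ^+ n * u.
  by apply: w_div => i; apply: contraTeq => /Hmin; rewrite -leqNgt.
by exists n, u => //; move: Hn; rewrite eu w_pXM ltnn subnn => /eqP.
Qed.

Definition w_unit (a : wring) : bool := a 0%N != 0.
Definition w_invr (a : wring) : wring :=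
  if pselect (exists b : wring, b * a = 1) is left e then projT1 (cid e) else a.
Lemma w_mulVx : {in w_unit, left_inverse 1 w_invr *%R}.
Proof.
move=> a /eqP /w_inv e; rewrite /w_invr; case: pselect => // e'.
by case: (cid e').
Qed.
Lemma w_unitP (a b : wring) : b * a = 1 -> w_unit a.
Proof.
move=> /(congr1 w_red); rewrite rmorphM rmorph1 /= => e; apply/eqP => a0.
by move/eqP: e; rewrite [w_red a]a0 mulr0 eq_sym oner_eq0.
Qed.
Lemma w_invr_out : {in [predC w_unit], w_invr =1 id}.
Proof.
move=> a /negP na; rewrite /w_invr; case: pselect => // e'.
by case: na; case: e' => b; apply: w_unitP.
Qed.
HB.instance Definition _ := GRing.ComNzRing_hasMulInverse.Build wring
  w_mulVx w_unitP w_invr_out.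
Lemma w_integral (a b : wring) : a * b = 0 -> (a == 0) || (b == 0).
Proof.
move=> e; apply: contrapT => /negP; rewrite negb_or => /andP[/eqP na /eqP nb].
have [m [u ea Hu]] := w_unit_decomp na; have [n [v eb Hv]] := w_unit_decomp nb.
have : (pw ^+ (m + n) * (u * v) : wring) (m + n)%N = 0.
  have -> : pw ^+ (m + n) * (u * v) = a * b by rewrite ea eb exprD; ring.
  by rewrite e w0E.
rewrite w_pXM ltnn subnn -[LHS]/(w_red (u * v)) rmorphM => /eqP.
by rewrite mulf_eq0 => /orP[/eqP /Hu|/eqP /Hv].
Qed.
HB.instance Definition _ := GRing.ComUnitRing_isIntegral.Build wring w_integral.

Lemma digits_dvr N : p ^+ N = 2%:R ->
  exists (R : idomainType) (red : {rmorphism R -> k}) (q : R) (teR : k -> R),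
  [/\ q ^+ N = 2%:R, red q = 0, q <> 0 &
      forall a, red a = 0 -> exists b, a = q * b] /\
  [/\ forall a, (forall n, exists b, a = q ^+ n * b) -> a = 0,
      forall u : nat -> R, exists a, forall n, exists b,
        a = \sum_(i < n) q ^+ i * u i + q ^+ n * b &
      forall a, red a <> 0 -> a \is a GRing.unit] /\
  [/\ forall c, red (teR c) = c, teR 1 = 1 & forall a b, teR (a * b) = teR a * teR b].
Proof.
move=> pN; exists wring, w_red, pw, (fun c => w_of (te c)); split; last split.
- split; first by rewrite -rmorphXn pN rmorph_nat.
  + by rewrite /= w_red_of.
  + move=> e; have := w_pXM 1 (1 : wring) 1; rewrite expr1 e mul0r w0E /=.
    by rewrite -[RHS]/(w_red 1) rmorph1 => /esym /eqP; rewrite oner_eq0.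
  + move=> a Ha; have [|b ->] := @w_div 1 a; last by exists b; rewrite expr1.
    by move=> i; rewrite ltnS leqn0 => /eqP ->.
- by split; [exact: w_sep | exact: w_complete | move=> a /eqP].
- by split=> [c||a b]; rewrite /= ?w_red_of ?thte ?te1 ?rmorph1 // teM rmorphM.
Qed.
End Digits.

(** * The ramified Witt vectors of [k] *)

Section CompleteDVR.
Variables (k : closedFieldType) (char2 : 2%N \in [pchar k]).

Lemma closed_sqrt (a : k) : exists b, b ^+ 2 = a.
Proof.
have [b] := @solve_monicpoly k 2 (fun i => if i == 0%N then a else 0) isT.
rewrite !big_ord_recl big_ord0 /= mul0r !addr0 mulr1 => e; by exists b.
Qed.
Lemma sqr_inj (a b : k) : a ^+ 2 = b ^+ 2 -> a = b.
Proof.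
move=> e; apply/eqP; rewrite -subr_eq0 -sqrf_eq0; apply/eqP.
have two : 2%:R = 0 :> k by apply: pcharf0.
have -> : (a - b) ^+ 2 = a ^+ 2 - b ^+ 2 + 2%:R * (b ^+ 2 - a * b) by ring.
by rewrite two e subrr mul0r addr0.
Qed.

(** [O / q] has only the classes of 0 and 1, so the indicator function of the class of 1 is a ring
    morphism to a field of characteristic 2. *)
Lemma residue_O (O : comNzRingType) (q : O) N : q ^+ N = 2%:R -> (0 < N)%N ->
  (forall x, (exists y, x = q * y) \/ (exists y, x = 1 + q * y)) ->
  (forall y, 1 <> q * y) -> exists r : {rmorphism O -> k}, r q = 0.
Proof.
move=> qN N0 res q1; have two : 2%:R = 0 :> k by apply: pcharf0.
pose r (x : O) : k := if `[< exists y, x = q * y >] then 0 else 1.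
have r0 y : r (q * y) = 0 by rewrite /r asboolT //; exists y.
have r1 y : r (1 + q * y) = 1.
  rewrite /r asboolF // => -[z e]; apply: (q1 (z - y)).
  by rewrite mulrBr -e addrK.
have mm1 : (-1 : k) = 1 by apply/eqP; rewrite eq_sym -subr_eq0 opprK -two.
have addr : zmod_morphism r.
  move=> x x'; have [[y ->]|[y ->]] := res x; have [[y' ->]|[y' ->]] := res x'.
  - by rewrite -mulrBr !r0 subr0.
  - have -> : q * y - (1 + q * y') = 1 + q * (y - y' - q ^+ N.-1).
      by rewrite !mulrBr -exprS prednK // qN; ring.
    by rewrite !(r0, r1) sub0r mm1.
  - have -> : 1 + q * y - q * y' = 1 + q * (y - y') by ring.
    by rewrite !(r0, r1) subr0.
  - have -> : 1 + q * y - (1 + q * y') = q * (y - y') by ring.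
    by rewrite r0 !r1 subrr.
have mulr : monoid_morphism r.
  split=> [|x x']; first by rewrite -[1]addr0 -(mulr0 q) r1.
  have [[y ->]|[y ->]] := res x; first by rewrite -mulrA !r0 mul0r.
  have [[y' ->]|[y' ->]] := res x'; first by rewrite mulrCA !r0 mulr0.
  have -> : (1 + q * y) * (1 + q * y') = 1 + q * (y + y' + q * y * y') by ring.
  by rewrite !r1 mulr1.
pose M1 := GRing.isZmodMorphism.Build O k r addr.
pose M2 := GRing.isMonoidMorphism.Build O k r mulr.
pose rr : {rmorphism O -> k} := HB.pack r M1 M2.
by exists rr; rewrite -[q]mulr1; apply: r0.
Qed.

(** The ring is the completion of the monoid ring of [k] over [O = Z[2^(1/2^j)]] at the kernel of
    the augmentation. Since [k] is perfect, squaring on [k] induces an invertible Frobenius lift, as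
    required in the section on digits. *)
Lemma complete_dvr j : 
  exists (R : idomainType) (red : {rmorphism R -> k}) (q : R) (teR : k -> R),
  [/\ q ^+ (2 ^ j) = 2%:R, red q = 0, q <> 0 &
      forall a, red a = 0 -> exists b, a = q * b] /\
  [/\ forall a, (forall n, exists b, a = q ^+ n * b) -> a = 0,
      forall u : nat -> R, exists a, forall n, exists b,
        a = \sum_(i < n) q ^+ i * u i + q ^+ n * b &
      forall a, red a <> 0 -> a \is a GRing.unit] /\
  [/\ forall c, red (teR c) = c, teR 1 = 1 & forall a b, teR (a * b) = teR a * teR b].
Proof.
have [O [q [qN qreg qres q1]]] := dyadic_root_ring j.
have N0 : (0 < 2 ^ j)%N by rewrite expn_gt0.
have [r rq] := residue_O qN N0 qres q1.
have [sq Hsq] := choice closed_sqrt.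
have sqM : {morph sq : a b / a * b} by move=> a b; apply: sqr_inj; rewrite exprMn !Hsq.
have sq1 : sq 1 = 1 by apply: sqr_inj; rewrite Hsq expr1n.
pose f (a : k) := a ^+ 2.
have fM : {morph f : a b / a * b} by move=> a b; rewrite /f exprMn.
have f1 : f 1 = 1 by rewrite /f expr1n.
pose push s (sM : {morph s : a b / a * b}) (s1 : s 1 = 1) : {rmorphism mring O k -> mring O k} :=
  HB.pack (@mpush O k s) (GRing.isZmodMorphism.Build _ _ _ (@mpush_additive O k s))
    (GRing.isMonoidMorphism.Build _ _ _ (@mpush_monoid O k s sM s1)).
apply: (@digits_dvr (mring O k) k (mscal k q) (aug r) (@teich O k) (push f fM f1) (push sq sqM sq1)).
- move=> x e; apply: mval_inj => phi; have := congr1 (fun y => mval y phi) e.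
  rewrite mval_scalM [RHS]/= /fin_sum big_nil => /qreg ->.
  by rewrite [RHS]/= /fin_sum big_nil.
- by rewrite /= aug_scal.
- exact: aug_teich.
- exact: teich1.
- exact: teichM.
- exact: mpush_scal.
- move=> x; apply: mval_inj => phi; rewrite /=; congr (mval x).
  by apply: funext => a /=; congr phi; rewrite /f Hsq.
- move=> x; apply: mval_inj => phi; rewrite /=; congr (mval x).
  by apply: funext => a /=; congr phi; apply: sqr_inj; rewrite Hsq.
- have two : 2%:R = mscal k q * mscal k (q ^+ (2 ^ j).-1).
    by rewrite -rmorphM -exprS prednK // qN rmorph_nat.
  elim/mring_ind => [|o a x [y ey]].
    by exists 0; rewrite rmorph0 expr0n mulr0 addr0.
  (* [O / q] is the field with two elements, so [O] may be fixed by the Frobenius lift. *)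
  have [z ez] : exists z, o - o ^+ 2 = q * z.
    case: (qres o) => -[z ->]; first by exists (z * (1 - q * z)); ring.
    by exists (- z * (1 + q * z)); ring.
  exists (mscal k z * teich O (a ^+ 2) + y - mscal k (q ^+ (2 ^ j).-1) * (mscal k o * teich O a * x)).
  rewrite rmorphD ey rmorphM /= mpush_scal // mpush_teich /f expr2 teichM.
  have {1}-> : mscal k o = mscal k o ^+ 2 + mscal k q * mscal k z.
    by rewrite -rmorphXn -rmorphM -rmorphD -ez addrC subrK.
  move: (mscal k o) (mscal k q) (mscal k z) (teich O a) (mscal k (q ^+ (2 ^ j).-1)) two.
  move=> o1 q' z' t q'' two'.
  have -> : (o1 * t + x) ^+ 2 + q' * (z' * (t * t) + y - q'' * (o1 * t * x)) =
    o1 ^+ 2 * (t * t) + x ^+ 2 + q' * z' * (t * t) + q' * y + (2%:R - q' * q'') * (o1 * t * x).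
    by ring.
  by rewrite -two' subrr mul0r; ring.
- by exists (mscal k (q ^+ (2 ^ j).-1)); rewrite -rmorphM -exprS prednK // qN rmorph_nat.
- by rewrite -rmorphXn qN rmorph_nat.
Qed.
End CompleteDVR.
(** Solving the lifting equations *)

Section SquareModTwo.
Variable R : comNzRingType.
(** The cross terms of a square occur twice; each coefficient is computed on a truncation of [f]. *)
Lemma sqr_mod2 (f : ps R) : exists Y,
  f ^+ 2 = ((fun m => if odd m then 0 else f m./2 ^+ 2) : ps R) + 2%:R * Y.
Proof.
set d : ps R := fun m => _.
have fin N : exists Y, (\sum_(i < N) ps_C (f i) * psX R ^+ i) ^+ 2 =
    \sum_(i < N) ps_C (f i ^+ 2) * psX R ^+ (i + i) + 2%:R * Y.
  elim: N => [|N [Y e]]; first by exists 0; rewrite !big_ord0 expr0n mulr0 addr0.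
  exists (Y + (\sum_(i < N) ps_C (f i) * psX R ^+ i) * (ps_C (f N) * psX R ^+ N)).
  rewrite !big_ord_recr /=; move: e; move: (\sum_(i < N) _) (\sum_(i < N) _) => S S' e.
  rewrite rmorphXn exprD /= sqrrD e; move: (ps_C _) (psX R ^+ N) => a b.
  by rewrite mulr2n; ring.
have E m : exists y, (f ^+ 2) m = d m + 2%:R * y.
  have [Y e] := fin m.+1; exists (Y m); set S := \sum_(i < _) _ in e.
  have fS : vge m.+1 (f - S).
    move=> j ltj; rewrite psDE psNE /S ps_sumE (bigD1 (Ordinal ltj)) //= psCM psXnE eqxx mulr1.
    rewrite big1 ?addr0 ?subrr // => i /eqP ne; rewrite psCM psXnE.
    by case: eqP => [e'|]; [case: ne; apply: val_inj | rewrite mulr0].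
  have fS2 : (f ^+ 2) m = (S ^+ 2) m.
    apply/eqP; rewrite -subr_eq0 -psNE -psDE.
    have -> : f ^+ 2 - S ^+ 2 = (f - S) * (f + S) by ring.
    by apply/eqP; apply: (@vgeMr _ m.+1).
  have -> : d m = (\sum_(i < m.+1) ps_C (f i ^+ 2) * psX R ^+ (i + i)) m.
    rewrite ps_sumE /d; case: ifP => om.
      rewrite big1 // => i _; rewrite psCM psXnE; case: eqP => [e'|]; last by rewrite mulr0.
      by lia.
    have lt : (m./2 < m.+1)%N by lia.
    have em : m = (m./2 + m./2)%N by lia.
    rewrite (bigD1 (Ordinal lt)) //= psCM psXnE -em eqxx mulr1 big1 ?addr0 // => i /eqP ne.
    rewrite psCM psXnE; case: eqP => [e'|]; last by rewrite mulr0.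
    by case: ne; apply: val_inj => /=; lia.
  by rewrite fS2 e psDE; congr (_ + _); rewrite -[2%:R](rmorph_nat (@ps_C R)) psCM.
have [Y HY] := choice E; exists Y; apply: funext => m.
by rewrite HY psDE -[2%:R in RHS](rmorph_nat (@ps_C R)) psCM.
Qed.
End SquareModTwo.

Section LiftingEquations.
Variables (R : comNzRingType) (p z : R).
Hypotheses (p16 : p ^+ 16 = 2%:R) (z3 : z ^+ 3 = 1) (z1 : 1 + z + z ^+ 2 = 0).
Local Notation S := (ps R).
Local Notation X := (psX R).
Local Notation sg := (ps_sub z).
Let P : S := ps_C p.

Lemma P16 : P ^+ 16 = 2%:R. Proof. by rewrite /P -rmorphXn p16 rmorph_nat. Qed.

Definition avoids n (f : S) : Prop := forall j, f j <> 0 -> (j %% 3 != n %% 3)%N.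

Lemma avoidsD n f g : avoids n f -> avoids n g -> avoids n (f + g).
Proof.
move=> Hf Hg j; rewrite psDE => nz; have [e|/Hf //] := EM (f j = 0).
by apply: Hg => e2; apply: nz; rewrite e e2 addr0.
Qed.
Lemma avoidsC n c f : avoids n f -> avoids n (ps_C c * f).
Proof. by move=> Hf j; rewrite psCM => nz; apply: Hf => e; apply: nz; rewrite e mulr0. Qed.
Lemma avoidsN n f : avoids n f -> avoids n (- f).
Proof. by move=> Hf j; rewrite psNE => nz; apply: Hf => e; apply: nz; rewrite e oppr0. Qed.
Lemma avoidsX n d f : (3 %| d)%N -> avoids n f -> avoids n (X ^+ d * f).
Proof.
move=> d3 Hf j; rewrite psXnM; case: ltnP => // le /Hf; case/dvdnP: d3 le => m -> le.
by move=> ne; apply/negP => /eqP e; move/negP: ne; apply; apply/eqP; lia.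
Qed.
Lemma avoidsPX n m f : avoids n f -> avoids n (P ^+ m * f).
Proof. by rewrite /P -rmorphXn; apply: avoidsC. Qed.

(** On the monomial of degree [j] the two summands multiply by [u] and [u^2] with [u = z^(2n+j)].
    This is a primitive cube root of unity unless [j = n] modulo 3, and then [u + u^2 = -1]. *)
Lemma avoids_trace n f : avoids n f ->
  ps_C (z ^+ n) ^+ 2 * sg f + ps_C (z ^+ n) * sg (sg f) = - f.
Proof.
move=> Hf; apply: funext => j; rewrite psDE psNE -rmorphXn !psCM /ps_sub.
have [->|/Hf H] := EM (f j = 0); first by rewrite !mulr0 oppr0 addr0.
have zm m : z ^+ m = z ^+ (m %% 3).
  by rewrite {1}(divn_eq m 3) exprD mulnC exprM z3 expr1n mul1r.
rewrite !mulrA -exprM -!exprD.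
have -> : z ^+ (n + j + j) = z ^+ (n * 2 + j) ^+ 2.
  by rewrite -exprM zm [RHS]zm; congr (_ ^+ _); lia.
rewrite -mulrDl [z ^+ (n * 2 + j)]zm.
have : ((n * 2 + j) %% 3 = 1 \/ (n * 2 + j) %% 3 = 2)%N by lia.
have z12 : z + z ^+ 2 = -1 by rewrite -[RHS]addr0 -z1; ring.
case=> ->; first by rewrite expr1 z12 mulN1r.
have -> : (z ^+ 2) ^+ 2 = z ^+ 3 * z by ring.
by rewrite z3 mul1r addrC z12 mulN1r.
Qed.

(** For [g] avoiding [n], the trace relation makes the product of the two nontrivial conjugates of
    [K + y g] equal to [K^2 - y K g] plus a multiple of [y^2]. Both required relations then become
    polynomial identities modulo the equation for [K c - b^2]. *)
Lemma lifting_identity n K c b Y q :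
  sg K = ps_C (z ^+ n) * K -> avoids n c -> avoids n b ->
  K * c - b ^+ 2 = P ^+ 6 * (q + P * Y) ->
  exists G H Phi : S, [/\ sg G * sg (sg G) = H ^+ 2 + 4%:R * Phi,
    exists U, G * H - sg H * sg (sg H) = 2%:R * P * U &
    exists U1 U2 U3, [/\ G = K + P * U1, H = K + P * U2 & Phi = q + P * U3]].
Proof.
move=> eK /avoids_trace ec /avoids_trace eb e.
have sgP m : sg (P ^+ m) = P ^+ m by rewrite rmorphXn /P /= ps_sub_C.
have sgPM m f : sg (P ^+ m * f) = P ^+ m * sg f by rewrite rmorphM /= sgP.
have zn : ps_C (z ^+ n) ^+ 3 = 1.
  by rewrite -rmorphXn -exprM mulnC exprM z3 expr1n.
have eK2 : sg (sg K) = ps_C (z ^+ n) ^+ 2 * K.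
  by rewrite eK rmorphM /= eK ps_sub_C; ring.
pose g' := - (c + P ^+ 3 * b).
(* [26 + 6 = 32] and [4 = P^32], while 13 is half of 26. The summand [P^3 b] of [g'] accounts for
   the cross term of [H^2], as [2 P^13 = P^29]. *)
exists (K + P ^+ 26 * g'), (K + P ^+ 13 * b), (q + P * Y + P ^+ 20 * (sg g' * sg (sg g'))).
have four : 4%:R = P ^+ 32 :> S by rewrite (exprM P 16 2) P16; ring.
have eg : ps_C (z ^+ n) ^+ 2 * sg g' + ps_C (z ^+ n) * sg (sg g') = - g'.
  rewrite /g' !(rmorphN, rmorphD) /= !sgPM.
  have -> : - (c + P ^+ 3 * b) = (- c) + P ^+ 3 * (- b) by ring.
  by rewrite -ec -eb; ring.
have prod x y u v w : x * x * x = 1 :> S -> x ^+ 2 * u + x * v = - w ->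
    (x * K + y * u) * (x ^+ 2 * K + y * v) = K ^+ 2 - y * K * w + y ^+ 2 * (u * v).
  move=> x3 ew; have -> : - (y * K * w) = y * K * (- w) by ring.
  rewrite -ew; have -> : (x * K + y * u) * (x ^+ 2 * K + y * v) =
    x * x * x * K ^+ 2 + y * K * (x ^+ 2 * u + x * v) + y ^+ 2 * (u * v) by ring.
  by rewrite x3 mul1r.
have zn' : ps_C (z ^+ n) * ps_C (z ^+ n) * ps_C (z ^+ n) = 1 by rewrite -zn; ring.
split.
- rewrite !rmorphD /= !sgPM eK2 eK (prod _ _ _ _ _ zn' eg) four.
  have -> : (K + P ^+ 13 * b) ^+ 2 + P ^+ 32 * (q + P * Y + P ^+ 20 * (sg g' * sg (sg g'))) =
    K ^+ 2 + 2%:R * P ^+ 13 * K * b + P ^+ 26 * b ^+ 2 + P ^+ 26 * (P ^+ 6 * (q + P * Y)) +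
    P ^+ 52 * (sg g' * sg (sg g')) by ring.
  by rewrite -e -P16 /g'; ring.
- exists (P ^+ 9 * g' * K + P ^+ 12 * b * K + P ^+ 22 * g' * b - P ^+ 9 * (sg b * sg (sg b))).
  rewrite !rmorphD /= !sgPM eK2 eK (prod _ _ _ _ _ zn' eb).
  have -> : (K + P ^+ 26 * g') * (K + P ^+ 13 * b) -
    (K ^+ 2 - P ^+ 13 * K * b + (P ^+ 13) ^+ 2 * (sg b * sg (sg b))) =
    2%:R * (P ^+ 13 * K * b) + P ^+ 26 * g' * K + P ^+ 39 * g' * b -
    P ^+ 26 * (sg b * sg (sg b)) by ring.
  by rewrite -P16; ring.
- by exists (P ^+ 25 * g'), (P ^+ 12 * b), (Y + P ^+ 19 * (sg g' * sg (sg g'))); split; ring.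
Qed.

Variables (s : nat -> R) (n : nat).
Hypothesis sE : forall e, s e <> 0 -> odd e /\ (e %% 3 != (2 * n) %% 3)%N.

(** A band of exponents of the lift of [q]; coefficients are given as squares so that [root] can be
    explicit. *)
Definition part (D : pred nat) : S := fun e => if D e then s e ^+ 2 else 0.
(** The square root modulo 2 of [X^d * part D] for odd [d]: exponents of [part D] are odd too, so
    those of the product are even. *)
Definition root (D : pred nat) d : S :=
  fun i => if (d <= 2 * i)%N && D (2 * i - d)%N then s (2 * i - d) else 0.

Lemma root_sqr D d : odd d -> exists Y, root D d ^+ 2 = X ^+ d * part D + 2%:R * Y.
Proof.
move=> od; have [Y ->] := sqr_mod2 (root D d); exists Y; congr (_ + _).
apply: funext => m; rewrite psXnM /part /root; case: ltnP => [lt|le].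
  by case: ifP => // om; rewrite ifF ?expr0n //; apply/negbTE; rewrite negb_and -ltnNge; lia.
case: ifP => om.
  have [->|/sE[oe _]] := EM (s (m - d) = 0); first by rewrite expr0n; case: ifP.
  by move: oe; rewrite oddB // om od.
have -> : (2 * m./2 = m)%N by lia.
by rewrite le /=; case: ifP; rewrite ?expr0n.
Qed.

Lemma root_avoids D d : (3 %| d)%N -> avoids n (root D d).
Proof.
move=> /dvdnP[m ->] j; rewrite /root; case: ifP => // /andP[le _] /sE[_ ne].
by apply/negP => /eqP e; move/negP: ne; apply; apply/eqP; lia.
Qed.

Lemma part_div (D : pred nat) i : (forall e, D e -> s e <> 0 -> (i <= e)%N) -> (i %% 3 = n %% 3)%N ->
  exists2 L, part D = X ^+ i * L & avoids n L.
Proof.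
move=> H ei; exists (drop i (part D)).
  apply: vge_drop => j lt; rewrite /part; case: ifP => // Dj.
  have [->|/(H _ Dj)] := EM (s j = 0); first by rewrite expr0n.
  by rewrite leqNgt lt.
move=> j; rewrite /drop /part; case: ifP => // _ nz.
have /sE[_ ne] : s (j + i) <> 0 by move=> e; apply: nz; rewrite e expr0n.
by apply/negP => /eqP e; move/negP: ne; apply; apply/eqP; lia.
Qed.

Lemma part_split (D D1 D2 : pred nat) : (forall e, D e = D1 e || D2 e) ->
  (forall e, ~~ (D1 e && D2 e)) -> part D = part D1 + part D2.
Proof.
move=> H dis; apply: funext => e; rewrite psDE /part H; move: (dis e).
by case: (D1 e); case: (D2 e) => //= _; rewrite ?addr0 ?add0r.
Qed.

(** Exponents of [q] below [n] cannot come from multiples of [X^n]. They come from the lower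
    monomials of [K], and the products that appear with too small a power of [P] are cancelled by
    [b^2]. *)
Lemma lifting_seed : (0 < n)%N -> (n %% 3 != 2)%N -> exists K c b Y : S,
  [/\ sg K = ps_C (z ^+ n) * K, avoids n c, avoids n b,
      K * c - b ^+ 2 = P ^+ 6 * (part predT + P * Y) &
      exists U, K = X ^+ n + P * U].
Proof.
move=> n0 n2; pose r := (n %/ 3)%N; pose i := (n %% 3)%N.
have en : (n = i + 3 * r)%N by rewrite /i /r; lia.
have i2 : (i < 2)%N by rewrite /i; lia.
have sgX m : sg (X ^+ m) = ps_C (z ^+ m) * X ^+ m.
  by rewrite rmorphXn /= ps_sub_X exprMn -rmorphXn.
have z3m m : z ^+ (i + 3 * m) = z ^+ n.
  by rewrite en exprD exprM z3 expr1n [RHS]exprD exprM z3 expr1n.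
have sgX3 m : sg (X ^+ i * X ^+ (3 * m)) = ps_C (z ^+ n) * (X ^+ i * X ^+ (3 * m)).
  by rewrite -exprD sgX z3m.
have sgP m : sg (P ^+ m) = P ^+ m by rewrite rmorphXn /P /= ps_sub_C.
have sgPM m f : sg (P ^+ m * f) = P ^+ m * sg f by rewrite rmorphM /= sgP.
have ge1 e : s e <> 0 -> (i <= e)%N by move=> /sE[oe _]; lia.
have imod : (i %% 3 = n %% 3)%N by rewrite /i modn_mod.
have nmod : (n %% 3 = n %% 3)%N by [].
have [ev|od] := boolP (~~ odd r && (0 < r)%N).
  (* For even [r], [X^(3r)] times the low band has odd exponents and admits no [root]. An
     intermediate monomial [X^(i+3)] in [K] replaces the shift [3r] by the odd shifts [3], [3(r-1)]
     and [3(2r-1)]. *)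
  case/andP: ev => er r0.
  have [L eL aL] := @part_div (fun e => n <= e)%N n (fun e H _ => H) nmod.
  have [M eM aM] : exists2 M, part (fun e => i + 3 <= e < n)%N = X ^+ (i + 3) * M & avoids n M.
    by apply: part_div => [e /andP[]|]; rewrite // modnDr.
  have [U eU aU] : exists2 U, part (fun e => e < i + 3)%N = X ^+ i * U & avoids n U.
    by apply: part_div => // e _; apply: ge1.
  have eT : part predT = part (fun e => n <= e)%N + (part (fun e => i + 3 <= e < n)%N +
      part (fun e => e < i + 3)%N).
    rewrite (@part_split predT (fun e => n <= e)%N (fun e => e < n)%N) => [|e|e] /=; try lia.
    by congr (_ + _); apply: part_split => e /=; lia.
  have [Y1 e1] := @root_sqr (fun e => e < i + 3)%N 3 isT.
  have [|Y2 e2] := @root_sqr (fun e => i + 3 <= e < n)%N (3 * (r - 1)); first by lia.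
  have [|Y3 e3] := @root_sqr (fun e => e < i + 3)%N (3 * (r - 1)); first by lia.
  have [|Y4 e4] := @root_sqr (fun e => e < i + 3)%N (3 * (2 * r - 1)); first by lia.
  have a1 := @root_avoids (fun e => e < i + 3)%N 3 isT.
  have a2 := @root_avoids (fun e => i + 3 <= e < n)%N (3 * (r - 1)) (dvdn_mulr _ (dvdnn 3)).
  have a3 := @root_avoids (fun e => e < i + 3)%N (3 * (r - 1)) (dvdn_mulr _ (dvdnn 3)).
  have a4 := @root_avoids (fun e => e < i + 3)%N (3 * (2 * r - 1)) (dvdn_mulr _ (dvdnn 3)).
  rewrite eT; move: (root _ _) (root _ _) (root _ _) (root _ _) e1 e2 e3 e4 a1 a2 a3 a4.
  rewrite eL eM eU => B4 B3 B2 B1 e1 e2 e3 e4 a1 a2 a3 a4.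
  have ex : X ^+ n = X ^+ i * X ^+ 3 * X ^+ (3 * (r - 1)).
    by rewrite -!exprD; congr (_ ^+ _); lia.
  have ex4 : X ^+ (3 * (2 * r - 1)) = X ^+ 3 * X ^+ (3 * (r - 1)) ^+ 2.
    by rewrite -exprM -exprD; congr (_ ^+ _); lia.
  pose w := X ^+ (3 * (r - 1)).
  (* In [K c], the summand [- w U] of [c] cancels the products of order [P^2]. Those of order [P^4]
     match [B1^2], [B2^2], [B3^2], and the one of order 0 matches [B4^2], all up to signs and
     multiples of [2 = P^16]; the order [P^6] gives the three bands of [q]. *)
  exists (X ^+ i * (X ^+ 3 * w + P ^+ 2 * X ^+ 3 + P ^+ 4)),
    (P ^+ 6 * L + P ^+ 2 * U + P ^+ 4 * M - w * U), (P ^+ 2 * (B1 + B2 + B3) + B4).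
  exists (X ^+ i * (P * X ^+ 3 * L + P ^+ 3 * L + P * M) - P ^+ 9 * X ^+ 3 * w ^+ 2 * X ^+ i * U
     - P ^+ 13 * X ^+ i * w * U
     - P ^+ 13 * (Y1 + Y2 + Y3 + (B1 * B2 + B1 * B3 + B2 * B3))
     - P ^+ 11 * (B1 + B2 + B3) * B4 - P ^+ 9 * Y4); split.
  - have h m : sg (X ^+ (3 * m)) = X ^+ (3 * m) by rewrite sgX exprM z3 expr1n rmorph1 mul1r.
    have hi : sg (X ^+ i) = ps_C (z ^+ n) * X ^+ i by rewrite -[i]addn0 -[X in (_ + X)%N](muln0 3) sgX z3m.
    by rewrite rmorphM !rmorphD /= !sgPM rmorphM /= sgP !h (h 1%N) hi -/w; ring.
  - apply: avoidsD; last by apply/avoidsN/avoidsX; rewrite ?dvdn_mulr.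
    by apply: avoidsD; [apply: avoidsD|]; apply: avoidsPX.
  - by apply: avoidsD => //; apply: avoidsPX; do !apply: avoidsD.
  - rewrite ex -/w exprD; move: ex4 e4; rewrite -/w => ->; move: e1 e2 e3; rewrite -/w exprD.
    move: (X ^+ 3) (X ^+ i) w => y x w' e1 e2 e3 e4.
    have -> : (P ^+ 2 * (B1 + B2 + B3) + B4) ^+ 2 = P ^+ 4 * (B1 ^+ 2 + B2 ^+ 2 + B3 ^+ 2) +
       B4 ^+ 2 + 2%:R * (P ^+ 4 * (B1 * B2 + B1 * B3 + B2 * B3) + P ^+ 2 * (B1 + B2 + B3) * B4).
      by ring.
    rewrite e1 e2 e3 e4.
    set Z := 2%:R; pose T1 := y * w' ^+ 2 * x * U + P ^+ 4 * w' * x * U.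
    have -> : x * (y * w' + P ^+ 2 * y + P ^+ 4) * (P ^+ 6 * L + P ^+ 2 * U + P ^+ 4 * M - w' * U) =
      P ^+ 6 * (x * y * w' * L + (x * y * M + x * U) + P ^+ 2 * x * y * L + P ^+ 4 * x * L + P ^+ 2 * x * M) 
       + P ^+ 4 * (y * x * U + w' * x * y * M + w' * x * U) + y * w' ^+ 2 * x * U - 2%:R * T1.
      by rewrite /T1; ring.
    by rewrite -/Z /Z -P16 /T1; ring.
  - by exists (P * X ^+ i * X ^+ 3 + P ^+ 3 * X ^+ i); rewrite ex -/w; ring.
have [L eL aL] := @part_div (fun e => n <= e)%N n (fun e H _ => H) nmod.
have [U eU aU] : exists2 U, part (fun e => e < n)%N = X ^+ i * U & avoids n U.
  by apply: part_div => // e _; apply: ge1.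
have eT : part predT = part (fun e => n <= e)%N + part (fun e => e < n)%N.
  by apply: part_split => e /=; lia.
(* For odd [r] the shift [3r] is odd and [root] applies. For [r = 0] the low band is empty: [n] is
   at most 1 and exponents are odd. *)
have [B [Y1 e1 a1]] : exists B, exists2 Y, B ^+ 2 = X ^+ (3 * r) * part (fun e => e < n)%N + 2%:R * Y &
   avoids n B.
  have [or|er] := boolP (odd r).
    have [|Y e] := @root_sqr (fun e => e < n)%N (3 * r); first by lia.
    by exists (root (fun e => e < n)%N (3 * r)), Y => //; apply: root_avoids; rewrite dvdn_mulr.
  exists 0, 0; last by move=> j; rewrite ps0E.
  suff -> : part (fun e => e < n)%N = 0 by rewrite expr0n !mulr0 addr0.
  apply: funext => e; rewrite /part; case: ifP => // lt.
  have [->|/sE[oe _]] := EM (s e = 0); first by rewrite expr0n.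
  by move: od; rewrite er /= -leqNgt leqn0 => /eqP r0; lia.
rewrite eT; move: e1; rewrite eL eU => e1.
have ex : X ^+ n = X ^+ i * X ^+ (3 * r) by rewrite -exprD -en.
exists (X ^+ i * (X ^+ (3 * r) + P ^+ 2)), (P ^+ 6 * L + P ^+ 4 * U), (P ^+ 2 * B),
  (P * X ^+ i * L - P ^+ 13 * Y1); split.
- have h m : sg (X ^+ (3 * m)) = X ^+ (3 * m) by rewrite sgX exprM z3 expr1n rmorph1 mul1r.
  have hi : sg (X ^+ i) = ps_C (z ^+ n) * X ^+ i by rewrite -[i]addn0 -[X in (_ + X)%N](muln0 3) sgX z3m.
  by rewrite rmorphM rmorphD /= sgP h hi; ring.
- by apply: avoidsD; apply: avoidsPX.
- exact: avoidsPX.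
- have -> : (P ^+ 2 * B) ^+ 2 = P ^+ 4 * B ^+ 2 by ring.
  by rewrite e1 ex -P16; ring.
- by exists (P * X ^+ i); rewrite ex; ring.
Qed.
End LiftingEquations.
(** The Klein four algebra P[Y0, Y1, Y2] *)

(* The free P-module on 1, Y0, Y1, Y2 with Y0^2 = g1 g2, Y0 Y1 = g2 Y2, and
   the relations obtained from these by permuting the indices. *)
Definition klein_alg (P : comNzRingType) (g0 g1 g2 : P) : Type := (P * P * P * P)%type.

Section KleinAlgebra.
Variables (P : comNzRingType) (g0 g1 g2 : P).
Local Notation klein := (klein_alg g0 g1 g2).
HB.instance Definition _ := GRing.Zmodule.copy klein (P * P * P * P)%type.

Definition kl (x y0 y1 y2 : P) : klein := (x, y0, y1, y2).
Definition kc (e : klein) : P := e.1.1.1.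
Definition ky0 (e : klein) : P := e.1.1.2.
Definition ky1 (e : klein) : P := e.1.2.
Definition ky2 (e : klein) : P := e.2.

Definition klein_mul (e f : klein) : klein :=
  kl (kc e * kc f + ky0 e * ky0 f * (g1 * g2) + ky1 e * ky1 f * (g2 * g0)
        + ky2 e * ky2 f * (g0 * g1))
     (kc e * ky0 f + ky0 e * kc f + (ky1 e * ky2 f + ky2 e * ky1 f) * g0)
     (kc e * ky1 f + ky1 e * kc f + (ky2 e * ky0 f + ky0 e * ky2 f) * g1)
     (kc e * ky2 f + ky2 e * kc f + (ky0 e * ky1 f + ky1 e * ky0 f) * g2).
Definition klein_one : klein := kl 1 0 0 0.

Lemma klein_eq (e f : klein) : kc e = kc f -> ky0 e = ky0 f -> ky1 e = ky1 f ->
  ky2 e = ky2 f -> e = f.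
Proof.
by case: e f => [[[a b] c] d] [[[a' b'] c'] d']; rewrite /kc /ky0 /ky1 /ky2 /= => -> -> -> ->.
Qed.
Lemma klein_mulA : associative klein_mul.
Proof. by move=> e f h; apply: klein_eq; rewrite /klein_mul /kc /ky0 /ky1 /ky2 /=; ring. Qed.
Lemma klein_mulC : commutative klein_mul.
Proof. by move=> e f; apply: klein_eq; rewrite /klein_mul /kc /ky0 /ky1 /ky2 /=; ring. Qed.
Lemma klein_mul1 : left_id klein_one klein_mul.
Proof. by move=> e; apply: klein_eq; rewrite /klein_mul /kc /ky0 /ky1 /ky2 /=; ring. Qed.
Lemma klein_mulDl : left_distributive klein_mul +%R.
Proof. by move=> e f h; apply: klein_eq; rewrite /klein_mul /kc /ky0 /ky1 /ky2 /=; ring. Qed.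
Lemma klein_one_neq0 : klein_one != 0.
Proof. by rewrite !xpair_eqE !negb_and oner_neq0. Qed.
HB.instance Definition _ := GRing.Zmodule_isComNzRing.Build klein
  klein_mulA klein_mulC klein_mul1 klein_mulDl klein_one_neq0.

Definition klc (x : P) : klein := kl x 0 0 0.
Lemma klc_additive : zmod_morphism klc.
Proof. by move=> x y; apply: klein_eq; rewrite /klc /kc /ky0 /ky1 /ky2 /= ?subr0. Qed.
HB.instance Definition _ := GRing.isZmodMorphism.Build P klein klc klc_additive.
Lemma klc_monoid : monoid_morphism klc.
Proof.
by split=> // x y; apply: klein_eq; rewrite /klc /kc /ky0 /ky1 /ky2 /= /klein_mul
  /kc /ky0 /ky1 /ky2 /=; ring.
Qed.
HB.instance Definition _ := GRing.isMonoidMorphism.Build P klein klc klc_monoid.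

Lemma klein_cM x (e : klein) : klc x * e = kl (x * kc e) (x * ky0 e) (x * ky1 e) (x * ky2 e).
Proof.
by apply: klein_eq; rewrite /klc /kl /kc /ky0 /ky1 /ky2 /= /klein_mul /kc /ky0 /ky1 /ky2 /=; ring.
Qed.

Definition kl_a (e : klein) : klein := kl (kc e) (ky0 e) (- ky1 e) (- ky2 e).
Definition kl_b (e : klein) : klein := kl (kc e) (- ky0 e) (ky1 e) (- ky2 e).

Lemma kl_a_additive : zmod_morphism kl_a.
Proof. by move=> e f; apply: klein_eq; rewrite /kl_a /kl /kc /ky0 /ky1 /ky2 /=; ring. Qed.
Lemma kl_b_additive : zmod_morphism kl_b.
Proof. by move=> e f; apply: klein_eq; rewrite /kl_b /kl /kc /ky0 /ky1 /ky2 /=; ring. Qed.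
Lemma kl_a_monoid : monoid_morphism kl_a.
Proof.
split=> [|e f]; apply: klein_eq; rewrite /kl_a /kl /kc /ky0 /ky1 /ky2 /= ?oppr0 //;
  rewrite /klein_mul /kl /kc /ky0 /ky1 /ky2 /=; ring.
Qed.
Lemma kl_b_monoid : monoid_morphism kl_b.
Proof.
split=> [|e f]; apply: klein_eq; rewrite /kl_b /kl /kc /ky0 /ky1 /ky2 /= ?oppr0 //;
  rewrite /klein_mul /kl /kc /ky0 /ky1 /ky2 /=; ring.
Qed.
HB.instance Definition _ := GRing.isZmodMorphism.Build klein klein kl_a kl_a_additive.
HB.instance Definition _ := GRing.isZmodMorphism.Build klein klein kl_b kl_b_additive.
HB.instance Definition _ := GRing.isMonoidMorphism.Build klein klein kl_a kl_a_monoid.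
HB.instance Definition _ := GRing.isMonoidMorphism.Build klein klein kl_b kl_b_monoid.

Lemma kl_aK e : kl_a (kl_a e) = e.
Proof. by apply: klein_eq; rewrite /kl_a /kl /kc /ky0 /ky1 /ky2 /= ?opprK. Qed.
Lemma kl_bK e : kl_b (kl_b e) = e.
Proof. by apply: klein_eq; rewrite /kl_b /kl /kc /ky0 /ky1 /ky2 /= ?opprK. Qed.

Variable sg : {rmorphism P -> P}.
Definition kl_s (e : klein) : klein := kl (sg (kc e)) (sg (ky2 e)) (sg (ky0 e)) (sg (ky1 e)).
Lemma kl_s_additive : zmod_morphism kl_s.
Proof. by move=> e f; apply: klein_eq; rewrite /kl_s /kl /kc /ky0 /ky1 /ky2 /= rmorphB. Qed.
Lemma kl_sa e : kl_s (kl_a e) = kl_b (kl_s e).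
Proof. by apply: klein_eq; rewrite /kl_s /kl_a /kl_b /kl /kc /ky0 /ky1 /ky2 /= ?rmorphN. Qed.
Lemma kl_sb e : kl_s (kl_b e) = kl_a (kl_b (kl_s e)).
Proof.
by apply: klein_eq; rewrite /kl_s /kl_a /kl_b /kl /kc /ky0 /ky1 /ky2 /= ?rmorphN ?opprK.
Qed.
Lemma kl_sK : (forall x, sg (sg (sg x)) = x) -> forall e, kl_s (kl_s (kl_s e)) = e.
Proof. by move=> H e; apply: klein_eq; rewrite /kl_s /kl /kc /ky0 /ky1 /ky2 /= H. Qed.
Hypotheses (sg0 : sg g0 = g1) (sg1 : sg g1 = g2) (sg2 : sg g2 = g0).
Lemma kl_s_monoid : monoid_morphism kl_s.
Proof.
split=> [|e f]; apply: klein_eq; rewrite /kl_s /kl /kc /ky0 /ky1 /ky2 /= ?rmorph0 ?rmorph1 //;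
  rewrite /klein_mul /kl /kc /ky0 /ky1 /ky2 /= !(rmorphD, rmorphM) /= ?(sg0, sg1, sg2); ring.
Qed.
End KleinAlgebra.

Lemma rmorph_quad (A B : comNzRingType) (f : {rmorphism A -> B}) a b c d x y :
  f (a + b * x + (c + d * x) * y) = f a + f b * f x + (f c + f d * f x) * f y.
Proof. by rewrite !(rmorphD, rmorphM). Qed.

Section QuadraticExtension.
Variables (E : comNzRingType).
Implicit Types K : E -> Prop.
Definition quad_ext K (w e : E) : Prop := exists a b, [/\ K a, K b & e = a + b * w].
Lemma quad_base K w e : subring_prop K -> K e -> quad_ext K w e.
Proof. by move=> sK Ke; exists e, 0; split=> //; [apply: K0 | rewrite mul0r addr0]. Qed.
Lemma quad_gen K w : subring_prop K -> quad_ext K w w.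
Proof.
by move=> sK; exists 0, 1; split; [apply: K0 | case: sK | rewrite mul1r add0r].
Qed.
Lemma quad_subring K w h f : subring_prop K -> K h -> K f -> w ^+ 2 = h * w + f ->
  subring_prop (quad_ext K w).
Proof.
move=> sK Kh Kf e; split.
- by apply: quad_base => //; case: sK.
- move=> _ _ [a [b [Ka Kb ->]]] [c [d [Kc Kd ->]]]; exists (a - c), (b - d).
  by case: sK => _ KB _; split; [apply: KB | apply: KB | ring].
- move=> _ _ [a [b [Ka Kb ->]]] [c [d [Kc Kd ->]]].
  exists (a * c + b * d * f), (a * d + b * c + b * d * h); split.
  + by apply: KD => //; do ?apply: KM.
  + by apply: KD => //; [apply: KD => //|]; do ?apply: KM.
  + have -> : (a + b * w) * (c + d * w) = a * c + (a * d + b * c) * w + b * d * w ^+ 2 by ring.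
    by rewrite e; ring.
Qed.
Lemma quad_closed K a b c d x y : subring_prop K ->
  K a -> K b -> K c -> K d -> K x -> K y -> K (a + b * x + (c + d * x) * y).
Proof. by move=> sK *; do ?[assumption | apply: (KD sK) | apply: (KM sK)]. Qed.
End QuadraticExtension.
(** The lifted ring *)

(** [f] maps a finite expansion with remainder to another one, so its continuity need not be
    assumed. *)
Lemma aut_comp (k : fieldType) (f : {rmorphism ps k -> ps k}) c (t x : ps k) :
  (forall d, f (ps_C d) = ps_C d) -> vge 1 t -> f t = ps_C c * t ->
  f (ps_comp t x) = ps_comp t (ps_sub c x).
Proof.
move=> fC t1 ft; apply: ps_comp_uniq => // m.
have [r _ e] := ps_comp_expands t1 x m; exists (ps_C (c ^+ m) * f r) => //.
rewrite {1}e rmorphD rmorphM rmorphXn rmorph_sum /= ft; congr (_ + _); last first.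
  by rewrite exprMn rmorphXn; ring.
apply: eq_bigr => i _; rewrite rmorphM rmorphXn /= ft fC exprMn /ps_sub rmorphM rmorphXn.
by ring.
Qed.

Lemma ps_sub1 (A : comNzRingType) (f : ps A) : ps_sub 1 f = f.
Proof. by apply: funext => i; rewrite /ps_sub expr1n mul1r. Qed.

Section Lift.
Variables (k : closedFieldType) (char2 : 2%N \in [pchar k]).
Variables (R : idomainType) (red : {rmorphism R -> k}) (p : R) (te : k -> R) (z : R).
Hypotheses (p16 : p ^+ 16 = 2%:R) (redp : red p = 0) (p0 : p <> 0)
  (pdiv : forall a, red a = 0 -> exists b, a = p * b)
  (psep : forall a, (forall n, exists b, a = p ^+ n * b) -> a = 0)
  (pcomplete : forall u : nat -> R, exists a, forall n, exists b,
      a = \sum_(i < n) p ^+ i * u i + p ^+ n * b)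
  (runit : forall a, red a <> 0 -> a \is a GRing.unit)
  (rte : forall c, red (te c) = c)
  (z3 : z ^+ 3 = 1).
Local Notation S := (ps R).
Local Notation X := (psX R).
Local Notation sg := (ps_sub z).
Local Notation redS := (ps_map red).
Let P : S := ps_C p.

Variables (al be s : {rmorphism ps k -> ps k}).
Hypotheses (alC : forall c, al (ps_C c) = ps_C c) (beC : forall c, be (ps_C c) = ps_C c)
  (sC : forall c, s (ps_C c) = ps_C c).
Hypotheses (al2 : forall x, al (al x) = x) (be2 : forall x, be (be x) = x)
  (albe : forall x, al (be x) = be (al x)) (s3 : forall x, s (s (s x)) = x)
  (sal : forall x, s (al x) = be (s x)) (sbe : forall x, s (be x) = al (be (s x))).
Hypotheses (alV : forall m x, vge m x -> vge m (al x))
  (beV : forall m x, vge m x -> vge m (be x)).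
Variables (t w0 q : ps k) (n : nat).
Hypotheses (vt : has_val 4 t) (alt : al t = t) (bet : be t = t)
  (st : s t = ps_C (red z) * t) (n0 : (0 < n)%N)
  (alw : al w0 = w0) (bew : be w0 = w0 + t ^+ n)
  (vq : has_val 1 q) (wq : w0 ^+ 2 + t ^+ n * w0 = ps_comp t q).
Let w1 := s w0.
Let w2 := s w1.
Hypothesis wtr : w0 + ps_C (red z ^+ (2 * n)) * w1 + ps_C (red z ^+ n) * w2 = 0.
Hypothesis fixal : forall x, al x = x -> exists a b, x = ps_comp t a + ps_comp t b * w0.
Hypothesis jump : forall m x, vge m x -> vge (m + 2 * n - 1) (al x + x).

Variables (G H Phi U : S).
Hypotheses (eqF : sg G * sg (sg G) = H ^+ 2 + 4%:R * Phi)
  (eqT : G * H - sg H * sg (sg H) = 2%:R * P * U)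
  (redG : redS G = psX k ^+ n) (redH : redS H = psX k ^+ n) (redPhi : redS Phi = q).

Lemma two_psk : 2%:R = 0 :> ps k.
Proof. by rewrite -(rmorph_nat (@ps_C k)) pcharf0 // rmorph0. Qed.
Lemma addxx (x : ps k) : x + x = 0.
Proof. by rewrite -mulr2n -mulr_natl two_psk mul0r. Qed.
Lemma oppx (x : ps k) : - x = x.
Proof. by apply/eqP; rewrite eq_sym -addr_eq0 addxx. Qed.

Lemma addx_eq0 (x y : ps k) : x + y = 0 -> x = y.
Proof. by move=> e; apply/eqP; rewrite -subr_eq0 [- y]oppx e. Qed.

Lemma t1 : vge 1 t. Proof. by apply: vgeW vt.1. Qed.
Lemma t_neq0 : t <> 0. Proof. exact: has_val_neq0 vt. Qed.

(** Reduction modulo [p] followed by [T -> t]; its image is [k[[t]]] inside [k[[z]]]. *)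
Definition cS (f : S) : ps k := ps_comp t (redS f).
Lemma cS_additive : zmod_morphism cS.
Proof. by move=> f g; rewrite /cS rmorphB ps_comp_additive //; apply: t1. Qed.
HB.instance Definition _ := GRing.isZmodMorphism.Build S (ps k) cS cS_additive.
Lemma cS_monoid : monoid_morphism cS.
Proof.
have [c1 cM] := ps_comp_monoid t1.
by split=> [|f g]; rewrite /cS ?rmorph1 ?rmorphM.
Qed.
HB.instance Definition _ := GRing.isMonoidMorphism.Build S (ps k) cS cS_monoid.

Lemma cS_eq0 f : cS f = 0 -> redS f = 0.
Proof. exact: ps_comp_inj vt isT. Qed.
Lemma cS_P f : cS (P * f) = 0.
Proof.
rewrite rmorphM /= /cS /P ps_map_C redp rmorph0 (_ : ps_comp t 0 = 0) ?mul0r //.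
by rewrite -(rmorph0 (@ps_C k)) ps_comp_C ?rmorph0 //; apply: t1.
Qed.
Lemma cS_p : cS P = 0. Proof. by rewrite -[P]mulr1 cS_P. Qed.
Lemma cS_C c : cS (ps_C c) = ps_C (red c).
Proof. by rewrite /cS ps_map_C ps_comp_C //; apply: t1. Qed.
Lemma cS_X : cS X = t.
Proof. by rewrite /cS ps_map_X ps_comp_X //; apply: t1. Qed.
Lemma cS_redXn f m : redS f = psX k ^+ m -> cS f = t ^+ m.
Proof. by move=> e; rewrite /cS e -(ps_map_X red) -rmorphXn -/(cS _) rmorphXn /= cS_X. Qed.
Lemma cS_s f : s (cS f) = cS (sg f).
Proof. by rewrite /cS (aut_comp _ sC t1 st) ps_map_sub. Qed.
Lemma cS_al f : al (cS f) = cS f.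
Proof. by rewrite /cS (@aut_comp _ _ 1 _ _ alC t1) ?ps_sub1 // rmorph1 mul1r. Qed.
Lemma cS_be f : be (cS f) = cS f.
Proof. by rewrite /cS (@aut_comp _ _ 1 _ _ beC t1) ?ps_sub1 // rmorph1 mul1r. Qed.

Lemma redS_surj x : exists f, redS f = x.
Proof. by exists (fun i => te (x i)); apply: funext => i; rewrite /ps_map rte. Qed.

Lemma pdivS f : redS f = 0 -> exists g, f = P * g.
Proof.
move=> e; have H' i : exists b, f i = p * b.
  by apply: pdiv; rewrite -[LHS]/(redS f i) e.
have [g Hg] := choice H'; exists g; apply: funext => i.
by rewrite psCM.
Qed.

Lemma bew1 : be w1 = w1. Proof. by rewrite /w1 -sal alw. Qed.
Lemma alw1 : al w1 = w1 + s t ^+ n.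
Proof. by rewrite -bew1 -/w1 -sbe bew rmorphD rmorphXn bew1. Qed.

(** * Lifts of the generators over a field containing [R] *)

Variables (kap : fieldType) (jR : {rmorphism R -> kap}).
Hypothesis jR_inj : injective jR.
Local Notation j := (ps_map jR).
Lemma j_inj f g : j f = j g -> f = g.
Proof.
move=> e; apply: funext => i; apply: jR_inj.
exact: (congr1 (fun h : ps kap => h i) e).
Qed.
Definition intP (y : ps kap) : Prop := exists f, y = j f.
Lemma intP_subring : subring_prop intP.
Proof.
split; first by exists 1; rewrite rmorph1.
  by move=> _ _ [f ->] [g ->]; exists (f - g); rewrite rmorphB.
by move=> _ _ [f ->] [g ->]; exists (f * g); rewrite rmorphM.
Qed.
Definition pK : ps kap := j P.
Definition pinv : ps kap := ps_C ((jR p)^-1).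
Lemma pKV : pK * pinv = 1.
Proof.
rewrite /pK /pinv ps_map_C -rmorphM divff ?rmorph1 //.
by rewrite -(rmorph0 jR) (inj_eq jR_inj); apply/eqP.
Qed.
Lemma pK_inj x y : pK * x = pK * y -> x = y.
Proof. by move=> e; rewrite -[x]mul1r -[y]mul1r -pKV -!(mulrC pinv) -!mulrA e. Qed.

(** [P] is a prime of [S] that does not divide [f], so the factors [P] of the denominator can be
    removed one by one. *)
Lemma intP_div f N y : redS f <> 0 -> intP (pK ^+ N * y) -> intP (j f * y) -> intP y.
Proof.
move=> nf; elim: N y => [|N IH] y; first by rewrite expr0 mul1r.
move=> [m em] [m' em']; apply: IH; last by exists m'.
have e : f * m = P * (P ^+ N * m').
  by apply: j_inj; rewrite !rmorphM rmorphXn /= -em -em' -/pK exprS; ring.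
have [|m1 em1] := @pdivS m.
  have /ps_mulf_eq0[//|//] : redS f * redS m = 0.
  by rewrite -rmorphM e rmorphM /= /P ps_map_C redp rmorph0 mul0r.
by exists m1; apply: pK_inj; rewrite mulrA -exprS em em1 rmorphM /=.
Qed.

Let g0 := j G.
Let g1 := j (sg G).
Let g2 := j (sg (sg G)).
Definition LL : comNzRingType := klein_alg g0 g1 g2.
(* The lift of k[[z]] lives in E as the ring of pairs formed by an element and
   its reduction. *)
Definition E : comNzRingType := (LL * ps k)%type.
Definition p1 (e : E) : LL := e.1.
Definition p2 (e : E) : ps k := e.2.
Lemma p1_additive : zmod_morphism p1. Proof. by []. Qed.
Lemma p1_monoid : monoid_morphism p1. Proof. by []. Qed.
Lemma p2_additive : zmod_morphism p2. Proof. by []. Qed.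
Lemma p2_monoid : monoid_morphism p2. Proof. by []. Qed.
HB.instance Definition _ := GRing.isZmodMorphism.Build E LL p1 p1_additive.
HB.instance Definition _ := GRing.isMonoidMorphism.Build E LL p1 p1_monoid.
HB.instance Definition _ := GRing.isZmodMorphism.Build E (ps k) p2 p2_additive.
HB.instance Definition _ := GRing.isMonoidMorphism.Build E (ps k) p2 p2_monoid.
Lemma p1M e f : p1 (e * f) = p1 e * p1 f. Proof. by []. Qed.
Lemma p2M e f : p2 (e * f) = p2 e * p2 f. Proof. by []. Qed.
Lemma p1B e f : p1 (e - f) = p1 e - p1 f. Proof. by []. Qed.
Lemma p2B e f : p2 (e - f) = p2 e - p2 f. Proof. by []. Qed.
Lemma p2D e f : p2 (e + f) = p2 e + p2 f. Proof. by []. Qed.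
Lemma p1D e f : p1 (e + f) = p1 e + p1 f. Proof. by []. Qed.
Lemma E_eq e f : p1 e = p1 f -> p2 e = p2 f -> e = f.
Proof. by case: e f => [x a] [y b]; rewrite /p1 /p2 /= => -> ->. Qed.

Definition tS (f : S) : E := (klc g0 g1 g2 (j f), cS f).
Lemma tS_additive : zmod_morphism tS.
Proof. by move=> f h; apply: E_eq; rewrite /p1 /p2 /=; [rewrite !rmorphB | exact: cS_additive]. Qed.
Lemma tS_monoid : monoid_morphism tS.
Proof.
have [c1 cM] := cS_monoid.
by split=> [|f h]; apply: E_eq; rewrite /p1 /p2 /= ?c1 ?cM // ?rmorph1 // !rmorphM.
Qed.
HB.instance Definition _ := GRing.isZmodMorphism.Build S E tS tS_additive.
HB.instance Definition _ := GRing.isMonoidMorphism.Build S E tS tS_monoid.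
Lemma tS1 f : p1 (tS f) = klc g0 g1 g2 (j f). Proof. by []. Qed.
Lemma tS2 f : p2 (tS f) = cS f. Proof. by []. Qed.

Definition aE (e : E) : E := (kl_a (p1 e), al (p2 e)).
Definition bE (e : E) : E := (kl_b (p1 e), be (p2 e)).
Definition sE (e : E) : E :=
  (kl_s (ps_sub (jR z)) (p1 e), s (p2 e)).
Lemma aE_additive : zmod_morphism aE.
Proof. by move=> e f; apply: E_eq; rewrite /p1 /p2 /= rmorphB. Qed.
Lemma aE_monoid : monoid_morphism aE.
Proof.
by split=> [|e f]; apply: E_eq; rewrite /p1 /p2 /= ?rmorph1 ?rmorphM.
Qed.
Lemma bE_additive : zmod_morphism bE.
Proof. by move=> e f; apply: E_eq; rewrite /p1 /p2 /= rmorphB. Qed.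
Lemma bE_monoid : monoid_morphism bE.
Proof.
by split=> [|e f]; apply: E_eq; rewrite /p1 /p2 /= ?rmorph1 ?rmorphM.
Qed.
HB.instance Definition _ := GRing.isZmodMorphism.Build E E aE aE_additive.
HB.instance Definition _ := GRing.isMonoidMorphism.Build E E aE aE_monoid.
HB.instance Definition _ := GRing.isZmodMorphism.Build E E bE bE_additive.
HB.instance Definition _ := GRing.isMonoidMorphism.Build E E bE bE_monoid.

Lemma j_s f : ps_sub (jR z) (j f) = j (sg f).
Proof. by rewrite ps_map_sub. Qed.
Lemma sg3 (f : S) : sg (sg (sg f)) = f.
Proof. exact: ps_sub3. Qed.
Lemma sE_additive : zmod_morphism sE.
Proof. by move=> e f; apply: E_eq; rewrite /p1 /p2 /= ?kl_s_additive ?rmorphB. Qed.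
Lemma sE_monoid : monoid_morphism sE.
Proof.
have [||| k1 kM] := @kl_s_monoid _ g0 g1 g2 (ps_sub (jR z)).
- exact: j_s.
- exact: j_s.
- by rewrite [LHS]j_s sg3.
by split=> [|e f]; apply: E_eq; rewrite /p1 /p2 /= ?k1 ?kM ?rmorph1 ?rmorphM.
Qed.
HB.instance Definition _ := GRing.isZmodMorphism.Build E E sE sE_additive.
HB.instance Definition _ := GRing.isMonoidMorphism.Build E E sE sE_monoid.

Lemma aE_tS f : aE (tS f) = tS f.
Proof. by apply: E_eq; rewrite /p1 /p2 /= ?cS_al //;
  apply: klein_eq; rewrite /kl_a /klc /kl /kc /ky0 /ky1 /ky2 /= ?oppr0. Qed.
Lemma bE_tS f : bE (tS f) = tS f.
Proof. by apply: E_eq; rewrite /p1 /p2 /= ?cS_be //;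
  apply: klein_eq; rewrite /kl_b /klc /kl /kc /ky0 /ky1 /ky2 /= ?oppr0. Qed.
Lemma sE_tS f : sE (tS f) = tS (sg f).
Proof.
apply: E_eq; rewrite /p1 /p2 /= ?cS_s //.
by apply: klein_eq; rewrite /kl_s /klc /kl /kc /ky0 /ky1 /ky2 /= ?rmorph0 // j_s.
Qed.

Definition hk : ps kap := ps_C (2%:R)^-1.
Lemma hk2 : 2%:R * hk = 1.
Proof.
rewrite -[2%:R](rmorph_nat (@ps_C kap)) /hk -rmorphM divff ?rmorph1 //.
rewrite -(rmorph_nat jR) -p16 rmorphXn expf_neq0 //.
by rewrite -(rmorph0 jR) (inj_eq jR_inj); apply/eqP.
Qed.

Let H0 := H.
Let H1 := sg H.
Let H2 := sg (sg H).
(* W_i = (H_i - Y_i) / 2 is a root of W^2 = H_i W + s^i Phi, and lifts w_i. *)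
Definition W0 : E := (kl g0 g1 g2 (hk * j H0) (- hk) 0 0, w0).
Definition W1 : E := (kl g0 g1 g2 (hk * j H1) 0 (- hk) 0, w1).
Definition W2 : E := (kl g0 g1 g2 (hk * j H2) 0 0 (- hk), w2).

Lemma sC_tS c f : s (ps_C c * f) = ps_C c * s f.
Proof. by rewrite rmorphM /= sC. Qed.
Lemma cS_H0 : cS H0 = t ^+ n. Proof. exact: cS_redXn. Qed.
Lemma cS_H1 : cS H1 = s t ^+ n. Proof. by rewrite -cS_s cS_H0 rmorphXn. Qed.
Lemma cS_G0 : cS G = t ^+ n. Proof. exact: cS_redXn. Qed.

Lemma sE_W0 : sE W0 = W1.
Proof.
apply: E_eq => //; apply: klein_eq; rewrite /kl_s /kl /kc /ky0 /ky1 /ky2 /= ?rmorph0 //.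
  by rewrite rmorphM /= j_s /hk ps_sub_C.
by rewrite rmorphN /= /hk ps_sub_C.
Qed.
Lemma sE_W1 : sE W1 = W2.
Proof.
apply: E_eq => //; apply: klein_eq; rewrite /kl_s /kl /kc /ky0 /ky1 /ky2 /= ?rmorph0 //.
  by rewrite rmorphM /= j_s /hk ps_sub_C.
by rewrite rmorphN /= /hk ps_sub_C.
Qed.

Lemma klM (e f : LL) : e * f = klein_mul e f. Proof. by []. Qed.

Lemma W0_sqr : W0 ^+ 2 = tS H * W0 + tS Phi.
Proof.
have h2 := hk2.
apply: E_eq; last first.
  rewrite rmorphXn rmorphD rmorphM /= cS_H0 /cS redPhi -wq.
  by rewrite addrA [_ + w0 ^+ 2]addrC -addrA addxx addr0.
rewrite rmorphXn rmorphD rmorphM /= expr2 klein_cM klM.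
have e : j Phi = hk * hk * (g1 * g2 - j H * j H).
  have -> : g1 * g2 = j H * j H + 4%:R * j Phi.
    by rewrite /g1 /g2 -rmorphM eqF rmorphD rmorphXn rmorphM rmorph_nat expr2.
  have -> : hk * hk * (j H * j H + 4%:R * j Phi - j H * j H) = (2%:R * hk) ^+ 2 * j Phi by ring.
  by rewrite h2 expr1n mul1r.
rewrite /klc e; apply: klein_eq; rewrite /klein_mul /kl /kc /ky0 /ky1 /ky2 /=; try ring.
- have -> : forall x y : ps kap, hk * x * (hk * x) + - hk * - hk * y + 0 * 0 * (g2 * g0) + 0 * 0 * (g0 * g1) =
    x * (hk * x) * (2%:R * hk) + hk * hk * (y - x * x) by move=> x y; ring.
  by rewrite h2; ring.
- have -> : hk * j H0 * - hk + - hk * (hk * j H0) + (0 * 0 + 0 * 0) * g0 =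
    j H * - hk * (2%:R * hk) by rewrite /H0; ring.
  by rewrite h2; ring.
Qed.
Lemma W1_sqr : W1 ^+ 2 = tS H1 * W1 + tS (sg Phi).
Proof. by rewrite -sE_W0 -rmorphXn W0_sqr rmorphD rmorphM /= !sE_tS. Qed.

Lemma aE_W0 : aE W0 = W0.
Proof.
by apply: E_eq => //; apply: klein_eq; rewrite /kl_a /kl /kc /ky0 /ky1 /ky2 /= ?oppr0.
Qed.
Lemma bE_W1 : bE W1 = W1.
Proof.
apply: E_eq; last exact: bew1.
by apply: klein_eq; rewrite /kl_b /kl /kc /ky0 /ky1 /ky2 /= ?oppr0.
Qed.
Lemma aE_W1 : aE W1 = tS H1 - W1.
Proof.
apply: E_eq; last by rewrite rmorphB /= cS_H1 oppx addrC -alw1.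
rewrite rmorphB /=; apply: klein_eq; rewrite /kl_a /klc /kl /kc /ky0 /ky1 /ky2 /=; try ring.
by rewrite -{2}[j H1]mul1r -hk2; ring.
Qed.
Lemma bE_W0 : bE W0 = tS H0 - W0.
Proof.
apply: E_eq; last by rewrite rmorphB /= cS_H0 oppx addrC -bew.
rewrite rmorphB /=; apply: klein_eq; rewrite /kl_b /klc /kl /kc /ky0 /ky1 /ky2 /=; try ring.
by rewrite -{2}[j H0]mul1r -hk2; ring.
Qed.

(** The first component is [Y0 Y1 = g2 Y2] rewritten in the [W_i], with [eqT] turning the constant
    term into a multiple of [P]; the second is the linear relation [wtr] multiplied by a power of
    [t]. It is the reason why [W2] is integral at [p]. *)
Lemma GW2 : tS (sg (sg G)) * W2 =
  tS H1 * W0 + tS H0 * W1 - 2%:R * (W0 * W1) + tS (P * sg (sg U)).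
Proof.
have h2 := hk2.
apply: E_eq; last first.
  rewrite !(rmorphD, rmorphB, rmorphM) /= addxx mul0r subr0 cS_p mul0r addr0.
  rewrite cS_H1 cS_H0 -!cS_s cS_G0 !rmorphXn /= st sC_tS st !exprMn.
  have aaa : (ps_C (red z) ^+ n) ^+ 3 = 1.
    by rewrite -exprM mulnC exprM -(rmorphXn (@ps_C k)) -(rmorphXn red) z3 !rmorph1 expr1n.
  move: wtr; rewrite !rmorphXn /= mulnC exprM.
  move: (ps_C (red z) ^+ n) aaa => a aaa e.
  have e' : a * (a * t ^+ n) * w2 + (a * t ^+ n * w0 + a ^+ 3 * t ^+ n * w1) = 0.
    by rewrite -(mulr0 (a * t ^+ n)) -e; ring.
  by rewrite aaa mul1r in e'; apply: addx_eq0.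
have eT : j (sg (sg G)) * j H2 = j H0 * j H1 + 2%:R * pK * j (sg (sg U)).
  have := congr1 (fun x => sg (sg x)) eqT; rewrite !rmorphB !rmorphM /= !sg3.
  have sgP : sg P = P by exact: ps_sub_C.
  rewrite !sgP !rmorph_nat => /(congr1 j); rewrite rmorphB !rmorphM rmorph_nat /= -/pK => <-.
  by rewrite /H0 /H1 /H2; ring.
rewrite !(rmorphD, rmorphB, rmorphM) /=.
have -> : 1 + 1 = klc g0 g1 g2 2%:R by rewrite rmorph_nat.
(* The coordinates agree only modulo [2 hk = 1], which [ring] ignores; [c] is the cofactor of this
   relation. *)
have fin (x y c : ps kap) : x - y = (2%:R * hk - 1) * c -> x = y.
  by rewrite h2 subrr mul0r => /eqP; rewrite subr_eq0 => /eqP.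
rewrite !klein_cM /klc; apply: klein_eq; rewrite /klein_mul /kl /kc /ky0 /ky1 /ky2 /=;
  rewrite /kc /ky0 /ky1 /ky2 /=.
- rewrite mulrCA eT; apply: (fin _ _ (pK * j (sg (sg U)) + hk * j H0 * j H1)).
  by rewrite /pK; ring.
- by apply: (fin _ _ (- hk * j H1)); ring.
- by apply: (fin _ _ (- hk * j H0)); ring.
- by apply: (fin _ _ (hk * g2)); rewrite /g2; ring.
Qed.
Definition imS (e : E) : Prop := exists f, e = tS f.
Lemma imS_subring : subring_prop imS.
Proof.
split; first by exists 1; rewrite rmorph1.
  by move=> _ _ [f ->] [g ->]; exists (f - g); rewrite rmorphB.
by move=> _ _ [f ->] [g ->]; exists (f * g); rewrite rmorphM.
Qed.
(** The [S]-module generated by [1], [W0], [W1], [W0 W1]. By [GW2] it contains a multiple of [W2],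
    which becomes enough after localization. *)
Definition NN : E -> Prop := quad_ext (quad_ext imS W0) W1.
Lemma N0_subring : subring_prop (quad_ext imS W0).
Proof.
apply: (quad_subring imS_subring _ _ W0_sqr); [by exists H | by exists Phi].
Qed.
Lemma NN_subring : subring_prop NN.
Proof.
apply: (quad_subring N0_subring _ _ W1_sqr); apply: quad_base imS_subring _.
  by exists H1.
by exists (sg Phi).
Qed.
Lemma NN_tS f : NN (tS f).
Proof. by apply: quad_base N0_subring _; apply: quad_base imS_subring _; exists f. Qed.
Lemma NN_W0 : NN W0.
Proof. by apply: quad_base N0_subring _; apply: quad_gen imS_subring. Qed.
Lemma NN_W1 : NN W1. Proof. exact: quad_gen N0_subring. Qed.
Lemma NN_rep e : NN e -> exists b0 b1 b2 b3,
  e = tS b0 + tS b1 * W0 + (tS b2 + tS b3 * W0) * W1.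
Proof.
move=> [_ [_ [[_ [_ [[b0 ->] [b1 ->] ->]]] [_ [_ [[b2 ->] [b3 ->] ->]]] ->]]].
by exists b0, b1, b2, b3.
Qed.
Lemma NN_mk b0 b1 b2 b3 : NN (tS b0 + tS b1 * W0 + (tS b2 + tS b3 * W0) * W1).
Proof.
exact: (quad_closed NN_subring (NN_tS _) (NN_tS _) (NN_tS _) (NN_tS _) NN_W0 NN_W1).
Qed.

Lemma NN_a e : NN e -> NN (aE e).
Proof.
move=> /NN_rep[b0 [b1 [b2 [b3 ->]]]].
rewrite (rmorph_quad aE) /= !aE_tS aE_W0 aE_W1.
apply: (quad_closed NN_subring (NN_tS _) (NN_tS _) (NN_tS _) (NN_tS _) NN_W0).
by case: NN_subring => _ NB _; apply: NB; [apply: NN_tS | apply: NN_W1].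
Qed.
Lemma NN_b e : NN e -> NN (bE e).
Proof.
move=> /NN_rep[b0 [b1 [b2 [b3 ->]]]].
rewrite (rmorph_quad bE) /= !bE_tS bE_W0 bE_W1.
apply: (quad_closed NN_subring (NN_tS _) (NN_tS _) (NN_tS _) (NN_tS _) _ NN_W1).
by case: NN_subring => _ NB _; apply: NB; [apply: NN_tS | apply: NN_W0].
Qed.

Lemma redX_neq0 f m : redS f = psX k ^+ m -> redS f <> 0.
Proof. by move=> ->; apply: has_val_neq0 (has_val_exp m (has_valX k)). Qed.
Lemma redG0 : redS G <> 0. Proof. exact: redX_neq0 redG. Qed.
Lemma redG_s (f : S) : redS f <> 0 -> redS (sg f) <> 0.
Proof.
move=> nz e; apply: nz.
by rewrite -[f]sg3 2!ps_map_sub e !rmorph0.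
Qed.
Lemma redG2 : redS (sg (sg G)) <> 0. Proof. by do 2!apply: redG_s; apply: redG0. Qed.

Lemma hk_inj x y : hk * x = hk * y -> x = y.
Proof. by move=> e; rewrite -[x]mul1r -[y]mul1r -hk2 -!mulrA e. Qed.

Lemma coordsN b0 b1 b2 b3 :
  p1 (tS b0 + tS b1 * W0 + (tS b2 + tS b3 * W0) * W1) =
  kl g0 g1 g2 (j b0 + hk * (j b1 * j H0) + hk * (j b2 * j H1) + hk * (hk * (j b3 * j H0 * j H1)))
   (hk * - (j b1 + hk * (j b3 * j H1))) (hk * - (j b2 + hk * (j b3 * j H0)))
   (hk * (hk * (j b3 * g2))).
Proof.
rewrite (rmorph_quad p1) /= !klein_cM /klc klM.
by apply: klein_eq; rewrite /klein_mul /kl /kc /ky0 /ky1 /ky2 /=;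
  rewrite /kc /ky0 /ky1 /ky2 /=; ring.
Qed.

Lemma kl_inj (a b c d a' b' c' d' : ps kap) :
  kl g0 g1 g2 a b c d = kl g0 g1 g2 a' b' c' d' -> [/\ a = a', b = b', c = c' & d = d'].
Proof. by move=> [-> -> -> ->]. Qed.

Lemma coordsN_P b0 b1 b2 b3 x :
  p1 (tS b0 + tS b1 * W0 + (tS b2 + tS b3 * W0) * W1) = klc g0 g1 g2 x ->
  [/\ b1 = 0, b2 = 0, b3 = 0 & j b0 = x].
Proof.
rewrite coordsN => /kl_inj[e0 e1 e2 e3].
have hk0 y : hk * y = 0 -> y = 0 by rewrite -[X in _ = X](mulr0 hk) => /hk_inj.
have b30 : b3 = 0.
  have : b3 * sg (sg G) = 0 by apply: j_inj; rewrite rmorphM rmorph0; apply/hk0/hk0.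
  by case/ps_mulf_eq0 => // e; case: redG2; rewrite e rmorph0.
move: e0 e1 e2; rewrite b30 rmorph0 !mul0r !mulr0 !addr0 => e0 /hk0 /eqP + /hk0 /eqP.
rewrite !oppr_eq0 => /eqP e1 /eqP e2.
have b10 : b1 = 0 by apply: j_inj; rewrite rmorph0.
have b20 : b2 = 0 by apply: j_inj; rewrite rmorph0.
by split=> //; rewrite -e0 b10 b20 !rmorph0 !mul0r mulr0 !addr0.
Qed.

Lemma NN_P e x : NN e -> p1 e = klc g0 g1 g2 x -> exists f, e = tS f.
Proof.
move=> /NN_rep[b0 [b1 [b2 [b3 ->]]]] /coordsN_P[-> -> -> _].
by exists b0; rewrite !rmorph0 !mul0r !addr0 mul0r addr0.
Qed.
Lemma NN_fun e : NN e -> p1 e = 0 -> e = 0.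
Proof.
move=> /NN_rep[b0 [b1 [b2 [b3 ->]]]] h.
have [|-> -> -> e0] := @coordsN_P b0 b1 b2 b3 0; first by rewrite h rmorph0.
have -> : b0 = 0 by apply: j_inj; rewrite e0 rmorph0.
by rewrite !(rmorph0, mul0r, addr0).
Qed.

(** [1], [w0], [w1], [w0 w1] are independent over [k[[t]]]: subtracting the image under [al]
    isolates the coefficient of [w1], and then [be] does the same for [w0]. So all four coefficients
    reduce to zero. *)
Lemma NN_div e : NN e -> p2 e = 0 -> exists2 e', NN e' & e = tS P * e'.
Proof.
move=> /NN_rep[b0 [b1 [b2 [b3 ->]]]]; rewrite (rmorph_quad p2) /= => h.
have cn f m : cS f * t ^+ m = 0 -> cS f = 0.
  by case/ps_mulf_eq0 => // ez; case: (ps_expf_neq0 (n := m) t_neq0).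
have st0 : s t <> 0.
  by move=> ez; apply: t_neq0; rewrite -[t]s3 ez !rmorph0.
have h1 : cS b2 + cS b3 * w0 = 0.
  have := congr1 al h; rewrite (rmorph_quad al) /= !cS_al alw alw1 rmorph0 => h'.
  have : (cS b2 + cS b3 * w0) * s t ^+ n = 0.
    have -> : (cS b2 + cS b3 * w0) * s t ^+ n = (cS b0 + cS b1 * w0 + (cS b2 + cS b3 * w0) * (w1 + s t ^+ n)) - (cS b0 + cS b1 * w0 + (cS b2 + cS b3 * w0) * w1) by ring.
    by rewrite h h' subrr.
  by case/ps_mulf_eq0 => // ez; case: (ps_expf_neq0 (n := n) st0).
have h2 (c d : S) : cS c + cS d * w0 = 0 -> cS c = 0 /\ cS d = 0.
  move=> h2; have := congr1 be h2; rewrite !(rmorphD, rmorphM) /= !cS_be bew rmorph0 => h3.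
  have /cn d0 : cS d * t ^+ n = 0.
    have -> : cS d * t ^+ n = (cS c + cS d * (w0 + t ^+ n)) - (cS c + cS d * w0) by ring.
    by rewrite h2 h3 subrr.
  by move: h2; rewrite d0 mul0r addr0.
have [/cS_eq0/pdivS[c2 e2] /cS_eq0/pdivS[c3 e3]] := h2 _ _ h1.
have [|/cS_eq0/pdivS[c0 e0] /cS_eq0/pdivS[c1 e1]] := h2 b0 b1.
  by move: h; rewrite h1 mul0r addr0.
exists (tS c0 + tS c1 * W0 + (tS c2 + tS c3 * W0) * W1); first exact: NN_mk.
by rewrite e0 e1 e2 e3 !rmorphM /=; ring.
Qed.
(* The localization of NN at the prime ideal pS. *)
Definition VV (e : E) : Prop := exists2 f, redS f <> 0 & NN (tS f * e).
Lemma redS_mul_neq0 f h : redS f <> 0 -> redS h <> 0 -> redS (f * h) <> 0.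
Proof. by move=> nf nh; rewrite rmorphM => /ps_mulf_eq0[]. Qed.
Lemma redS1 : redS 1 <> 0.
Proof. by rewrite rmorph1; apply/eqP/oner_neq0. Qed.
Lemma NN_VV e : NN e -> VV e.
Proof. by move=> Ne; exists 1; [exact: redS1 | rewrite rmorph1 mul1r]. Qed.
Lemma VV_subring : subring_prop VV.
Proof.
have sN := NN_subring; split; first by apply: NN_VV; case: sN.
  move=> e e' [f nf Nf] [f' nf' Nf']; exists (f * f'); first exact: redS_mul_neq0.
  have -> : tS (f * f') * (e - e') = tS f' * (tS f * e) - tS f * (tS f' * e').
    by rewrite rmorphM /=; ring.
  by case: (sN) => _ NB _; apply: NB; apply: (KM sN) => //; apply: NN_tS.
move=> e e' [f nf Nf] [f' nf' Nf']; exists (f * f'); first exact: redS_mul_neq0.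
have -> : tS (f * f') * (e * e') = (tS f * e) * (tS f' * e') by rewrite rmorphM /=; ring.
exact: (KM sN).
Qed.
Lemma VV_div f e : redS f <> 0 -> VV (tS f * e) -> VV e.
Proof.
move=> nf [f' nf' Nf']; exists (f' * f); first exact: redS_mul_neq0.
by rewrite rmorphM /= -mulrA.
Qed.
Lemma VV_tS f : VV (tS f). Proof. exact/NN_VV/NN_tS. Qed.
Lemma VV_W0 : VV W0. Proof. exact/NN_VV/NN_W0. Qed.
Lemma VV_W1 : VV W1. Proof. exact/NN_VV/NN_W1. Qed.
Lemma VV_W2 : VV W2.
Proof.
apply: (@VV_div (sg (sg G))); first exact: redG2.
rewrite GW2; have sN := VV_subring; apply: (KD sN); last exact: VV_tS.
case: (sN) => _ NB _; apply: NB.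
  apply: (KD sN); first exact: (KM sN (VV_tS _) VV_W0).
  exact: (KM sN (VV_tS _) VV_W1).
rewrite -(rmorph_nat tS); apply: (KM sN (VV_tS _)).
exact: (KM sN VV_W0 VV_W1).
Qed.
Lemma VV_a e : VV e -> VV (aE e).
Proof. by move=> [f nf /NN_a]; rewrite rmorphM /= aE_tS; exists f. Qed.
Lemma VV_b e : VV e -> VV (bE e).
Proof. by move=> [f nf /NN_b]; rewrite rmorphM /= bE_tS; exists f. Qed.
Lemma VV_s e : VV e -> VV (sE e).
Proof.
move=> [f nf Nf]; apply: (@VV_div (sg f)); first exact: redG_s.
have -> : tS (sg f) * sE e = sE (tS f * e) by rewrite rmorphM /= sE_tS.
have sN := VV_subring; move: Nf => /NN_rep[b0 [b1 [b2 [b3 ->]]]].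
rewrite (rmorph_quad sE) /= !sE_tS sE_W0 sE_W1.
exact: (quad_closed sN (VV_tS _) (VV_tS _) (VV_tS _) (VV_tS _) VV_W1 VV_W2).
Qed.
(** A multiple of [e] lies in [NN], where coordinates determine everything. Consequently the
    reduction is a function of the first component, and identities may be checked there. *)
Lemma VV_fun e : VV e -> p1 e = 0 -> e = 0.
Proof.
move=> [f nf Nf] e1; apply: E_eq => //.
have : tS f * e = 0 by apply: NN_fun Nf _; rewrite p1M e1 mulr0.
by move/(congr1 p2); rewrite p2M tS2 => /ps_mulf_eq0[/cS_eq0|].
Qed.

(** The order [S + S Y0 + S Y1 + S Y2]. It bounds the lift from below ([MM_AA]) and, after
    multiplication by 4, from above ([AA_quarter]). *)
Definition MM (x : LL) : Prop := [/\ intP (kc x), intP (ky0 x), intP (ky1 x) & intP (ky2 x)].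
Lemma MM_subring : subring_prop MM.
Proof.
have sI := intP_subring; have I0 := K0 sI; have I1 : intP 1 by case: sI.
split; first by split.
  by move=> x y [? ? ? ?] [? ? ? ?]; case: sI => _ IB _; split; apply: IB.
have [G0 G1 G2] : [/\ intP g0, intP g1 & intP g2].
  by split; [exists G | exists (sg G) | exists (sg (sg G))].
move=> x y [? ? ? ?] [? ? ? ?]; rewrite klM; split=> /=;
  by do ?[assumption | apply: (KD sI) | apply: (KM sI)].
Qed.
Lemma MM_int y : intP y -> MM (klc g0 g1 g2 y).
Proof. by move=> Iy; have I0 := K0 intP_subring; split. Qed.
Definition kP : LL := klc g0 g1 g2 pK.
Lemma kPX N : kP ^+ N = klc g0 g1 g2 (pK ^+ N). Proof. by rewrite rmorphXn. Qed.
Lemma MM_kPX N : MM (kP ^+ N).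
Proof. by rewrite kPX; apply: MM_int; exists (P ^+ N); rewrite rmorphXn. Qed.
Definition bd (x : LL) : Prop := exists N, MM (kP ^+ N * x).
Lemma bd_subring : subring_prop bd.
Proof.
have sM := MM_subring; split; first by exists 0%N; rewrite mulr1; apply: MM_kPX.
  move=> x y [N Hx] [M Hy]; exists (N + M)%N.
  have -> : kP ^+ (N + M) * (x - y) = kP ^+ M * (kP ^+ N * x) - kP ^+ N * (kP ^+ M * y).
    by rewrite exprD; ring.
  by case: (sM) => _ MB _; apply: MB; apply: (KM sM) => //; apply: MM_kPX.
move=> x y [N Hx] [M Hy]; exists (N + M)%N.
have -> : kP ^+ (N + M) * (x * y) = (kP ^+ N * x) * (kP ^+ M * y) by rewrite exprD; ring.
exact: (KM sM).
Qed.
Lemma MM_bd x : MM x -> bd x. Proof. by exists 0%N; rewrite mul1r. Qed.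
Lemma intP_s y : intP y -> intP (ps_sub (jR z) y).
Proof. by move=> [f ->]; exists (sg f); rewrite j_s. Qed.
Lemma intP_N y : intP y -> intP (- y). Proof. exact: (KN intP_subring). Qed.
Lemma bd_a x : bd x -> bd (kl_a x).
Proof.
move=> [N [h0 h1 h2 h3]]; exists N; move: h0 h1 h2 h3; rewrite kPX !klein_cM => h0 h1 h2 h3.
by split; rewrite /= ?mulrN //; apply: intP_N.
Qed.
Lemma bd_b x : bd x -> bd (kl_b x).
Proof.
move=> [N [h0 h1 h2 h3]]; exists N; move: h0 h1 h2 h3; rewrite kPX !klein_cM => h0 h1 h2 h3.
by split; rewrite /= ?mulrN //; apply: intP_N.
Qed.
Lemma bd_s (x : LL) : bd x -> bd (kl_s (ps_sub (jR z)) x).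
Proof.
move=> [N [h0 h1 h2 h3]]; exists N; move: h0 h1 h2 h3; rewrite kPX !klein_cM => h0 h1 h2 h3.
have sp : ps_sub (jR z) (pK ^+ N) = pK ^+ N.
  by rewrite rmorphXn /= /pK j_s /P ps_sub_C.
by split; rewrite /kl_s /kl /kc /ky0 /ky1 /ky2 /= -{1}sp -rmorphM; apply: intP_s.
Qed.
Lemma bd_cancel N x : bd (kP ^+ N * x) -> bd x.
Proof. by move=> [M]; rewrite mulrA -exprD; exists (M + N)%N. Qed.

(* The lift of k[[z]]: elements integral over S away from p and at p. *)
Definition AA (e : E) : Prop := VV e /\ bd (p1 e).
Lemma AA_subring : subring_prop AA.
Proof.
have [V1 VB VM] := VV_subring; have [b1 bB bM] := bd_subring; split=> //.
  by move=> e f [Ve be'] [Vf bf]; split; [apply: VB | rewrite p1B; apply: bB].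
by move=> e f [Ve be'] [Vf bf]; split; [apply: VM | rewrite p1M; apply: bM].
Qed.
Lemma AA_tS f : AA (tS f).
Proof. by split; [apply: VV_tS | apply/MM_bd/MM_int; exists f]. Qed.
Lemma AA_a e : AA e -> AA (aE e). Proof. by move=> [/VV_a Ve /bd_a be']. Qed.
Lemma AA_b e : AA e -> AA (bE e). Proof. by move=> [/VV_b Ve /bd_b be']. Qed.
Lemma AA_s e : AA e -> AA (sE e). Proof. by move=> [/VV_s Ve /bd_s be']. Qed.
Lemma four_pK : 4%:R = pK ^+ 32.
Proof.
have -> : pK ^+ 32 = j (P ^+ 32) by rewrite rmorphXn.
have -> : P ^+ 32 = 4%:R.
  by rewrite /P -rmorphXn (exprM p 16 2) p16 -natrX rmorph_nat.
by rewrite rmorph_nat.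
Qed.
Lemma hk_pK : pK ^+ 32 * hk = 2%:R.
Proof. by rewrite -four_pK -[RHS]mulr1 -hk2; ring. Qed.
Lemma AA_W0 : AA W0.
Proof.
split; first exact: VV_W0.
exists 32; rewrite kPX /W0 klein_cM.
have Ih : intP (pK ^+ 32 * hk) by rewrite hk_pK; exists 2%:R; rewrite rmorph_nat.
have I0 := K0 intP_subring.
split; rewrite /= ?mulr0 // ?mulrN ?mulrA //; last exact: intP_N.
by apply: (KM intP_subring) => //; exists H0.
Qed.
Lemma AA_W1 : AA W1. Proof. by rewrite -sE_W0; apply/AA_s/AA_W0. Qed.
Lemma AA_fun e : AA e -> p1 e = 0 -> e = 0. Proof. by move=> [/VV_fun]. Qed.
Lemma AA_inj e f : AA e -> AA f -> p1 e = p1 f -> e = f.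
Proof.
move=> Ae Af ef; apply/eqP; rewrite -subr_eq0; apply/eqP/AA_fun.
  by case: AA_subring => _ AB _; apply: AB.
by rewrite p1B ef subrr.
Qed.
Lemma p1_P : p1 (tS P) = kP. Proof. by []. Qed.
Lemma kP_inj (x y : LL) : kP * x = kP * y -> x = y.
Proof.
move=> e; rewrite -[x]mul1r -[y]mul1r.
have -> : 1 = klc g0 g1 g2 pinv * kP by rewrite /kP -rmorphM mulrC pKV rmorph1.
by rewrite -!mulrA e.
Qed.
Lemma AA_P_inj e f : AA e -> AA f -> tS P * e = tS P * f -> e = f.
Proof.
move=> Ae Af ef; apply: AA_inj => //; apply: kP_inj.
by rewrite -p1_P -!p1M ef.
Qed.
Lemma AA_PX_inj N e f : AA e -> AA f -> tS P ^+ N * e = tS P ^+ N * f -> e = f.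
Proof.
move=> Ae Af; elim: N => [|N IH]; first by rewrite !mul1r.
rewrite exprS -!mulrA => /AA_P_inj h; apply/IH/h; apply: (KM AA_subring) => //;
  by rewrite -rmorphXn; apply: AA_tS.
Qed.

Lemma bd_int e x f : bd (p1 e) -> p1 e = klc g0 g1 g2 x -> redS f <> 0 ->
  intP (j f * x) -> intP x.
Proof.
move=> [N [h0 _ _ _]] e1 nf If; apply: (@intP_div f N) => //.
by move: h0; rewrite e1 kPX klein_cM.
Qed.

Lemma AA_P e x : AA e -> p1 e = klc g0 g1 g2 x -> exists f, e = tS f.
Proof.
move=> Ae e1; have [[f nf Nf] be'] := Ae.
have [|m em] := @NN_P (tS f * e) (j f * x) Nf.
  by rewrite p1M e1 tS1 -rmorphM.
have [|y ey] := bd_int be' e1 nf.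
  exists m; have := congr1 p1 em; rewrite p1M e1 !tS1 -rmorphM /klc => /kl_inj[-> _ _ _].
  by [].
exists y; apply: AA_inj => //; first exact: AA_tS.
by rewrite e1 ey.
Qed.

Lemma fix_ab (x : LL) : kl_a x = x -> kl_b x = x -> exists y, x = klc g0 g1 g2 y.
Proof.
have h (y : ps kap) : - y = y -> y = 0.
  move=> e; have : hk * y + hk * y = 0 by rewrite -mulrDr -{1}e addNr mulr0.
  by rewrite -mulrDl -mulr2n -mulr_natl hk2 mul1r.
move=> ea eb; exists (kc x); apply: klein_eq => //=.
- by apply: h; rewrite -{2}eb.
- by apply: h; rewrite -{2}ea.
- by apply: h; rewrite -{2}ea.
Qed.
Lemma AA_fix e : AA e -> aE e = e -> bE e = e -> exists f, e = tS f.
Proof.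
move=> Ae ea eb; have [||x ex] := @fix_ab (p1 e); [by rewrite -{2}ea | by rewrite -{2}eb |].
exact: AA_P Ae ex.
Qed.
Lemma aEK e : aE (aE e) = e.
Proof. by apply: E_eq; rewrite /p1 /p2 /= ?al2 // -[RHS]kl_aK. Qed.
Lemma bEK e : bE (bE e) = e.
Proof. by apply: E_eq; rewrite /p1 /p2 /= ?be2 // -[RHS]kl_bK. Qed.
Lemma abE e : aE (bE e) = bE (aE e).
Proof. by apply: E_eq; rewrite /p1 /p2 /= ?albe. Qed.
Lemma sEa e : sE (aE e) = bE (sE e).
Proof. by apply: E_eq; rewrite /p1 /p2 /= ?sal // kl_sa. Qed.
Lemma sEb e : sE (bE e) = aE (bE (sE e)).
Proof. by apply: E_eq; rewrite /p1 /p2 /= ?sbe // kl_sb. Qed.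
Lemma jz3 : jR z ^+ 3 = 1. Proof. by rewrite -rmorphXn z3 rmorph1. Qed.
Lemma sEK e : sE (sE (sE e)) = e.
Proof.
apply: E_eq; rewrite /p1 /p2 /= ?s3 //; apply: kl_sK => x; exact: ps_sub3 jz3 x.
Qed.

Lemma has_val_al m x : has_val m x -> has_val m (al x).
Proof.
move=> [Hm nm]; split; first exact: alV.
move=> e; have /alV : vge m.+1 (al x) by apply/vgeS; split; [apply: alV | ].
by rewrite al2 => /vgeS[].
Qed.
Lemma has_val_be m x : has_val m x -> has_val m (be x).
Proof.
move=> [Hm nm]; split; first exact: beV.
move=> e; have /beV : vge m.+1 (be x) by apply/vgeS; split; [apply: beV | ].
by rewrite be2 => /vgeS[].
Qed.

Definition norm4 (A : comNzRingType) (f g : A -> A) (e : A) : A := e * f e * (g e * f (g e)).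
Lemma norm4_fix (A : comNzRingType) (f g : {rmorphism A -> A}) e :
  (forall e, f (f e) = e) -> (forall e, g (g e) = e) -> (forall e, f (g e) = g (f e)) ->
  f (norm4 f g e) = norm4 f g e /\ g (norm4 f g e) = norm4 f g e.
Proof. by move=> ff gg fg; rewrite /norm4 !rmorphM !fg !ff !gg; split; ring. Qed.

Lemma norm_p1 e : p1 (norm4 aE bE e) = norm4 (@kl_a _ g0 g1 g2) (@kl_b _ g0 g1 g2) (p1 e).
Proof. by rewrite /norm4 !p1M. Qed.
Lemma norm4_closed (A : comNzRingType) (K : A -> Prop) f g e : subring_prop K ->
  K e -> K (f e) -> K (g e) -> K (f (g e)) -> K (norm4 f g e).
Proof. by move=> sK *; apply: (KM sK); apply: (KM sK). Qed.
Lemma norm_p2 e : p2 (norm4 aE bE e) = norm4 al be (p2 e).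
Proof. by []. Qed.

(** Some [f] prime to [p] gives [f e = P v] with [v] in [NN]; the quotient of [e] by [P] needs a
    reduction, so that of [f] must divide that of [v]. With [x = p1 e / p], the norm over the Klein
    group gives [N(v) = f^4 N(x)], and [N(x)] is integral by [intP_div]. The four conjugates of a
    series have equal valuation, so comparing valuations of the reductions suffices. *)
Lemma AA_sat e : AA e -> p2 e = 0 -> exists2 e', AA e' & e = tS P * e'.
Proof.
move=> [[f nf Nf] be'] e2.
have [|v Nv ev] := NN_div Nf; first by rewrite p2M e2 mulr0.
have [x ex] : exists x : LL, kP * x = p1 e.
  by exists (klc g0 g1 g2 pinv * p1 e); rewrite mulrA /kP -rmorphM pKV rmorph1 mul1r.
have bx : bd x by apply: (@bd_cancel 1); rewrite expr1 ex.
have fx : klc g0 g1 g2 (j f) * x = p1 v.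
  by apply: kP_inj; rewrite mulrCA ex -p1_P -p1M -ev p1M.
have [na nb] := norm4_fix v aEK bEK abE.
have Nn : NN (norm4 aE bE v).
  by apply: (norm4_closed NN_subring); [|exact: NN_a|exact: NN_b|exact/NN_a/NN_b].
have [m em] : exists m, norm4 aE bE v = tS m.
  have [||y ey] := @fix_ab (p1 (norm4 aE bE v)).
  - exact: (congr1 p1 na).
  - exact: (congr1 p1 nb).
  - exact: NN_P Nn ey.
have [y ey] : exists y, norm4 (@kl_a _ g0 g1 g2) (@kl_b _ g0 g1 g2) x = klc g0 g1 g2 y.
  have [xa xb] := norm4_fix x (@kl_aK _ g0 g1 g2) (@kl_bK _ g0 g1 g2) (fun=> erefl).
  exact: fix_ab.
have mE : j m = j (f ^+ 4) * y.
  have h := congr1 p1 em; rewrite norm_p1 -fx tS1 in h.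
  have {}h : klc g0 g1 g2 (j f) ^+ 4 * norm4 (@kl_a _ g0 g1 g2) (@kl_b _ g0 g1 g2) x = klc g0 g1 g2 (j m).
    rewrite -h /norm4 !rmorphM /=.
    have -> : kl_a (klc g0 g1 g2 (j f)) = klc g0 g1 g2 (j f).
      by apply: klein_eq => //=; rewrite /klc /kl /ky1 /ky2 /= oppr0.
    have -> : kl_b (klc g0 g1 g2 (j f)) = klc g0 g1 g2 (j f).
      by apply: klein_eq => //=; rewrite /klc /kl /ky0 /ky2 /= oppr0.
    have -> : kl_a (klc g0 g1 g2 (j f)) = klc g0 g1 g2 (j f).
      by apply: klein_eq => //=; rewrite /klc /kl /ky1 /ky2 /= oppr0.
    by ring.
  by move: h; rewrite ey -rmorphXn -rmorphM /klc => /kl_inj[<- _ _ _]; rewrite rmorphXn.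
have [y0 ey0] : intP y.
  have bn : bd (norm4 (@kl_a _ g0 g1 g2) (@kl_b _ g0 g1 g2) x).
    by apply: (norm4_closed bd_subring); [|exact: bd_a|exact: bd_b|exact/bd_a/bd_b].
  move: bn => [N [h0 _ _ _]]; apply: (@intP_div (f ^+ 4) N).
  - by rewrite rmorphXn; apply: ps_expf_neq0.
  - by move: h0; rewrite ey kPX klein_cM.
  - by exists m.
have mE2 : norm4 al be (p2 v) = cS f ^+ 4 * cS y0.
  rewrite -norm_p2 em tS2 -rmorphXn -rmorphM; congr cS.
  by apply: j_inj; rewrite mE ey0 -rmorphM.
have [a ea] : exists a, p2 v = cS f * a.
  have [->|/has_val_ex[m' Hm]] := EM (p2 v = 0); first by exists 0; rewrite mulr0.
  have cf : cS f <> 0 by move=> /cS_eq0.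
  have [c Hc] := has_val_ex cf.
  apply: (ps_div Hc); suff le : (c <= m')%N by apply: vgeW le Hm.1.
  have Hn : has_val (m' + m' + (m' + m')) (norm4 al be (p2 v)).
    by apply: has_valM; apply: has_valM => //;
      [exact: has_val_al | exact: has_val_be | exact/has_val_al/has_val_be].
  have : vge (c * 4) (norm4 al be (p2 v)).
    by rewrite mE2; apply: vgeMr; case: (has_val_exp 4 Hc).
  by move=> h; have := vge_has_val h Hn; lia.
exists ((x, a) : E); last first.
  by apply: E_eq; rewrite ?p1M ?p2M ?tS2 ?cS_p ?mul0r //; rewrite -ex.
split=> //; exists f => //.
suff -> : tS f * ((x, a) : E) = v by [].
by apply: E_eq; rewrite ?p1M ?p2M.
Qed.

Definition Y0 : E := tS H0 - 2%:R * W0.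
Definition Y1 : E := tS H1 - 2%:R * W1.
Definition Y2 : E := tS H2 - 2%:R * W2.
Lemma AA_2M e f : AA e -> AA f -> AA (e - 2%:R * f).
Proof.
move=> Ae Af; have [_ AB AM] := AA_subring; apply: AB => //; apply: AM => //.
by rewrite -(rmorph_nat tS); apply: AA_tS.
Qed.
Lemma AA_W2 : AA W2. Proof. by rewrite -sE_W1; apply/AA_s/AA_W1. Qed.
Lemma AA_Y0 : AA Y0. Proof. exact: AA_2M (AA_tS _) AA_W0. Qed.
Lemma AA_Y1 : AA Y1. Proof. exact: AA_2M (AA_tS _) AA_W1. Qed.
Lemma AA_Y2 : AA Y2. Proof. exact: AA_2M (AA_tS _) AA_W2. Qed.
Lemma two_klc : 2%:R = klc g0 g1 g2 2%:R :> LL. Proof. by rewrite rmorph_nat. Qed.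
Lemma p1_2 e : p1 (2%:R * e) = klc g0 g1 g2 2%:R * p1 e.
Proof. by rewrite p1M -two_klc. Qed.
Lemma hk2x x : 2%:R * (hk * x) = x. Proof. by rewrite mulrA hk2 mul1r. Qed.
Lemma hk2N : 2%:R * (- hk) = -1. Proof. by rewrite mulrN hk2. Qed.
Lemma Y0_1 : p1 Y0 = kl g0 g1 g2 0 1 0 0.
Proof.
rewrite p1B p1_2 tS1 klein_cM.
by apply: klein_eq; rewrite /klc /kl /kc /ky0 /ky1 /ky2 /= ?hk2x ?hk2N ?mulr0 ?subrr ?sub0r ?opprK.
Qed.
Lemma Y1_1 : p1 Y1 = kl g0 g1 g2 0 0 1 0.
Proof.
rewrite p1B p1_2 tS1 klein_cM.
by apply: klein_eq; rewrite /klc /kl /kc /ky0 /ky1 /ky2 /= ?hk2x ?hk2N ?mulr0 ?subrr ?sub0r ?opprK.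
Qed.
Lemma Y2_1 : p1 Y2 = kl g0 g1 g2 0 0 0 1.
Proof.
rewrite p1B p1_2 tS1 klein_cM.
by apply: klein_eq; rewrite /klc /kl /kc /ky0 /ky1 /ky2 /= ?hk2x ?hk2N ?mulr0 ?subrr ?sub0r ?opprK.
Qed.

Lemma AA_trace e : AA e -> intP (4%:R * kc (p1 e)).
Proof.
move=> Ae; pose tr := e + aE e + (bE e + aE (bE e)).
have At : AA tr.
  have sA := AA_subring.
  exact: (KD sA (KD sA Ae (AA_a Ae)) (KD sA (AA_b Ae) (AA_a (AA_b Ae)))).
have e1 : p1 tr = klc g0 g1 g2 (4%:R * kc (p1 e)).
  apply: klein_eq; rewrite /tr !p1D /aE /bE /kl_a /kl_b /klc /kl /kc /ky0 /ky1 /ky2 /=; ring.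
have [m em] := AA_P At e1; exists m.
by have := congr1 p1 em; rewrite e1 tS1 /klc => /kl_inj[].
Qed.

(** The coordinates of [4 e] are the traces of [e] and of the products [e Y_i], the latter up to
    factors [g_i g_j] that are nonzero modulo [p] and are removed by [intP_div]. *)
Lemma AA_quarter e : AA e -> MM (klc g0 g1 g2 4%:R * p1 e).
Proof.
move=> Ae; have [_ [N [_ h1 h2 h3]]] := Ae; rewrite klein_cM; rewrite kPX klein_cM in h1 h2 h3.
have four : intP 4%:R by exists 4%:R; rewrite rmorph_nat.
have key y F : intP (pK ^+ N * y) -> redS F <> 0 -> intP (4%:R * (y * j F)) -> intP (4%:R * y).
  move=> hy nF hF; apply: (@intP_div F N) => //.
    by rewrite mulrCA; apply: (KM intP_subring).
  by rewrite mulrCA [j F * y]mulrC.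
have n01 : redS (sg G) <> 0 by apply/redG_s/redG0.
have AM := KM AA_subring.
split; first exact: AA_trace.
- apply: (key _ (sg G * sg (sg G))) => //; first by apply: redS_mul_neq0 => //; apply: redG2.
  have := AA_trace (AM _ _ Ae AA_Y0); rewrite p1M Y0_1 klM /klein_mul /kl /kc /ky0 /ky1 /ky2 /=.
  by rewrite !(mulr0, mulr1, mul0r, addr0, add0r) rmorphM.
- apply: (key _ (sg (sg G) * G)) => //; first by apply: redS_mul_neq0; [apply: redG2 | apply: redG0].
  have := AA_trace (AM _ _ Ae AA_Y1); rewrite p1M Y1_1 klM /klein_mul /kl /kc /ky0 /ky1 /ky2 /=.
  by rewrite !(mulr0, mulr1, mul0r, addr0, add0r) rmorphM.
- apply: (key _ (G * sg G)) => //; first by apply: redS_mul_neq0 => //; apply: redG0.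
  have := AA_trace (AM _ _ Ae AA_Y2); rewrite p1M Y2_1 klM /klein_mul /kl /kc /ky0 /ky1 /ky2 /=.
  by rewrite !(mulr0, mulr1, mul0r, addr0, add0r) rmorphM.
Qed.

Lemma MM_AA x : MM x -> exists2 e, AA e & p1 e = x.
Proof.
move=> [[c0 e0] [c1 e1] [c2 e2] [c3 e3]].
exists (tS c0 + tS c1 * Y0 + (tS c2 * Y1 + tS c3 * Y2)).
  have sA := AA_subring; have At := AA_tS.
  exact: (KD sA (KD sA (At c0) (KM sA (At c1) AA_Y0))
    (KD sA (KM sA (At c2) AA_Y1) (KM sA (At c3) AA_Y2))).
rewrite !p1D !p1M Y0_1 Y1_1 Y2_1 !tS1 !klein_cM.
by apply: klein_eq; rewrite /klc /kl /kc /ky0 /ky1 /ky2 /= !(mulr0, mulr1, addr0, add0r).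
Qed.

(** * Completeness and separation of the lift for the [p]-adic topology *)

Lemma limR_ex : exists lim : (nat -> R) -> R,
  forall u, lim u = u 0%N + p * lim (fun i => u i.+1).
Proof.
have [lim Hlim] := choice pcomplete; exists lim => u.
apply/eqP; rewrite -subr_eq0; apply/eqP/psep => N.
have [b eb] := Hlim u N.+1; have [c ec] := Hlim (fun i => u i.+1) N.
exists (p * (b - c)); rewrite eb ec big_ord_recl mul1r mulrDr mulr_sumr.
have -> : \sum_(i < N) p ^+ bump 0 i * u (bump 0 i) = \sum_(i < N) p * (p ^+ i * u i.+1).
  by apply: eq_bigr => i _; rewrite exprS mulrA.
by rewrite exprS; ring.
Qed.

Lemma mulrACA4 (A : comNzRingType) (a b c d : A) : a * (b * (c * d)) = a * c * (b * d).
Proof. by ring. Qed.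

(** A limit operator satisfying a recursion, unlike limits chosen one by one, passes to coefficients
    and then to coordinates. *)
Lemma limS_ex : exists lim : (nat -> S) -> S,
  forall u, lim u = u 0%N + P * lim (fun i => u i.+1).
Proof.
have [lim Hlim] := limR_ex; exists (fun u m => lim (fun i => u i m)) => u.
by apply: funext => m; rewrite psDE psCM {1}Hlim.
Qed.

Lemma p1_PX N e : p1 (tS P ^+ N * e) = kP ^+ N * p1 e.
Proof.
rewrite p1M; congr (_ * _); elim: N => [|N IH]; first by rewrite !expr0.
by rewrite !exprS p1M IH p1_P.
Qed.
Lemma p1_sum N (u : nat -> E) :
  p1 (\sum_(i < N) tS P ^+ i * u i) = \sum_(i < N) kP ^+ i * p1 (u i).
Proof.
elim: N => [|N IH]; first by rewrite !big_ord0.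
by rewrite big_ord_recr [RHS]big_ord_recr p1D p1_PX; congr (_ + _); exact: IH.
Qed.

(** By [AA_quarter] the terms multiplied by 4 have coordinates in [S], where limits exist; what
    remains is to divide the limit by 4 inside the lift. *)
Lemma AA_complete (u : nat -> E) : (forall i, AA (u i)) ->
  exists2 e, AA e & forall N, exists2 r, AA r &
    e = \sum_(i < N) tS P ^+ i * u i + tS P ^+ N * r.
Proof.
have [lim Hlim] := limS_ex.
have [|c Hc] := @choice E (S * S * S * S)%type (fun e c => AA e ->
    klc g0 g1 g2 4%:R * p1 e = kl g0 g1 g2 (j c.1.1.1) (j c.1.1.2) (j c.1.2) (j c.2)).
  move=> e; have [/AA_quarter[[c0 e0] [c1 e1] [c2 e2] [c3 e3]]|] := EM (AA e); last first.
    by exists (0, 0, 0, 0).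
  by exists (c0, c1, c2, c3) => _; apply: klein_eq.
pose L4 (u : nat -> E) : LL := kl g0 g1 g2 (j (lim (fun i => (c (u i)).1.1.1)))
  (j (lim (fun i => (c (u i)).1.1.2))) (j (lim (fun i => (c (u i)).1.2))) (j (lim (fun i => (c (u i)).2))).
have L4S v : AA (v 0%N) -> L4 v = klc g0 g1 g2 4%:R * p1 (v 0%N) + kP * L4 (fun i => v i.+1).
  move=> /Hc ->; rewrite /L4 /kP klein_cM /pK.
  by apply: klein_eq; rewrite /kl /kc /ky0 /ky1 /ky2 /= Hlim rmorphD rmorphM.
pose q4 := klc g0 g1 g2 (hk * hk).
have q44 x : q4 * (klc g0 g1 g2 4%:R * x) = x.
  rewrite mulrA /q4 -rmorphM (_ : hk * hk * 4%:R = (2%:R * hk) ^+ 2); last by ring.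
  by rewrite hk2 expr1n rmorph1 mul1r.
have LS v N : (forall i, AA (v i)) ->
    q4 * L4 v = \sum_(i < N) kP ^+ i * p1 (v i) + kP ^+ N * (q4 * L4 (fun i => v (i + N)%N)).
  move=> Av; elim: N => [|N IH].
    by rewrite big_ord0 add0r mul1r; congr (q4 * L4 _); apply: funext => i; rewrite addn0.
  rewrite IH big_ord_recr /= -addrA; congr (_ + _).
  rewrite (L4S (fun i => v (i + N)%N)) // mulrDr q44 add0n exprSr mulrDr.
  congr (_ + _); have -> : (fun i => v (i.+1 + N)%N) = (fun i => v (i + N.+1)%N).
    by apply: funext => i; rewrite addSnnS.
  exact: mulrACA4.
have H4 v : (forall i, AA (v i)) -> exists2 e, AA e & p1 e = q4 * L4 v.
  (* Only the tail from index 32 on is a genuine limit. Its factor [P^32 = 4] compensates the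
     division by 4, so it has coordinates in [S] and [MM_AA] applies. *)
  move=> Av; have [e Ae e1] : exists2 e, AA e & p1 e = L4 (fun i => v (i + 32)%N).
    by apply: MM_AA; split; eexists.
  exists (\sum_(i < 32) tS P ^+ i * v i + e).
    apply: (KD AA_subring) => //; apply: (K_sum AA_subring) => i _.
    by apply: (KM AA_subring) => //; rewrite -rmorphXn; apply: AA_tS.
  by rewrite p1D e1 (LS v 32) // kPX -four_pK mulrCA q44 p1_sum.
move=> Au; have [e Ae e1] := H4 u Au; exists e => // N.
have [r Ar r1] := H4 (fun i => u (i + N)%N) (fun i => Au _); exists r => //.
apply: AA_inj => //.
  apply: (KD AA_subring); last first.
    by apply: (KM AA_subring) => //; rewrite -rmorphXn; apply: AA_tS.
  apply: (K_sum AA_subring) => i _.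
  by apply: (KM AA_subring) => //; rewrite -rmorphXn; apply: AA_tS.
by rewrite p1D e1 (LS u N) // p1_PX r1 p1_sum.
Qed.

Lemma AA_sep e : AA e -> (forall N, exists2 r, AA r & e = tS P ^+ N * r) -> e = 0.
Proof.
move=> Ae He; apply: AA_fun => //.
have four x : klc g0 g1 g2 4%:R * x = 0 -> x = 0.
  move=> h; have : klc g0 g1 g2 (hk * hk) * (klc g0 g1 g2 4%:R * x) = 0 by rewrite h mulr0.
  rewrite mulrA -rmorphM (_ : hk * hk * 4%:R = (2%:R * hk) ^+ 2); last by ring.
  by rewrite hk2 expr1n rmorph1 mul1r.
apply: four.
have sepS f : (forall N, exists y, j f = pK ^+ N * j y) -> f = 0.
  move=> h; apply: funext => m; apply: psep => N; have [y ey] := h N.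
  exists (y m); have -> : f = P ^+ N * y by apply: j_inj; rewrite ey rmorphM rmorphXn.
  by rewrite -rmorphXn psCM.
have co (c : LL -> ps kap) : (forall x y, c (klc g0 g1 g2 x * y) = x * c y) ->
    (forall e, AA e -> intP (c (klc g0 g1 g2 4%:R * p1 e))) -> c (klc g0 g1 g2 4%:R * p1 e) = 0.
  move=> cM cI; have [f ef] := cI _ Ae; rewrite ef (sepS f) ?rmorph0 // => N.
  have [r Ar er] := He N; have [y ey] := cI _ Ar; exists y.
  by rewrite -ey -ef {1}er p1_PX kPX mulrCA [LHS]cM.
have [h0 h1 h2 h3] : [/\ forall e, AA e -> intP (kc (klc g0 g1 g2 4%:R * p1 e)),
   forall e, AA e -> intP (ky0 (klc g0 g1 g2 4%:R * p1 e)),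
   forall e, AA e -> intP (ky1 (klc g0 g1 g2 4%:R * p1 e)) &
   forall e, AA e -> intP (ky2 (klc g0 g1 g2 4%:R * p1 e))].
  by split=> e' /AA_quarter[].
by apply: klein_eq; apply: co => // x y; rewrite klein_cM.
Qed.

Lemma AA_PX N e : AA e -> AA (tS P ^+ N * e).
Proof. by move=> Ae; apply: (KM AA_subring) => //; rewrite -rmorphXn; apply: AA_tS. Qed.
Lemma AA_B e f : AA e -> AA f -> AA (e - f).
Proof. by case: AA_subring => _ AB _; apply: AB. Qed.
Lemma AA_M e f : AA e -> AA f -> AA (e * f). Proof. exact: (KM AA_subring). Qed.

(* F = H^2 + 4 Phi is separable, because Phi has a simple zero modulo p. *)
Lemma coprime_G : exists a b : S, a * sg G + b * sg (sg G) = 16%:R.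
Proof.
pose F := sg G * sg (sg G).
have unitS (f : S) : red (f 0%N) <> 0 -> exists g, f * g = 1.
  by move=> /runit uf; apply: (@ps_unit _ _ (f 0%N)^-1); rewrite divrr.
have rPhi i : red (Phi i) = q i by rewrite -redPhi.
have [u eu] : exists u, ps_deriv Phi * u = 1.
  apply: unitS; rewrite /ps_deriv mulr1n rPhi; exact: vq.2.
have [v ev] : exists v, (1 + Phi * ps_deriv H ^+ 2 * u ^+ 2) * v = 1.
  apply: unitS; rewrite psDE ps1E ps_M0E ps_M0E.
  have r0 : red (Phi 0%N) = 0 by rewrite rPhi vq.1.
  by rewrite rmorphD !rmorphM /= r0 !mul0r addr0 rmorph1; apply/eqP/oner_neq0.
have dF : ps_deriv F = 2%:R * H * ps_deriv H + 4%:R * ps_deriv Phi.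
  rewrite /F eqF ps_derivD expr2 !ps_derivM.
  have -> : ps_deriv (4%:R : S) = 0.
    have nat m : ps_deriv (m%:R : S) = 0.
      elim: m => [|m IH]; first by apply: funext => i; rewrite /ps_deriv mul0rn.
      rewrite mulrSr ps_derivD IH add0r; apply: funext => i.
      by rewrite /ps_deriv ps1E mul0rn.
    exact: nat.
  by ring.
have dF2 : ps_deriv F = ps_deriv (sg G) * sg (sg G) + sg G * ps_deriv (sg (sg G)).
  by rewrite /F ps_derivM.
pose H' := ps_deriv H; pose Q' := ps_deriv Phi; pose w := u * v.
have e4 : 4%:R = w * ps_deriv F - 2%:R * u * w * H' * (H * Q' - 2%:R * Phi * H').
  have eH : H = u * (H * Q' - 2%:R * Phi * H') + 2%:R * u * Phi * H'.
    have -> : u * (H * Q' - 2%:R * Phi * H') + 2%:R * u * Phi * H' = (Q' * u) * H by ring.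
    by rewrite /Q' eu mul1r.
  move: eH; set E0 := H * Q' - _ => eH.
  rewrite dF -/H' -/Q' {1}eH.
  have -> : w * (2%:R * (u * E0 + 2%:R * u * Phi * H') * H' + 4%:R * Q') -
     2%:R * u * w * H' * E0 = 4%:R * (v * (Q' * u + u ^+ 2 * Phi * H' ^+ 2)) by rewrite /w; ring.
  rewrite {1}/Q' eu (_ : v * _ = (1 + Phi * H' ^+ 2 * u ^+ 2) * v); last by ring.
  by rewrite ev mulr1.
have e16 : 16%:R = (4%:R * w - 2%:R * u * w * H' * H) * ps_deriv F +
     4%:R * u * w * H' ^+ 2 * F.
  have e0 : 4%:R * (H * Q' - 2%:R * Phi * H') = H * ps_deriv F - 2%:R * H' * F.
    by rewrite dF /F eqF -/H' -/Q'; ring.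
  have -> : 16%:R = 4%:R * 4%:R :> S by ring.
  rewrite {2}e4; move: e0; move: (H * Q' - _) => E0 e0.
  have -> : 4%:R * (w * ps_deriv F - 2%:R * u * w * H' * E0) =
    4%:R * w * ps_deriv F - 2%:R * u * w * H' * (4%:R * E0) by ring.
  by rewrite e0; ring.
exists ((4%:R * w - 2%:R * u * w * H' * H) * ps_deriv (sg (sg G)) + 4%:R * u * w * H' ^+ 2 * sg (sg G)),
  ((4%:R * w - 2%:R * u * w * H' * H) * ps_deriv (sg G)).
by rewrite e16 dF2 /F; ring.
Qed.
(** The series fixed by [al] are combinations of [1] and [w0] over [k[[t]]], and [W0] is fixed by
    [aE]. *)
Lemma fix_lift x : al x = x -> exists b, [/\ AA b, aE b = b & p2 b = x].
Proof.
move=> /fixal[a [c ->]]; have [f ef] := redS_surj a; have [h eh] := redS_surj c.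
exists (tS f + tS h * W0); split.
- apply: (KD AA_subring (AA_tS f)); exact: AA_M (AA_tS h) AA_W0.
- by rewrite rmorphD rmorphM /= !aE_tS aE_W0.
- by rewrite p2D p2M !tS2 /cS ef eh.
Qed.

Lemma p2_aE e : p2 (aE e) = al (p2 e). Proof. by []. Qed.
Lemma p1_aE e : p1 (aE e) = kl_a (p1 e). Proof. by []. Qed.
Lemma p2N e : p2 (- e) = - p2 e. Proof. by []. Qed.
Lemma p1N e : p1 (- e) = - p1 e. Proof. by []. Qed.
Lemma anti_fix e : aE e = - e -> al (p2 e) = p2 e.
Proof. by move=> h; rewrite -p2_aE h p2N oppx. Qed.
Lemma aE_P e : aE (tS P * e) = tS P * aE e.
Proof. by rewrite rmorphM /= aE_tS. Qed.
Lemma aE_PX N e : aE (tS P ^+ N * e) = tS P ^+ N * aE e.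
Proof. by rewrite rmorphM rmorphXn /= aE_tS. Qed.
Lemma tSP2 e : p2 (tS P * e) = 0. Proof. by rewrite p2M tS2 cS_p mul0r. Qed.

(** * Elements negated by the involution, and the uniformizer *)

Definition anti (e : E) : Prop := AA e /\ aE e = - e.

Section Generator.
Variables (x0 : E) (v0 : nat).
Hypotheses (Ax0 : anti x0) (vx0 : has_val v0 (p2 x0))
  (minx0 : forall y v, anti y -> has_val v (p2 y) -> (v0 <= v)%N).

(** Minimality of [v0] makes the reduction of [x0] divide that of [y]. Signs vanish in
    characteristic 2, so the quotient is fixed by [al] and lifts to a fixed [b]; then [y - b x0] has
    zero reduction. *)
Lemma anti_step y : anti y -> exists b y', [/\ AA b, anti y' & y = b * x0 + tS P * y'].
Proof.
move=> Ay; have [c ec] : exists c, p2 y = p2 x0 * c.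
  apply: (ps_div vx0); have [->|/has_val_ex[v Hv]] := EM (p2 y = 0); first exact: vge_zero.
  by apply: vgeW Hv.1; apply: minx0 Hv.
have alc : al c = c.
  apply: (ps_mulfI (has_val_neq0 vx0)); rewrite -[RHS]ec -(anti_fix Ay.2) ec rmorphM.
  by rewrite (anti_fix Ax0.2).
have [b [Ab ab bc]] := fix_lift alc.
have Ad : AA (y - b * x0) by apply: AA_B Ay.1 (AA_M Ab Ax0.1).
have [|y' Ay' ey'] := AA_sat Ad; first by rewrite p2B p2M bc ec mulrC subrr.
exists b, y'; split=> //; last by rewrite -ey' addrC subrK.
split=> //; apply: AA_P_inj; [exact: AA_a | exact: (KN AA_subring) |].
by rewrite -aE_P mulrN -ey' rmorphB rmorphM /= Ay.2 Ax0.2 ab; ring.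
Qed.

(** The coefficients [b] of the successive steps sum to one element because the lift is complete. *)
Lemma anti_gen y : anti y -> exists2 b, AA b & y = b * x0.
Proof.
move=> Ay; have [|f Hf] := @choice E (E * E)%type (fun y c => anti y ->
    [/\ AA c.1, anti c.2 & y = c.1 * x0 + tS P * c.2]).
  move=> e; have [/anti_step[b [y' H']]|] := EM (anti e); last by exists (0, 0).
  by exists (b, y').
pose u N := iter N (fun e => (f e).2) y.
have Au N : anti (u N) by elim: N => //= N IH; have [] := Hf _ IH.
have [e Ae He] : exists2 e, AA e & forall N, exists2 r, AA r &
    e = \sum_(i < N) tS P ^+ i * (f (u i)).1 + tS P ^+ N * r.
  by apply: (@AA_complete (fun i => (f (u i)).1)) => i; have [] := Hf _ (Au i).
exists e => //; apply/eqP; rewrite -subr_eq0; apply/eqP/AA_sep.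
  exact: AA_B Ay.1 (AA_M Ae Ax0.1).
move=> N; have [r Ar er] := He N; exists (u N - r * x0).
  exact: AA_B (Au N).1 (AA_M Ar Ax0.1).
have -> : y = (\sum_(i < N) tS P ^+ i * (f (u i)).1) * x0 + tS P ^+ N * u N.
  elim: N {r Ar er} => [|N IH]; first by rewrite big_ord0 mul0r add0r mul1r.
  rewrite big_ord_recr /= {1}IH mulrDl -addrA; congr (_ + _).
  by have [_ _ {1}->] := Hf _ (Au N); rewrite exprS; ring.
by rewrite er; ring.
Qed.
End Generator.

Lemma anti_Y1 : anti Y1.
Proof.
split; first exact: AA_Y1.
apply: AA_inj; [exact/AA_a/AA_Y1 | exact: (KN AA_subring AA_Y1) |].
rewrite p1_aE p1N Y1_1.
by apply: klein_eq; rewrite /kl_a /kl /kc /ky0 /ky1 /ky2 /= ?oppr0.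
Qed.
Lemma anti_Y2 : anti Y2.
Proof.
split; first exact: AA_Y2.
apply: AA_inj; [exact/AA_a/AA_Y2 | exact: (KN AA_subring AA_Y2) |].
rewrite p1_aE p1N Y2_1.
by apply: klein_eq; rewrite /kl_a /kl /kc /ky0 /ky1 /ky2 /= ?oppr0.
Qed.
Lemma Y1_sqr : Y1 * Y1 = tS (sg (sg G) * G).
Proof.
apply: AA_inj; [exact: AA_M AA_Y1 AA_Y1 | exact: AA_tS |].
rewrite p1M Y1_1 tS1 klM.
by apply: klein_eq; rewrite /klein_mul /klc /kl /kc /ky0 /ky1 /ky2 /= ?rmorphM /=; ring.
Qed.
Lemma Y2_sqr : Y2 * Y2 = tS (G * sg G).
Proof.
apply: AA_inj; [exact: AA_M AA_Y2 AA_Y2 | exact: AA_tS |].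
rewrite p1M Y2_1 tS1 klM.
by apply: klein_eq; rewrite /klein_mul /klc /kl /kc /ky0 /ky1 /ky2 /= ?rmorphM /=; ring.
Qed.

Lemma AA_div_sqr x N f c : AA x -> AA f -> AA c -> p2 x <> 0 ->
  tS P ^+ N * f = c * (x * x) -> exists2 c', AA c' & f = c' * (x * x).
Proof.
move=> Ax Af; elim: N c => [|N IH] c Ac nx; first by rewrite mul1r; exists c.
rewrite exprS -mulrA => h; have : p2 c * (p2 x * p2 x) = 0.
  by rewrite -!p2M -h tSP2.
case/ps_mulf_eq0 => [/(AA_sat Ac)[c1 Ac1 ec1]|/ps_mulf_eq0[]//].
apply: (IH c1) => //; apply: AA_P_inj; [exact: AA_PX | exact: AA_M (AA_M Ax Ax) |].
by rewrite h ec1 -mulrA.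
Qed.

Lemma anti_ex : exists x0 v0, [/\ anti x0, has_val v0 (p2 x0), (v0 <= 2 * n)%N &
  forall y, anti y -> exists2 b, AA b & y = b * x0].
Proof.
have ex : exists v, `[< exists2 x, anti x & has_val v (p2 x) >].
  have [|v Hv] := @has_val_ex _ (p2 Y1).
    rewrite /Y1 p2B p2M tS2 cS_H1 (_ : p2 2%:R = 0) ?mul0r ?subr0; last exact: two_psk.
    by apply: ps_expf_neq0 => e; apply: t_neq0; rewrite -[t]s3 e !rmorph0.
  by exists v; apply/asboolP; exists Y1 => //; apply: anti_Y1.
case: (ex_minnP ex) => v0 /asboolP[x0 Ax0 vx0] minv.
have gen := anti_gen Ax0 vx0 (fun y v Ay Hv => minv v (asboolT (ex_intro2 _ _ y Ay Hv))).
exists x0, v0; split=> //.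
have [b1 Ab1 e1] := gen _ anti_Y1; have [b2 Ab2 e2] := gen _ anti_Y2.
have [a [b eab]] := coprime_G.
have sA := AA_subring.
(* [Y2^2 = G (s G)] and [Y1^2 = G (s^2 G)], so the relation of [coprime_G] gives
   [a Y2^2 + b Y1^2 = 16 G] with [16 = P^64]. Both squares are multiples of [x0^2], whose reduction
   is nonzero. *)
have [c Ac ec] : exists2 c, AA c & tS G = c * (x0 * x0).
  apply: (@AA_div_sqr x0 64 _ (tS a * (b2 * b2) + tS b * (b1 * b1))) => //.
  - exact: Ax0.1.
  - exact: AA_tS.
  - exact: (KD sA (AA_M (AA_tS a) (AA_M Ab2 Ab2)) (AA_M (AA_tS b) (AA_M Ab1 Ab1))).
  - exact: has_val_neq0 vx0.
  have -> : (tS a * (b2 * b2) + tS b * (b1 * b1)) * (x0 * x0) =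
     tS a * (b2 * x0 * (b2 * x0)) + tS b * (b1 * x0 * (b1 * x0)) by ring.
  rewrite -e1 -e2 Y1_sqr Y2_sqr -(rmorphXn tS) -!(rmorphM tS) -(rmorphD tS); congr tS.
  have -> : P ^+ 64 = 16%:R.
    by rewrite /P -rmorphXn (exprM p 16 4) p16 -natrX rmorph_nat.
  by rewrite -eab; ring.
have h1 : has_val (4 * n) (p2 (tS G)) by rewrite tS2 cS_G0; apply: has_val_exp.
have h2 : vge (v0 + v0) (p2 (tS G)).
  by rewrite ec !p2M; apply: vgeMl; apply: vgeM; apply: vx0.1.
by have := vge_has_val h2 h1; lia.
Qed.

Lemma AA_two e : 2%:R * e = tS P ^+ 16 * e.
Proof.
by congr (_ * _); rewrite -(rmorph_nat tS) -(rmorphXn tS) /P -(rmorphXn (@ps_C R)) p16 (rmorph_nat (@ps_C R)).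
Qed.

(** It suffices to write [2 Z = q0 + x0] with [q0] fixed, for then [Z - a Z = x0]. As [2 = P^16],
    the divisibility of [q0 + x0] by [P] is improved in 16 steps, changing [q0] each time. *)
Lemma uniformizer_ex : exists2 Z, AA Z & has_val 1 (p2 Z) /\
  (exists x0 v0, [/\ anti x0, has_val v0 (p2 x0), (v0 <= 2 * n)%N & aE Z = Z - x0]).
Proof.
have [x0 [v0 [Ax vx0 v0n _]]] := anti_ex; have [Ax0 ax0] := Ax.
have sA := AA_subring.
have key c : (c <= 16)%N -> exists q0 Z0, [/\ AA q0, AA Z0, aE q0 = q0 & q0 + x0 = tS P ^+ c * Z0].
  elim: c => [|c IH] lec; first by exists 0, x0; rewrite rmorph0 add0r mul1r; split=> //; exact: (K0 sA).
  have [|q0 [Z0 [Aq AZ aq e]]] := IH; first by lia.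
  have alZ : al (p2 Z0) = p2 Z0.
    (* Adding its conjugate to [P^c Z0 = q0 + x0] gives [2 q0]. For [c < 16] this leaves a factor
       [P], so the reduction of [Z0] is fixed and can be lifted and subtracted. *)
    have h : tS P ^+ (16 - c) * q0 = Z0 + aE Z0.
      apply: (@AA_PX_inj c); [exact: AA_PX | exact: (KD sA AZ (AA_a AZ)) |].
      rewrite mulrA -exprD subnKC; last by lia.
      rewrite -AA_two mulrDr -e -aE_PX -e rmorphD /= aq ax0.
      by ring.
    have /(congr1 p2) := h; rewrite p2D p2_aE.
    have -> : (16 - c = (15 - c).+1)%N by lia.
    by rewrite exprS -mulrA tSP2 => /esym /addx_eq0.
  have [b [Ab ab bZ]] := fix_lift alZ.
  have [|Z1 AZ1 eZ1] := AA_sat (AA_B AZ Ab); first by rewrite p2B bZ subrr.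
  exists (q0 - tS P ^+ c * b), Z1; split=> //.
  - by apply: AA_B Aq (AA_PX c Ab).
  - by rewrite rmorphB /= aE_PX aq ab.
  - by rewrite exprSr -mulrA -eZ1 mulrBr -e; ring.
have [q0 [Z0 [Aq AZ0 aq eZ]]] := key 16 (leqnn 16).
have aZ0 : aE Z0 = Z0 - x0.
  apply: (@AA_PX_inj 16); [exact: AA_a | exact: AA_B |].
  by rewrite -aE_PX -eZ mulrBr -eZ -AA_two rmorphD /= aq ax0; ring.
pose c := ps_C (te (p2 Z0 0%N)) : S.
exists (Z0 - tS c); first exact: AA_B AZ0 (AA_tS c).
have aZ : aE (Z0 - tS c) = Z0 - tS c - x0 by rewrite rmorphB /= aZ0 aE_tS; ring.
split; last by exists x0, v0.
have vz : vge 1 (p2 (Z0 - tS c)).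
  by rewrite p2B tS2 cS_C rte; apply: vge1_C.
split=> // z1.
(* A valuation of at least 2 would force, by [jump], one of at least [2n + 1] for the reduction of
   [x0], against [v0 <= 2n]. *)
have h : vge 2 (p2 (Z0 - tS c)) by apply/vgeS.
have := jump h; rewrite -p2_aE aZ p2B oppx addrAC addxx add0r => hj.
by have := vge_has_val hj vx0; lia.
Qed.

(** * The lift is a power series ring in [Z] *)

Section Taylor.
Variables (Z x0 : E) (v0 : nat).
Hypotheses (AZ : AA Z) (vZ : has_val 1 (p2 Z)) (Ax0 : anti x0) (vx0 : has_val v0 (p2 x0))
  (v0n : (v0 <= 2 * n)%N) (aZ : aE Z = Z - x0).

(** For [f] without constant term, [jump] and [v0 <= 2n] make [al f + f] divisible by the reduction
    of [x0], which is [Z - a Z] modulo [p]. Hence [f = a + b Z] modulo [p] with [a], [b] fixed by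
    [al], and [fix_lift] applies to both. *)
Lemma p2_surj f : exists2 e, AA e & p2 e = f.
Proof.
pose f' := f - ps_C (f 0%N); have f1 : vge 1 f' := vge1_C f.
have [b eb] : exists b, al f' + f' = p2 x0 * b.
  apply: (ps_div vx0); apply: vgeW (jump f1); lia.
have alb : al b = b.
  apply: (ps_mulfI (has_val_neq0 vx0)).
  by rewrite -{1}(anti_fix Ax0.2) -rmorphM -eb rmorphD al2 addrC.
have ala : al (f' - b * p2 Z) = f' - b * p2 Z.
  rewrite rmorphB rmorphM alb -p2_aE aZ p2B mulrBr [b * p2 x0]mulrC -eb /=.
  have -> : al f' - (b * p2 Z - (al f' + f')) = f' - b * p2 Z + (al f' + al f') by ring.
  by rewrite addxx addr0.
have [a1 [Aa _ ea1]] := fix_lift ala; have [b1 [Ab _ eb1]] := fix_lift alb.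
exists (tS (ps_C (te (f 0%N))) + (a1 + b1 * Z)).
  exact: (KD AA_subring (AA_tS _) (KD AA_subring Aa (AA_M Ab AZ))).
by rewrite !p2D p2M ea1 eb1 tS2 cS_C rte subrK /f' addrC subrK.
Qed.

Definition iE (c : R) : E := tS (ps_C c).
Lemma iE_additive : zmod_morphism iE. Proof. by move=> c d; rewrite /iE !rmorphB. Qed.
Lemma iE_monoid : monoid_morphism iE.
Proof. by split=> [|c d]; rewrite /iE ?rmorphM ?rmorph1. Qed.
HB.instance Definition _ := GRing.isZmodMorphism.Build R E iE iE_additive.
HB.instance Definition _ := GRing.isMonoidMorphism.Build R E iE iE_monoid.
Lemma p2_iE c : p2 (iE c) = ps_C (red c). Proof. by rewrite tS2 cS_C. Qed.
Lemma AA_iE c : AA (iE c). Proof. exact: AA_tS. Qed.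
Lemma iE_p : iE p = tS P. Proof. by []. Qed.

Lemma taylor_step0 e : AA e -> exists c e1 e', [/\ AA e1, AA e' & e = iE c + Z * e1 + tS P * e'].
Proof.
move=> Ae; pose c := te (p2 e 0%N).
have [a ea] := ps_div vZ (vge1_C (p2 e)); have [e1 Ae1 ee1] := p2_surj a.
have Ad : AA (e - iE c - Z * e1) by apply: AA_B (AA_B Ae (AA_iE c)) (AA_M AZ Ae1).
have [|e' Ae' h] := AA_sat Ad.
  by rewrite !p2B p2M ee1 -ea p2_iE rte subrr.
by exists c, e1, e'; split=> //; rewrite -h; ring.
Qed.

(** [taylor_step0] holds up to a multiple of [P]; iterating it, the constants converge in [R] and
    the cofactors of [Z] in the lift. *)
Lemma taylor_step e : AA e -> exists c, exists2 e1, AA e1 & e = iE c + Z * e1.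
Proof.
move=> Ae; have [|f Hf] := @choice E (R * E * E)%type (fun e c => AA e ->
    [/\ AA c.1.2, AA c.2 & e = iE c.1.1 + Z * c.1.2 + tS P * c.2]).
  move=> x; have [/taylor_step0[c [e1 [e' h]]]|] := EM (AA x); last by exists (0, 0, 0).
  by exists (c, e1, e').
pose u N := iter N (fun e => (f e).2) e.
have Au N : AA (u N) by elim: N => //= N IH; have [] := Hf _ IH.
have [e1 Ae1 He1] : exists2 e1, AA e1 & forall N, exists2 r, AA r &
    e1 = \sum_(i < N) tS P ^+ i * (f (u i)).1.2 + tS P ^+ N * r.
  by apply: (@AA_complete (fun i => (f (u i)).1.2)) => i; have [] := Hf _ (Au i).
have [c Hc] := pcomplete (fun i => (f (u i)).1.1).
exists c, e1 => //; apply/eqP; rewrite -subr_eq0; apply/eqP/AA_sep.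
  exact: AA_B Ae (KD AA_subring (AA_iE c) (AA_M AZ Ae1)).
move=> N; have [r Ar er] := He1 N; have [b eb] := Hc N.
exists (u N - iE b - Z * r); first exact: AA_B (AA_B (Au N) (AA_iE b)) (AA_M AZ Ar).
have eu : e = \sum_(i < N) tS P ^+ i * iE (f (u i)).1.1 +
    Z * (\sum_(i < N) tS P ^+ i * (f (u i)).1.2) + tS P ^+ N * u N.
  elim: N {r Ar er b eb} => [|N IH]; first by rewrite !big_ord0 mulr0 !add0r mul1r.
  rewrite !big_ord_recr /= {1}IH; have [_ _ {1}->] := Hf _ (Au N); rewrite exprS.
  by move: (\sum_(i < N) _) (\sum_(i < N) _) => s1 s2; ring.
have ec : iE c = \sum_(i < N) tS P ^+ i * iE (f (u i)).1.1 + tS P ^+ N * iE b.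
  rewrite eb rmorphD rmorphM rmorphXn rmorph_sum /= iE_p; congr (_ + _).
  by apply: eq_bigr => i _; rewrite rmorphM rmorphXn.
by rewrite ec er {1}eu; move: (\sum_(i < N) _) (\sum_(i < N) _) => s1 s2; ring.
Qed.

(** The reduction of [Z] is not a zero divisor, so relations involving [Z] can be divided by [P]
    indefinitely until separation applies. Regularity of [Z] and separation by powers of [Z] both
    come from this. *)
Lemma ZX_div N e : AA e -> p2 (Z ^+ N * e) = 0 -> exists2 e', AA e' & e = tS P * e'.
Proof.
move=> Ae; rewrite p2M (rmorphXn p2) => /ps_mulf_eq0[h|]; last exact: AA_sat.
by case: (ps_expf_neq0 (n := N) (has_val_neq0 vZ)).
Qed.
Lemma AA_ZX N e : AA e -> AA (Z ^+ N * e).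
Proof. by move=> Ae; apply: AA_M => //; apply: (KX AA_subring). Qed.

Lemma Z_reg x y : AA x -> AA y -> Z * x = Z * y -> x = y.
Proof.
move=> Ax Ay e; apply/eqP; rewrite -subr_eq0; apply/eqP/AA_sep; first exact: AA_B.
move=> N; suff [r Ar [er Zr]] : exists2 r, AA r & x - y = tS P ^+ N * r /\ Z * r = 0 by exists r.
elim: N => [|N [r Ar [er Zr]]].
  by exists (x - y); [exact: AA_B | rewrite mul1r mulrBr e subrr].
have [|r' Ar' er'] := @ZX_div 1 r Ar; first by rewrite expr1 Zr.
exists r' => //; split; first by rewrite er er' mulrA exprSr.
apply: AA_P_inj; [exact: AA_M | exact: (K0 AA_subring) |].
by rewrite mulr0 mulrCA -er' Zr.
Qed.

Lemma iE_Z c y : AA y -> iE c = Z * y -> c = 0.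
Proof.
move=> Ay e; apply: psep => N.
suff [b [r [Ar eb er]]] : exists b r, [/\ AA r, c = p ^+ N * b & iE b = Z * r] by exists b.
elim: N => [|N [b [r [Ar eb er]]]]; first by exists c, y; rewrite mul1r.
have h := congr1 p2 er; rewrite p2_iE p2M in h.
have rb : red b = 0.
  have := congr1 (fun x : ps k => x 0%N) h; rewrite ps_M0E vZ.1 // mul0r.
  by [].
have [b' eb'] := pdiv rb.
have [|r' Ar' er'] := @ZX_div 1 r Ar; first by rewrite expr1 p2M -h rb rmorph0.
exists b', r'; split=> //; first by rewrite eb eb' mulrA exprSr.
apply: AA_P_inj; [exact: AA_iE | exact: AA_M |].
by rewrite mulrCA -er' -er eb' rmorphM /= iE_p.
Qed.

Lemma Z_sep u : (forall N, exists2 r, AA r & u = Z ^+ N * r) -> u = 0.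
Proof.
have step w : (forall N, exists2 r, AA r & w = Z ^+ N * r) ->
    exists2 w', (forall N, exists2 r, AA r & w' = Z ^+ N * r) & w = tS P * w'.
  move=> Hw; have [w' Aw' ew] : exists2 w', AA w' & w = tS P * w'.
    have [r Ar er] := Hw 0%N; apply: (@ZX_div 0); first by rewrite er mul1r.
    rewrite mul1r; apply: vge_all => N; have [r' _ ->] := Hw N.
    rewrite p2M (rmorphXn p2) /=; apply: vgeMr.
    by have := has_val_exp N vZ; rewrite mul1n => -[].
  exists w' => // N; have [r Ar er] := Hw N.
  have [|r' Ar' er'] := @ZX_div N r Ar; first by rewrite -er ew tSP2.
  exists r' => //; apply: AA_P_inj => //; first exact: AA_ZX.
  by rewrite -ew er er' mulrCA.
move=> Hu; apply: AA_sep; first by have [r Ar ->] := Hu 0%N; rewrite mul1r.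
move=> N; suff [w Hw ew] : exists2 w, (forall N, exists2 r, AA r & w = Z ^+ N * r) & u = tS P ^+ N * w.
  by exists w => //; have [r Ar ->] := Hw 0%N; rewrite mul1r.
elim: N => [|N [w /step[w' Hw' ew'] ew]]; first by exists u; rewrite ?mul1r.
by exists w' => //; rewrite ew ew' mulrA exprSr.
Qed.

Lemma expands_red e F : expands iE Z AA e F -> expands (@ps_C k) (p2 Z) (fun=> True) (p2 e) (redS F).
Proof.
move=> He N; have [r _ ->] := He N; exists (p2 r) => //.
rewrite p2D p2M (rmorphXn p2) (rmorph_sum p2) /=; congr (_ + _).
by apply: eq_bigr => i _; rewrite -[LHS]/(p2 (iE (F i) * Z ^+ i)) p2M (rmorphXn p2) p2_iE.
Qed.

Lemma expandsE e : AA e -> exists F, expands iE Z AA e F.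
Proof. exact: (expands_ex taylor_step). Qed.
Lemma expandsU e F F' : expands iE Z AA e F -> expands iE Z AA e F' -> F = F'.
Proof.
apply: (expands_uniq AA_subring AA_iE AZ Z_reg) => c y Ay; exact: iE_Z Ay.
Qed.

Lemma taylor_surj_step F : exists e G' F', [/\ AA e, expands iE Z AA e G' & F = G' + P * F'].
Proof.
have Z1 : vge 1 (p2 Z) := vZ.1.
have [e Ae ee] := p2_surj (ps_comp (p2 Z) (redS F)).
have [G' eG] := expandsE Ae.
have rr : redS F = redS G'.
  have h1 := ps_comp_expands Z1 (redS F); have := expands_red eG; rewrite ee => h2.
  apply: (expands_uniq _ _ _ _ _ h1 h2) => //.
    by move=> x y _ _; apply: ps_mulfI; apply: has_val_neq0 vZ.
  move=> c y _ /(congr1 (fun x : ps k => x 0%N)).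
  by rewrite ps_M0E Z1 // mul0r.
have [|F' eF] := @pdivS (F - G'); first by rewrite rmorphB /= rr subrr.
by exists e, G', F'; split=> //; rewrite -eF addrC subrK.
Qed.

(** Modulo [p] every series is an expansion, as [p2] is surjective and the reduction of [Z] is a
    uniformizer; the error is corrected [p]-adically, and uniqueness of expansions identifies the
    limit. *)
Lemma taylor_surj F : exists2 e, AA e & expands iE Z AA e F.
Proof.
have [|f Hf] := @choice S (E * S * S)%type (fun F c =>
    [/\ AA c.1.1, expands iE Z AA c.1.1 c.1.2 & F = c.1.2 + P * c.2]).
  by move=> F'; have [e [G' [F'' h]]] := taylor_surj_step F'; exists (e, G', F'').
pose u N := iter N (fun F => (f F).2) F.
have [e Ae He] : exists2 e, AA e & forall N, exists2 r, AA r &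
    e = \sum_(i < N) tS P ^+ i * (f (u i)).1.1 + tS P ^+ N * r.
  by apply: (@AA_complete (fun i => (f (u i)).1.1)) => i; have [] := Hf (u i).
have [Ge eGe] := expandsE Ae; exists e; first exact: Ae.
suff -> : F = Ge; first exact: eGe.
apply: funext => m; apply/eqP; rewrite -subr_eq0; apply/eqP/psep => N.
have [r Ar er] := He N; have [Gr eGr] := expandsE Ar.
have eP i : expands iE Z AA (tS P ^+ i) (P ^+ i).
  rewrite -iE_p /P -!rmorphXn; exact: (expandsC _ AA_subring AA_iE).
have eS : expands iE Z AA e (\sum_(i < N) P ^+ i * (f (u i)).1.2 + P ^+ N * Gr).
  rewrite er; apply: (expandsD AA_subring); last exact: (expandsM AA_subring AA_iE AZ (eP N) eGr).
  elim: N {r Ar er Gr eGr} => [|N IH].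
    rewrite !big_ord0 -(rmorph0 iE) -(rmorph0 (@ps_C R)); exact: (expandsC _ AA_subring AA_iE).
  rewrite !big_ord_recr /=; apply: (expandsD AA_subring); first exact: IH.
  by apply: (expandsM AA_subring AA_iE AZ (eP N)); have [_ h _] := Hf (u N); exact: h.
have eF : F = \sum_(i < N) P ^+ i * (f (u i)).1.2 + P ^+ N * u N.
  elim: N {r Ar er Gr eGr eS} => [|N IH]; first by rewrite big_ord0 add0r mul1r.
  rewrite big_ord_recr /= {1}IH -addrA; congr (_ + _).
  by have [_ _ {1}->] := Hf (u N); rewrite exprSr; ring.
exists ((u N - Gr) m); rewrite (expandsU eGe eS) {1}eF -psNE -psDE.
have -> (x a b c : S) : x + a * b - (x + a * c) = a * (b - c) by ring.
by rewrite /P -(rmorphXn (@ps_C R)) psCM.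
Qed.
End Taylor.

(** An interface that hides the Klein algebra: the group is transported from these properties
    alone. *)
Lemma lift_package :
  exists (E' : comNzRingType) (K : E' -> Prop) (pr : {rmorphism E' -> ps k})
    (th : {rmorphism S -> E'}) (io : {rmorphism R -> E'}) (a b s' : {rmorphism E' -> E'}) (V0 V1 Z : E'),
  [/\ subring_prop K, forall f, K (th f), [/\ K V0, K V1 & K Z],
      [/\ forall e, K e -> K (a e), forall e, K e -> K (b e) & forall e, K e -> K (s' e)] &
      forall c, io c = th (ps_C c)] /\
  [/\ forall e, a (a e) = e, forall e, b (b e) = e, forall e, a (b e) = b (a e),
      forall e, s' (a e) = b (s' e) & forall e, s' (b e) = a (b (s' e))] /\
  [/\ forall e, s' (s' (s' e)) = e,
      forall e, pr (a e) = al (pr e), forall e, pr (b e) = be (pr e) &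
      forall e, pr (s' e) = s (pr e)] /\
  [/\ forall f, a (th f) = th f, forall f, b (th f) = th f, forall f, s' (th f) = th (sg f) &
      injective th] /\
  [/\ pr V0 = w0, pr V1 = w1, forall f, pr (th f) = ps_comp t (redS f),
      forall e, K e -> a e = e -> b e = e -> exists f, e = th f &
      has_val 1 (pr Z)] /\
  [/\ forall e, K e -> exists F, expands io Z K e F,
      forall F, exists2 e, K e & expands io Z K e F,
      forall e F F', expands io Z K e F -> expands io Z K e F' -> F = F',
      forall e e' F, expands io Z K e F -> expands io Z K e' F -> e = e' &
      forall e F, expands io Z K e F -> expands (@ps_C k) (pr Z) (fun=> True) (pr e) (redS F)].
Proof.
have [Z AZ [vZ [x0 [v0 [Ax0 vx0 v0n aZ]]]]] := uniformizer_ex.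
exists E, AA, p2, tS, iE, aE, bE, sE, W0, W1, Z; split; last split; last split; last split; last split.
- split=> //; [exact: AA_subring | exact: AA_tS | by split; [exact: AA_W0 | exact: AA_W1 |] |].
  by split; [exact: AA_a | exact: AA_b | exact: AA_s].
- by split; [exact: aEK | exact: bEK | exact: abE | exact: sEa | exact: sEb].
- by split=> //; apply: sEK.
- split; [exact: aE_tS | exact: bE_tS | exact: sE_tS |].
  by move=> f g /(congr1 p1); rewrite !tS1 /klc => /kl_inj[/j_inj].
- by split=> //; apply: AA_fix.
- split.
  + exact: (expandsE AZ vZ Ax0 vx0 v0n aZ).
  + exact: (taylor_surj AZ vZ Ax0 vx0 v0n aZ).
  + exact: (expandsU AZ vZ).
  + move=> e e' F; exact: (expands_inj AA_subring (Z_sep AZ vZ)).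
  + exact: expands_red.
Qed.
End Lift.
(** A_4-actions on k[[z]] *)

(** The second hypothesis says that [Q] looks only at earlier values, so a value remains valid when
    the sequence is continued. *)
Lemma recursive_choice (T : Type) (x0 : T) (Q : (nat -> T) -> nat -> T -> Prop) :
  (forall c j, exists v, Q c j v) ->
  (forall c c' j v, (forall i, (i < j)%N -> c i = c' i) -> Q c j v -> Q c' j v) ->
  exists c, forall j, Q c j (c j).
Proof.
move=> Qex Qext; have [f Hf] := choice (fun cj : (nat -> T) * nat => Qex cj.1 cj.2).
pose u := fix u n := if n is m.+1 then fun i => if i == m then f (u m, m) else u m i else fun=> x0.
have uE m i : (i < m)%N -> u m i = u i.+1 i.
  elim: m => // m IH; rewrite ltnS leq_eqVlt => /orP[/eqP->//|im] /=.
  by rewrite ltn_eqF // IH.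
exists (fun j => u j.+1 j) => j /=; rewrite eqxx; apply: Qext (Hf (u j, j)) => i /= ij.
exact: uE.
Qed.

Lemma ps_sqrE (k : closedFieldType) (char2 : 2%N \in [pchar k]) (f : ps k) i :
  (f ^+ 2) i = if odd i then 0 else f i./2 ^+ 2.
Proof. by have [Y ->] := sqr_mod2 f; rewrite (two_psk char2) mul0r addr0. Qed.

(** The coefficients of [c] are found in increasing order: below index [n] a square root kills the
    even degree [2j], at [n] an Artin-Schreier equation kills degree [2n], and above [n] the
    equation in degree [j + n] is linear in [c_j]. *)
Lemma artin_schreier_reduce (k : closedFieldType) (char2 : 2%N \in [pchar k]) (q : ps k) n : (0 < n)%N ->
  exists c : ps k, forall i, (q + c ^+ 2 + psX k ^+ n * c) i <> 0 -> odd i /\ (i < 2 * n)%N.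
Proof.
move=> n0; have xx (a : k) : a + a = 0.
  by rewrite -mulr2n -mulr_natl pcharf0 // mul0r.
pose Q (c : nat -> k) j v := [/\
  (j < n)%N -> v ^+ 2 = q (2 * j)%N + (if (n <= 2 * j)%N then c (2 * j - n)%N else 0),
  j = n -> v ^+ 2 + v = q (2 * n)%N &
  (n < j)%N -> v = q (j + n)%N + (if odd (j + n) then 0 else c (j + n)./2 ^+ 2)].
have [||c Hc] := @recursive_choice k 0 Q.
- move=> c j; have [jn|jn|->] := ltngtP j n.
  + have [v ev] := closed_sqrt (q (2 * j)%N + (if (n <= 2 * j)%N then c (2 * j - n)%N else 0)).
    by exists v; split=> //; lia.
  + by exists (q (j + n)%N + (if odd (j + n) then 0 else c (j + n)./2 ^+ 2)); split=> //; lia.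
  + have [v] := @solve_monicpoly k 2 (fun i => if i == 0%N then q (2 * n)%N else -1) isT.
    rewrite !big_ord_recl big_ord0 /= !addr0 mulr1 expr1 => e; exists v.
    by split=> [|_|]; [lia | rewrite e; ring | lia].
- move=> c c' j v H [H1 H2 H3]; split=> // jn.
  + by rewrite H1 //; case: ifP => // h; rewrite H //; lia.
  + by rewrite H3 //; case: ifP => // h; rewrite H //; lia.
exists (c : ps k) => i; rewrite !psDE (ps_sqrE char2) psXnM => ne.
suff : odd i /\ (i < 2 * n)%N \/ q i + (if odd i then 0 else c i./2 ^+ 2)
    + (if (i < n)%N then 0 else c (i - n)%N) = 0 by case.
clear ne; have [i2|i2] := ltnP i (2 * n)%N; [case: (boolP (odd i)) => oi; [by left | right] | right].
  have [H _ _] := Hc i./2; rewrite H; last lia.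
  have -> : (2 * i./2)%N = i by lia.
  by rewrite leqNgt; case: (i < n)%N; rewrite /= ?addr0 ?addrA xx ?add0r ?xx.
rewrite ltnNge; have -> : (n <= i)%N by lia.
move: i2; rewrite /= leq_eqVlt => /orP[/eqP ei|i2].
  have [_ H _] := Hc n; move: (H erefl); rewrite -ei.
  have -> : odd (2 * n) = false by lia.
  have -> : (2 * n - n)%N = n by lia.
  have -> : (2 * n)./2 = n by lia.
  by move=> <-; rewrite -addrA xx.
have [_ _ H] := Hc (i - n)%N; rewrite H; last lia.
by rewrite subnK ?xx //; lia.
Qed.

Lemma sum3_root1 (F : idomainType) (l : F) : l ^+ 3 = 1 -> l <> 1 -> 1 + l + l ^+ 2 = 0.
Proof.
move=> l3 l1; have /eqP : (l - 1) * (1 + l + l ^+ 2) = 0 by transitivity (l ^+ 3 - 1); [ring | rewrite l3 subrr].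
by rewrite mulf_eq0 subr_eq0 => /orP[/eqP|/eqP].
Qed.

Lemma root3_modn (F : nzRingType) (l : F) a b : l ^+ 3 = 1 -> a = b %[mod 3] -> l ^+ a = l ^+ b.
Proof.
move=> l3 e; rewrite (divn_eq a 3) (divn_eq b 3) e !exprD mulnC exprM l3 expr1n.
by rewrite [(_ * 3)%N]mulnC exprM l3 expr1n.
Qed.

(** * Automorphisms of [k[[z]]]: valuations, fixed elements, ramification *)

Section Automorphism.
Variable k : closedFieldType.
Implicit Types (f g : {rmorphism ps k -> ps k}) (x y : ps k).

(** Minus its constant term, an element of [K] has positive valuation, hence at least [m] by
    divisibility; so it can be divided by [x] within [K], again and again. *)
Lemma ps_comp_digits (K : ps k -> Prop) m x : (0 < m)%N -> has_val m x ->
  subring_prop K -> (forall c, K (ps_C c)) -> (forall h, K ((x * h : ps k)) -> K h) ->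
  (forall j y, K y -> has_val j y -> (m %| j)%N) ->
  forall y, K y -> exists F, y = ps_comp x F.
Proof.
move=> m0 vx Ks KC Kdiv Kv y Ky; have x1 : vge 1 x := vgeW m0 vx.1.
suff [F HF] : exists F, expands (@ps_C k) x K y F.
  exists F; apply: (ps_comp_uniq x1) => n; have [r _ e] := HF n; by exists r.
apply: expands_ex Ky => u Ku; exists (u 0%N).
have Kd : K (u - ps_C (u 0%N)) by have [_ KB _] := Ks; apply: KB.
have [h eh] : exists h, u - ps_C (u 0%N) = x * h.
  apply: (ps_div vx); have [//|[j jm vj]] := vge_or (u - ps_C (u 0%N)) m.
  have := Kv _ _ Kd vj; have := vge_has_val (vge1_C u) vj.
  by case: j jm {vj} => // j jm _ /dvdn_leq; lia.
by exists h; [apply: Kdiv; rewrite -eh | rewrite -eh addrC subrK].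
Qed.

(** Continuity is automatic: if [f(X)] were a unit, applying [g] would make [X] a unit. *)
Lemma aut_vge f g m x : (forall y, g (f y) = y) -> vge m x -> vge m (f x).
Proof.
move=> gf /vge_divX[h ->]; rewrite rmorphM rmorphXn; apply: vgeMr.
suff f1 : vge 1 (f (psX k)) by have := @vge_exp _ 1 m _ f1; rewrite mul1n.
case=> // _; have [//|/eqP/ps_unit_field[y e]] := eqVneq (f (psX k) 0%N) 0.
have := congr1 (fun u : ps k => u 0%N) (congr1 g e).
by rewrite rmorphM gf ps_M0E mul0r rmorph1 ps1E => /esym/eqP; rewrite oner_eq0.
Qed.

Lemma aut_has_val f g m x : (forall y, g (f y) = y) -> (forall y, f (g y) = y) ->
  has_val m x -> has_val m (f x).
Proof.
move=> gf fg [vx nx]; split; first exact: aut_vge vx.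
move=> e; apply: nx; suff h : vge m.+1 (g (f x)) by rewrite -[x]gf; apply: h.
by apply: (@aut_vge g f _ _ fg); apply/vgeS; split=> //; apply: aut_vge gf vx.
Qed.

Lemma ps_comp_onto x y : has_val 1 x -> exists F, y = ps_comp x F.
Proof.
by move=> vx; apply: (@ps_comp_digits (fun=> True) 1 x).
Qed.

Lemma aut_fix_comp f x F : (forall c, f (ps_C c) = ps_C c) -> vge 1 x -> f x = x ->
  f (ps_comp x F) = ps_comp x F.
Proof.
move=> fC x1 fx; rewrite (aut_comp (c := 1)) ?ps_sub1 //.
by rewrite rmorph1 mul1r.
Qed.

Lemma aut_comp_eq f g x y : (forall c, f (ps_C c) = ps_C c) -> (forall c, g (ps_C c) = ps_C c) ->
  vge 1 (f x) -> has_val 1 x -> f x = g x -> f y = g y.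
Proof.
move=> fC gC fx1 vx e; have [F ->] := ps_comp_onto y vx.
suff H (h : {rmorphism ps k -> ps k}) : (forall c, h (ps_C c) = ps_C c) -> h x = f x -> h (ps_comp x F) = ps_comp (f x) F.
  by rewrite (H f) // (H g).
move=> hC hx; apply: (ps_comp_uniq fx1) => n; have [r _ er] := ps_comp_expands vx.1 F n.
exists (h r) => //; rewrite {1}er rmorphD rmorphM rmorphXn rmorph_sum /= hx; congr (_ + _).
by apply: eq_bigr => i _; rewrite rmorphM rmorphXn /= hx hC.
Qed.

Lemma aut_fix_id f x y : (forall c, f (ps_C c) = ps_C c) -> has_val 1 x -> f x = x -> f y = y.
Proof.
by move=> fC vx fx; have [F ->] := ps_comp_onto y vx; apply: aut_fix_comp => //; apply: vx.1.
Qed.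

Lemma fix_cancel f x h : x <> 0 -> f x = x -> f (x * h) = x * h -> f h = h.
Proof. by move=> x0 fx; rewrite rmorphM fx => /(ps_mulfI x0). Qed.

(** Dividing a fixed element of odd valuation by a power of the norm [X f(X)], of valuation 2, would
    leave a fixed uniformizer, and [f] would be the identity. *)
Lemma invol_fix_even f x m : (forall c, f (ps_C c) = ps_C c) -> (forall y, f (f y) = y) ->
  (exists y, f y <> y) -> f x = x -> has_val m x -> (2 %| m)%N.
Proof.
move=> fC f2 [y0 ny] fx vx; apply/negPn/negP => m2; apply: ny.
have vX : has_val 1 (psX k) := has_valX k.
have vy : has_val 2 (psX k * f (psX k)) by apply: (has_valM vX); apply: aut_has_val vX.
set y := psX k * f (psX k) in vy; have fy : f y = y by rewrite /y rmorphM f2 mulrC.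
have em : m = (2 * m./2 + 1)%N by lia.
have vj := has_val_exp m./2 vy; rewrite em in vx.
have [h eh] : exists h, x = y ^+ m./2 * h.
  by apply: (ps_div vj); apply: vgeW vx.1; lia.
have vh : has_val 1 h by rewrite eh in vx; apply: has_val_cancel vj vx.
apply: (aut_fix_id _ fC vh); apply: (fix_cancel (has_val_neq0 vj)).
  by rewrite rmorphXn /= fy.
by rewrite -eh.
Qed.

Lemma aut_diff_vge f e m x : (forall c, f (ps_C c) = ps_C c) -> (forall n y, vge n y -> vge n (f y)) ->
  (0 < e)%N -> vge e (f (psX k) - psX k) -> vge m x -> vge (m + e - 1) (f x - x).
Proof.
move=> fC fV e0 ve.
(* [d] bounds the gap between the valuation and the target [B]. Removing the leading monomial lowers
   it by one, and at gap 0 invariance of the valuation suffices. *)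
suff H d B m0 y : (B <= m0 + d)%N -> (B <= m0 + e - 1)%N -> vge m0 y -> vge B (f y - y).
  by apply: (H e (m + e - 1)%N m); lia.
elim: d m0 y => [|d IH] m0 y Bd Be vy.
  by apply: (vgeW (n := m0)); [lia | apply: vgeB => //; apply: fV].
have [h eh] := vge_divX vy; pose y' := y - ps_C (h 0%N) * psX k ^+ m0.
have -> : f y - y = (f y' - y') + ps_C (h 0%N) * (f (psX k) ^+ m0 - psX k ^+ m0).
  by rewrite /y' rmorphB rmorphM rmorphXn fC; ring.
apply: vgeD.
  apply: (IH m0.+1); [lia | lia |]; have := @vgeM _ _ _ _ _ (@vge_X k m0) (@vge1_C _ h).
  by rewrite addn1 mulrBr /y' eh [ps_C _ * _]mulrC.
apply: vgeMl; rewrite subrXX; apply: (vgeW (n := (e + (m0 - 1))%N)); first lia.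
apply: vgeM => //; apply: vge_sum => i _; have im := ltn_ord i.
apply: (vgeW (n := (m0.-1 - i + i)%N)); first lia.
apply: vgeM; last exact: vge_X.
by have := @vge_exp _ 1 (m0.-1 - i) _ (fV _ _ (has_valX k).1); rewrite mul1n => v1; apply: v1.
Qed.
End Automorphism.

(** * Invariants of the Klein group and the action of the 3-cycle on them *)

Section Action.
Variables (k : closedFieldType) (char2 : 2%N \in [pchar k]).
Variables (al be s : {rmorphism ps k -> ps k}).
Hypotheses (alC : forall c, al (ps_C c) = ps_C c) (beC : forall c, be (ps_C c) = ps_C c)
  (sC : forall c, s (ps_C c) = ps_C c).
Hypotheses (al2 : forall x, al (al x) = x) (be2 : forall x, be (be x) = x)
  (albe : forall x, al (be x) = be (al x)) (s3 : forall x, s (s (s x)) = x)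
  (sal : forall x, s (al x) = be (s x)) (sbe : forall x, s (be x) = al (be (s x))).
Hypothesis al_neq : exists x, al x <> x.
Local Notation X := (psX k).
Let xx := @addxx k char2.
Let addE := @addx_eq0 k char2.
Let oppE := @oppx k char2.

Lemma al_s x : al (s x) = s (be (al x)).
Proof. by rewrite sbe sal be2. Qed.
Lemma be_s x : be (s x) = s (al x). Proof. by rewrite sal. Qed.

Lemma s_inj x y : s x = s y -> x = y.
Proof. by move=> e; rewrite -[x]s3 e s3. Qed.

Lemma al_vge m x : vge m x -> vge m (al x). Proof. exact: aut_vge al2. Qed.
Lemma be_vge m x : vge m x -> vge m (be x). Proof. exact: aut_vge be2. Qed.
Lemma s_val m x : has_val m x -> has_val m (s x).
Proof. exact: (@aut_has_val k s (s \o s)). Qed.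
Lemma al_val m x : has_val m x -> has_val m (al x). Proof. exact: aut_has_val al2. Qed.
Lemma be_val m x : has_val m x -> has_val m (be x). Proof. exact: aut_has_val be2. Qed.

Lemma al_X : al X <> X.
Proof.
by have [x nx] := al_neq; move=> e; apply: nx; apply: (aut_fix_id _ alC (has_valX k) e).
Qed.
Lemma be_neq : exists x, be x <> x.
Proof. by exists (s X); rewrite be_s => /s_inj/al_X. Qed.
Lemma albe_neq : exists x, al (be x) <> x.
Proof. by exists (s (s X)); rewrite be_s al_s al2 be_s => /s_inj/s_inj/al_X. Qed.

Definition fix2 x := al x = x /\ be x = x.
Lemma fix2_subring : subring_prop fix2.
Proof.
split; first by split; rewrite rmorph1.
  by move=> x y [ax bx] [ay by_]; split; rewrite rmorphB /= ?ax ?ay ?bx ?by_.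
by move=> x y [ax bx] [ay by_]; split; rewrite rmorphM /= ?ax ?ay ?bx ?by_.
Qed.
Lemma fix2_C c : fix2 (ps_C c). Proof. by split. Qed.
Lemma fix2_cancel x h : x <> 0 -> fix2 x -> fix2 (x * h) -> fix2 h.
Proof. by move=> x0 [ax bx] [ah bh]; split; [apply: fix_cancel ax ah | apply: fix_cancel bx bh]. Qed.

Lemma fixal_even x m : al x = x -> has_val m x -> (2 %| m)%N.
Proof. exact: invol_fix_even alC al2 al_neq. Qed.

Lemma fixal_subring : subring_prop (fun x => al x = x).
Proof.
split; first exact: rmorph1.
  by move=> x y ax ay; rewrite rmorphB ax ay.
by move=> x y ax ay; rewrite rmorphM ax ay.
Qed.

Let y2 := X * al X.
Lemma y2_val : has_val 2 y2. Proof. exact: has_valM (has_valX k) (al_val (has_valX k)). Qed.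
Lemma y2_fix : al y2 = y2. Proof. by rewrite rmorphM al2 mulrC. Qed.

(** Otherwise [be] fixes the trace and the norm of [X] under [al], so [be X] is [X] or [al X], and
    [be] or [al be] is trivial. *)
Lemma fixal_not_fixbe : exists2 p, al p = p & be p <> p.
Proof.
apply: contrapT => H.
have fb x : al x = x -> be x = x.
  by move=> ax; apply: contrapT => bx; apply: H; exists x.
pose e := X + al X.
have ee : be e = e by apply: fb; rewrite rmorphD al2 addrC.
have ey : be y2 = y2 by apply: fb; exact: y2_fix.
have : (be X - X) * (be X - al X) = 0.
  have h : X ^+ 2 - e * X + y2 = 0 by rewrite /e /y2; ring.
  have := congr1 be h; rewrite rmorphD rmorphB rmorphXn rmorphM ee ey rmorph0 => <-.
  by rewrite /e /y2; ring.
case/ps_mulf_eq0 => /eqP; rewrite subr_eq0 => /eqP h.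
  by have [x nx] := be_neq; apply: nx; apply: (aut_fix_id _ beC (has_valX k) h).
have [x nx] := albe_neq; apply: nx.
have abC c : (al \o be) (ps_C c) = ps_C c by rewrite /= beC alC.
by apply: (aut_fix_id (f := al \o be) _ abC (has_valX k)); rewrite /= h al2.
Qed.

Let y4 := y2 * be y2.
Lemma y4_val : has_val 4 y4. Proof. exact: has_valM y2_val (be_val y2_val). Qed.
Lemma y4_fix : fix2 y4.
Proof. by split; rewrite rmorphM /= ?y2_fix ?be2 1?mulrC ?albe ?y2_fix // mulrC. Qed.

(** Otherwise division by a power of the norm [y4] gives an invariant [h] of valuation 2. Then all
    elements fixed by [al] are series in [h], hence fixed by [be], against [fixal_not_fixbe]. *)
Lemma fix2_dvd4 m x : fix2 x -> has_val m x -> (4 %| m)%N.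
Proof.
move=> fx vx; have m2 := fixal_even fx.1 vx.
apply/negPn/negP => m4; have [p ap] := fixal_not_fixbe; apply.
have em : m = (4 * (m %/ 4) + 2)%N by lia.
have vj := has_val_exp (m %/ 4) y4_val; rewrite em in vx.
have [h eh] : exists h, x = y4 ^+ (m %/ 4) * h by apply: (ps_div vj); apply: vgeW vx.1; lia.
have vh : has_val 2 h by rewrite eh in vx; apply: has_val_cancel vj vx.
have [ah bh] : fix2 h.
  apply: (fix2_cancel (has_val_neq0 vj)); last by rewrite -eh.
  exact: (KX fix2_subring) y4_fix.
have [||F ->] := @ps_comp_digits k (fun x => al x = x) 2 h isT vh fixal_subring alC _ _ p ap.
- by move=> u; apply: fix_cancel (has_val_neq0 vh) ah.
- by move=> j y ay vy; apply: fixal_even ay vy.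
by apply: aut_fix_comp => //; apply: vgeW vh.1.
Qed.

Lemma fix2_comp t x : has_val 4 t -> fix2 t -> fix2 x -> exists F, x = ps_comp t F.
Proof.
move=> vt ft fx.
apply: (@ps_comp_digits k fix2 4 t isT vt fix2_subring fix2_C _ _ x fx).
  by move=> u; apply: fix2_cancel (has_val_neq0 vt) ft.
by move=> j y fy vy; apply: fix2_dvd4 fy vy.
Qed.
Lemma comp_fix2 t F : has_val 4 t -> fix2 t -> fix2 (ps_comp t F).
Proof. by move=> vt ft; split; apply: aut_fix_comp => //; [apply: vgeW vt.1 | apply: ft.1 | apply: vgeW vt.1 | apply: ft.2]. Qed.

Lemma s_fix2 x : fix2 x -> fix2 (s x).
Proof. by move=> [ax bx]; split; rewrite ?al_s ?be_s ax ?bx. Qed.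

(** Otherwise [s] fixes the coefficients of the quartic with roots the Klein conjugates of [X]. Then
    [s] agrees with an element of the Klein group and commutes with [al], whereas it conjugates [al]
    to [be]. *)
Lemma s_not_fix2 : exists2 x, fix2 x & s x <> x.
Proof.
apply: contrapT => H.
have fs x : fix2 x -> s x = x by move=> ax; apply: contrapT => bx; apply: H; exists x.
pose a := al X; pose b := be X; pose c := al (be X).
have [ea eb ec] : [/\ al X = a, al a = X & al b = c] by rewrite /a al2.
have [fa fb fc] : [/\ be X = b, be a = c & be b = X] by rewrite /a /b /c albe be2.
have [ed fd] : al c = b /\ be c = a by rewrite /c al2 -albe be2.
pose e1 := X + a + b + c.
pose e2 := X * a + X * b + X * c + a * b + a * c + b * c.
pose e3 := X * a * b + X * a * c + X * b * c + a * b * c.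
pose e4 := X * a * b * c.
have f1 : s e1 = e1.
  by apply: fs; split; rewrite !rmorphD /= ?ea ?eb ?ec ?ed ?fa ?fb ?fc ?fd /e1; ring.
have f2 : s e2 = e2.
  by apply: fs; split; rewrite !rmorphD !rmorphM /= ?ea ?eb ?ec ?ed ?fa ?fb ?fc ?fd /e2; ring.
have f3 : s e3 = e3.
  by apply: fs; split; rewrite !rmorphD !rmorphM /= ?ea ?eb ?ec ?ed ?fa ?fb ?fc ?fd /e3; ring.
have f4 : s e4 = e4.
  by apply: fs; split; rewrite !rmorphM /= ?ea ?eb ?ec ?ed ?fa ?fb ?fc ?fd /e4; ring.
have : (s X - X) * (s X - a) * (s X - b) * (s X - c) = 0.
  have h : X ^+ 4 - e1 * X ^+ 3 + e2 * X ^+ 2 - e3 * X + e4 = 0.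
    by rewrite /e1 /e2 /e3 /e4; ring.
  have : (s X) ^+ 4 - e1 * (s X) ^+ 3 + e2 * (s X) ^+ 2 - e3 * s X + e4 = 0.
    move: e1 e2 e3 e4 f1 f2 f3 f4 h => E1 E2 E3 E4 f1 f2 f3 f4 /(congr1 s).
    by rewrite rmorphD rmorphB rmorphD rmorphB (rmorphM s E1) (rmorphM s E2) (rmorphM s E3) !rmorphXn f1 f2 f3 f4 rmorph0.
  by move=> <-; rewrite /e1 /e2 /e3 /e4; ring.
have sv := (s_val (has_valX k)).1.
have H' (f : {rmorphism ps k -> ps k}) : (forall d, f (ps_C d) = ps_C d) ->
    (forall x, f (al x) = al (f x)) -> s X - f X = 0 -> False.
  move=> fC fal /eqP; rewrite subr_eq0 => /eqP sX.
  have sf x : s x = f x := aut_comp_eq x sC fC sv (has_valX k) sX.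
  have [x] := albe_neq; rewrite -[x]s3.
  by rewrite -sal sf fal -sf al2.
case/ps_mulf_eq0; last by apply: (H' (al \o be)) => *; rewrite /= ?beC ?alC ?albe.
case/ps_mulf_eq0; last by apply: (H' be) => *; rewrite ?albe.
case/ps_mulf_eq0; last by apply: (H' al).
exact: (H' idfun).
Qed.

Lemma uniformizer_fix2 : exists t l, [/\ has_val 4 t, fix2 t, s t = ps_C l * t, l ^+ 3 = 1 & l <> 1].
Proof.
move: y4_val y4_fix; move: y4 => y vy fy.
have [u eu] := ps_div vy (s_val vy).1.
have fu : fix2 u by apply: (fix2_cancel (has_val_neq0 vy) fy); rewrite -eu; apply: s_fix2.
pose l := u 0%N.
have su0 x : s x 0%N = x 0%N.
  have : vge 1 (s (x - ps_C (x 0%N))) by apply: (@aut_vge k s (s \o s)) => //; apply: vge1_C.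
  by rewrite rmorphB sC => /(_ 0%N isT)/eqP; rewrite psDE psNE /ps_C /= subr_eq0 => /eqP.
have u3 : u * s u * s (s u) = 1.
  apply: (ps_mulfI (has_val_neq0 vy)); rewrite mulr1 -[RHS]s3 eu rmorphM eu !rmorphM eu /=; ring.
have l3 : l ^+ 3 = 1.
  have := congr1 (fun x : ps k => x 0%N) u3; rewrite !ps_M0E !su0 ps1E => e.
  by transitivity (l * l * l); [ring | apply: e].
(* [y v = y + l^2 s y + l s^2 y] is the projection of [y] to the eigenspace of [l]; [v] is a unit
   because its constant term is [3 = 1]. *)
pose v := 1 + ps_C (l ^+ 2) * u + ps_C l * (u * s u).
have v0 : v 0%N = 1.
  rewrite /v !psDE !psCM ps_M0E su0 ps1E -/l.
  have -> : 1 + l ^+ 2 * l + l * (l * l) = 1 + 2%:R * l ^+ 3 by ring.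
  by rewrite pcharf0 // mul0r addr0.
have vt : has_val 4 (y * v).
  rewrite -[4%N]addn0; apply: has_valM vy _; split=> //.
  by rewrite v0; apply/eqP; rewrite oner_neq0.
have ft : fix2 (y * v).
  apply: (KM fix2_subring) => //; apply: (KD fix2_subring).
    apply: (KD fix2_subring); first by have [] := fix2_subring.
    by apply: (KM fix2_subring) => //; apply: fix2_C.
  apply: (KM fix2_subring); first exact: fix2_C.
  by apply: (KM fix2_subring) => //; apply: s_fix2.
have st : s (y * v) = ps_C l * (y * v).
  have c3 : ps_C l ^+ 3 = 1 :> ps k by rewrite -rmorphXn l3 rmorph1.
  have c2 : ps_C (l ^+ 2) = ps_C l ^+ 2 :> ps k by rewrite rmorphXn.
  have sv : s v = 1 + ps_C (l ^+ 2) * s u + ps_C l * (s u * s (s u)).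
    by rewrite /v !rmorphD !(rmorphM s) rmorph1 !sC.
  rewrite rmorphM sv eu /v c2; move: (ps_C l) c3 => L c3.
  transitivity (y * (L ^+ 3 * u + L ^+ 2 * (u * s u) + L * (u * s u * s (s u)))).
    by rewrite c3; ring.
  by rewrite u3; ring.
exists (y * v), l; split=> // l1.
have [x fx nx] := s_not_fix2; apply: nx; have [F ->] := fix2_comp vt ft fx.
by apply: aut_fix_comp => //; [apply: vgeW vt.1 | rewrite st l1 rmorph1 mul1r].
Qed.

(** In even degree [2i < 2n] the equation expresses [e_i^2] through the coefficient of [e] at
    [2i - n < i], so [e] vanishes below [n]. The left side then has no odd term below [2n]. *)
Lemma artin_schreier_odd (e Q : ps k) n : (forall i, Q i <> 0 -> odd i /\ (i < 2 * n)%N) ->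
  e ^+ 2 + X ^+ n * e = Q -> Q = 0 /\ (e = 0 \/ e = X ^+ n).
Proof.
move=> HQ eQ.
have en j : (j < n)%N -> e j = 0.
  elim: j {-2}j (leqnn j) => [|j IH] i ij jn; have /eqP := congr1 (fun f : ps k => f (2 * i)%N) eQ;
    rewrite psDE (ps_sqrE char2) psXnM;
    (have -> : odd (2 * i) = false by lia);
    (have -> : (2 * i)./2 = i by lia);
    (have -> : Q (2 * i)%N = 0 by apply: contrapT => /HQ; lia).
    have -> : (2 * i < n)%N by lia.
    by rewrite addr0 sqrf_eq0 => /eqP.
  case: ifP => h; first by rewrite addr0 sqrf_eq0 => /eqP.
  rewrite (IH (2 * i - n)%N) ?addr0 ?sqrf_eq0; [by move/eqP | lia | lia].
have Q0 : Q = 0.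
  apply: funext => i; apply: contrapT => /[dup] ne /HQ[oi i2]; apply: ne.
  by rewrite -eQ psDE (ps_sqrE char2) oi psXnM add0r; case: ifP => // h; rewrite en //; lia.
split=> //; have : e * (e + X ^+ n) = 0 by rewrite -Q0 -eQ; ring.
by case/ps_mulf_eq0; [left | move/addE; right].
Qed.

(** * A normalized Artin-Schreier generator over [k[[t]]] *)

Section Uniformizer.
Variables (t : ps k) (l : k).
Hypotheses (vt : has_val 4 t) (ft : fix2 t) (st : s t = ps_C l * t) (l3 : l ^+ 3 = 1) (l1 : l <> 1).
Let t1 : vge 1 t. Proof. exact: vgeW vt.1. Qed.
Definition comp_t : ps k -> ps k := ps_comp t.
HB.instance Definition _ := GRing.isZmodMorphism.Build (ps k) (ps k) comp_t (ps_comp_additive t1).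
HB.instance Definition _ := GRing.isMonoidMorphism.Build (ps k) (ps k) comp_t (ps_comp_monoid t1).
Lemma comp_t_fix F : fix2 (comp_t F). Proof. exact: comp_fix2. Qed.
Lemma comp_tX n : comp_t (X ^+ n) = t ^+ n.
Proof. by rewrite rmorphXn /= /comp_t ps_comp_X. Qed.
Lemma comp_t_inj F H : comp_t F = comp_t H -> F = H.
Proof.
move=> e; apply/eqP; rewrite -subr_eq0; apply/eqP; apply: (ps_comp_inj vt) => //.
by rewrite -/(comp_t _) rmorphB /= e subrr.
Qed.

(** [p / t^N] is then an Artin-Schreier generator, shifted by 1 under [be], so the least [N]
    measures the ramification. *)
Definition jump_at N := exists2 p, al p = p & be p = p + t ^+ N.

Lemma be_diff x d : x + be x = d -> be x = x + d.
Proof. by move=> <-; rewrite addrA xx add0r. Qed.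

Lemma jump_at_diff x D N : al x = x -> x + be x = comp_t D -> has_val N D -> jump_at N.
Proof.
move=> ax eD vD; have [D1 eD1] := vge_divX vD.1.
have [D2 e2] : exists D2, D1 * D2 = 1.
  by apply: ps_unit_field; have := vD.2; rewrite eD1 psXnM ltnn subnn.
have [a2 b2] := comp_t_fix D2.
exists (x * comp_t D2); first by rewrite rmorphM ax a2.
rewrite rmorphM b2 (be_diff eD) mulrDl -rmorphM eD1 -mulrA e2 mulr1.
by rewrite /= comp_tX.
Qed.

Lemma diff_fix2 x : al x = x -> fix2 (x + be x).
Proof. by move=> ax; split; rewrite rmorphD ?albe ?be2 ?ax // addrC. Qed.

Lemma jump_at_ex : exists N, jump_at N.
Proof.
have [p ap bp] := fixal_not_fixbe; have [D eD] := fix2_comp vt ft (diff_fix2 ap).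
have [|N vD] := @has_val_ex _ D; last by exists N; apply: jump_at_diff ap eD vD.
move=> D0; apply: bp; move: eD; rewrite D0 -/(comp_t _) rmorph0 => h.
by rewrite (be_diff h) addr0.
Qed.

Lemma jump_at_gt0 : ~ jump_at 0.
Proof.
case=> p ap bp; have : vge 1 (be (p - ps_C (p 0%N))) by apply: be_vge; apply: vge1_C.
rewrite rmorphB beC bp => /(_ 0%N isT)/eqP.
by rewrite psDE psNE psDE expr0 ps1E /ps_C /= addrAC subrr add0r oner_eq0.
Qed.

Section Minimal.
Variable n : nat.
Hypotheses (Jn : jump_at n) (Jmin : forall N, (N < n)%N -> ~ jump_at N).

Lemma n_gt0 : (0 < n)%N.
Proof. by case: n Jn => // /jump_at_gt0. Qed.

Lemma diff_div x : al x = x -> exists D, x + be x = comp_t D * t ^+ n.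
Proof.
move=> ax; have [D eD] := fix2_comp vt ft (diff_fix2 ax).
have [/vge_divX[D1 e1]|[m mn vD]] := vge_or D n; last by case: (Jmin mn (jump_at_diff ax eD vD)).
by exists D1; rewrite eD e1 -/(comp_t _) rmorphM /= comp_tX mulrC.
Qed.

Lemma fixal_decomp w x : al w = w -> be w = w + t ^+ n -> al x = x ->
  exists a b, x = ps_comp t a + ps_comp t b * w.
Proof.
move=> aw bw ax; have [D eD] := diff_div ax; have [a2 b2] := comp_t_fix D.
have [|a ea] := @fix2_comp t (x + comp_t D * w) vt ft.
  split; rewrite rmorphD rmorphM /= ?ax ?aw ?a2 // b2 bw (be_diff eD).
  have -> : x + comp_t D * t ^+ n + comp_t D * (w + t ^+ n) =
      x + comp_t D * w + (comp_t D * t ^+ n + comp_t D * t ^+ n) by ring.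
  by rewrite xx addr0.
by exists a, D; rewrite -ea -addrA xx addr0.
Qed.

Lemma diff_vge (f g : {rmorphism ps k -> ps k}) e : (forall c, f (ps_C c) = ps_C c) ->
  (forall n y, vge n y -> vge n (f y)) -> (forall x, s (f x) = g (s x)) -> (0 < e)%N ->
  vge e (f X - X) -> vge e (g X - X).
Proof.
move=> fC fV sf e0 ve; have vs : vge 1 (s (s X)) := (s_val (s_val (has_valX k))).1.
have := aut_diff_vge fC fV e0 ve vs; rewrite addnC addn1 subn1 /= => h.
have : vge e (s (f (s (s X)) - s (s X))) by apply: (@aut_vge k s (s \o s)).
by rewrite rmorphB sf s3.
Qed.

(** The involutions are conjugate under [s], so [g X - X] has one valuation [m] for all three. The
    product for [be] and [al be] is the value at [X] of the [be]-conjugate of the quadratic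
    polynomial of [X] over the ring fixed by [al]. By [diff_div] its coefficients change by
    multiples of [t^n], whence [2m >= 4n]. *)
Lemma jump_al m x : vge m x -> vge (m + 2 * n - 1) (al x + x).
Proof.
move=> vx; have -> : al x + x = al x - x by rewrite oppE.
apply: aut_diff_vge => //.
- exact: al_vge.
- by have := n_gt0; lia.
move=> {m x vx}; have [//|[m m2 vm]] := vge_or (al X - X) (2 * n).
have m0 : (0 < m)%N.
  have := vge_has_val _ vm; apply; rewrite -[X]mulr1.
  by apply: vgeB; [apply: al_vge |]; apply: vgeMr; apply: (has_valX k).1.
have abC c : (al \o be) (ps_C c) = ps_C c by rewrite /= beC alC.
have abV i x : vge i x -> vge i ((al \o be) x) by move=> v; apply: al_vge; apply: be_vge.
have sab x : s ((al \o be) x) = al (s x) by rewrite /= sal sbe -albe be2.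
have vb : has_val m (be X - X).
  have v1 := diff_vge alC al_vge sal m0 vm.1; split=> // e.
  have v2 : vge m.+1 (be X - X) by apply/vgeS.
  apply: vm.2; have v3 := diff_vge (g := al \o be) beC be_vge sbe (ltn0Sn m) v2.
  exact: (diff_vge abC abV sab (ltn0Sn m) v3).
have vab : has_val m (al (be X) - X).
  have v1 := diff_vge (g := al \o be) beC be_vge sbe m0 vb.1; split=> // e.
  have v2 : vge m.+1 ((al \o be) X - X) by apply/vgeS.
  by apply: vm.2; apply: (diff_vge abC abV sab (ltn0Sn m) v2).
have vv := has_valM vb vab; have := vge_has_val _ vv.
have a1 : al (X + al X) = X + al X by rewrite rmorphD al2 addrC.
have [D1 e1] := diff_div a1; have [D2 e2] := diff_div y2_fix.
have b1 := be_diff e1; have b2 := be_diff e2.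
have -> : (be X - X) * (al (be X) - X) = (comp_t D2 - X * comp_t D1) * t ^+ n.
  have -> : (be X - X) * (al (be X) - X) = be y2 - X * be (X + al X) + X ^+ 2.
    by rewrite /y2 rmorphM rmorphD albe; ring.
  by rewrite b1 b2 /y2; ring.
move/(_ (4 * n)%N); have := @vge_exp _ 4 n t vt.1 => v4.
have v5 := @vgeMl _ _ (comp_t D2 - X * comp_t D1) _ v4.
by move/(_ v5); lia.
Qed.

(** If not, [q] has valuation at least 3 and [w * be w] at least 12. Then [t] divides [w], and
    [w / t] contradicts the minimality of [n]. *)
Lemma has_val1_odd w q : al w = w -> be w = w + t ^+ n -> w ^+ 2 + t ^+ n * w = comp_t q ->
  (forall i, q i <> 0 -> odd i) -> has_val 1 q.
Proof.
move=> aw bw wq qo; have qe i : ~~ odd i -> q i = 0.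
  by move=> oi; apply: contrapT => /qo; apply/negP.
split; first by case=> // _; apply: qe.
move=> q1; have vq : vge 3 q by case=> [|[|[|]]] // _; apply: qe.
have n1 := n_gt0.
have vw : vge 12 (w * be w).
  have -> : w * be w = comp_t q by rewrite bw -wq; ring.
  have [g ->] := vge_divX vq; rewrite rmorphM /= comp_tX; apply: vgeMr.
  exact: (@vge_exp _ 4 3 t vt.1).
have [v4|[m m4 vm]] := vge_or w 4; last first.
  by have := vge_has_val vw (has_valM vm (be_val vm)); lia.
have [h eh] := ps_div vt v4; apply: (Jmin (N := n.-1)); first lia.
exists h; first by apply: (fix_cancel (has_val_neq0 vt) ft.1); rewrite -eh.
apply: (ps_mulfI (has_val_neq0 vt)); rewrite mulrDr -eh -exprS prednK // -bw eh rmorphM.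
by rewrite ft.2.
Qed.

Lemma invariant_ex : exists w q, [/\ al w = w, be w = w + t ^+ n, w ^+ 2 + t ^+ n * w = comp_t q &
  forall i, q i <> 0 -> odd i /\ (i < 2 * n)%N].
Proof.
have [p ap bp] := Jn; have [at_ bt] := ft.
have [|q0 eq0] := @fix2_comp t (p ^+ 2 + t ^+ n * p) vt ft.
  split; rewrite rmorphD rmorphXn rmorphM rmorphXn /= ?ap ?at_ // bp bt.
  transitivity (p ^+ 2 + t ^+ n * p + (t ^+ n * p + t ^+ n * p) + (t ^+ n * t ^+ n + t ^+ n * t ^+ n)).
    by ring.
  by rewrite !xx !addr0.
have [c Hc] := artin_schreier_reduce char2 q0 n_gt0.
have [ac bc] := comp_t_fix c.
exists (p + comp_t c), (q0 + c ^+ 2 + X ^+ n * c); split=> //.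
- by rewrite rmorphD ap ac.
- by rewrite rmorphD bp bc addrAC.
rewrite !(rmorphD comp_t) (rmorphXn comp_t) (rmorphM comp_t) /= comp_tX -[comp_t q0]eq0.
transitivity (p ^+ 2 + t ^+ n * p + comp_t c ^+ 2 + t ^+ n * comp_t c + (p * comp_t c + p * comp_t c)).
  by ring.
by rewrite xx addr0.
Qed.

Lemma invariant_s w : al w = w -> be w = w + t ^+ n ->
  [/\ be (s w) = s w, al (s w) = s w + ps_C (l ^+ n) * t ^+ n,
      be (s (s w)) = s (s w) + ps_C (l ^+ (2 * n)) * t ^+ n &
      al (s (s w)) = s (s w) + ps_C (l ^+ (2 * n)) * t ^+ n].
Proof.
move=> aw bw.
have stn c : s (ps_C c * t ^+ n) = ps_C (c * l ^+ n) * t ^+ n.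
  by rewrite rmorphM rmorphXn sC /= st exprMn -rmorphXn rmorphM mulrA.
have b1 : be (s w) = s w by rewrite be_s aw.
have stn1 : s (t ^+ n) = ps_C (l ^+ n) * t ^+ n.
  by have := stn 1; rewrite rmorph1 !mul1r.
have a1 : al (s w) = s w + ps_C (l ^+ n) * t ^+ n by rewrite al_s aw bw rmorphD /= stn1.
have b2 : be (s (s w)) = s (s w) + ps_C (l ^+ (2 * n)) * t ^+ n.
  by rewrite be_s a1 rmorphD /= stn -exprD addnn mul2n.
have btn : be (ps_C (l ^+ n) * t ^+ n) = ps_C (l ^+ n) * t ^+ n.
  by rewrite (rmorphM be) (rmorphXn be) beC /= ft.2.
split=> //; rewrite al_s a1 (rmorphD be) /= b1 btn (rmorphD s) /= stn.
by rewrite -exprD addnn mul2n.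
Qed.

Definition trace_w w := w + ps_C (l ^+ (2 * n)) * s w + ps_C (l ^+ n) * s (s w).

Lemma invariant_trace_ex : exists w q, [/\ al w = w, be w = w + t ^+ n,
  w ^+ 2 + t ^+ n * w = comp_t q, trace_w w = 0 &
  forall i, q i <> 0 -> [/\ odd i, (i < 2 * n)%N & (i %% 3 != (2 * n) %% 3)%N]].
Proof.
have [w [q [aw bw wq Hq]]] := invariant_ex.
have [b1 a1 b2 a2] := invariant_s aw bw; have [at_ bt] := ft.
pose L := ps_C (l ^+ n); have eL : ps_C (l ^+ (2 * n)) = L ^+ 2 by rewrite -rmorphXn -exprM mulnC.
have L3 : L ^+ 3 = 1 by rewrite -rmorphXn -exprM mulnC exprM l3 expr1n rmorph1.
have trE v : trace_w v = v + L ^+ 2 * s v + L * s (s v) by rewrite /trace_w eL.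
have [|e ee] := @fix2_comp t (trace_w w) vt ft.
  have aL : al L = L by rewrite /L alC.
  have bL : be L = L by rewrite /L beC.
  split; rewrite trE.
    rewrite !(rmorphD al) !(rmorphM al) aL aw a1 a2 eL -/L.
    transitivity (w + L ^+ 2 * s w + L * s (s w) + (L ^+ 3 * t ^+ n + L ^+ 3 * t ^+ n)).
      by ring.
    by rewrite xx addr0.
  rewrite !(rmorphD be) !(rmorphM be) bL bw b1 b2 eL.
  transitivity (w + L ^+ 2 * s w + L * s (s w) + (t ^+ n + L ^+ 3 * t ^+ n)).
    by ring.
  by rewrite L3 mul1r xx addr0.
pose Q := q + ps_C (l ^+ n) * ps_sub l q + ps_C (l ^+ (2 * n)) * ps_sub l (ps_sub l q).
have QE i : Q i = q i * (1 + l ^+ (n + i) + (l ^+ (n + i)) ^+ 2).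
  by rewrite /Q !psDE !psCM /ps_sub [(2 * n)%N]mulnC exprM !exprD; ring.
have HQ i : Q i <> 0 -> odd i /\ (i < 2 * n)%N.
  by move=> ne; apply: Hq => q0; apply: ne; rewrite QE q0 mul0r.
have stn : s (t ^+ n) = L * t ^+ n by rewrite rmorphXn /= st exprMn -rmorphXn.
have s1 : s w ^+ 2 + L * t ^+ n * s w = comp_t (ps_sub l q).
  by rewrite /comp_t -(aut_comp _ sC t1 st) -/(comp_t q) -wq rmorphD rmorphXn rmorphM /= stn.
have sL : s L = L by rewrite /L sC.
have s2 : s (s w) ^+ 2 + L ^+ 2 * t ^+ n * s (s w) = comp_t (ps_sub l (ps_sub l q)).
  rewrite /comp_t -(aut_comp _ sC t1 st) -/(comp_t _) -s1 rmorphD rmorphXn !(rmorphM s) /= sL stn.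
  by ring.
have cC c : comp_t (ps_C c) = ps_C c by rewrite /comp_t ps_comp_C.
have L4 : L ^+ 4 = L by rewrite exprS L3 mulr1.
have eQ : e ^+ 2 + X ^+ n * e = Q.
  apply: comp_t_inj; rewrite /Q !(rmorphD comp_t) (rmorphXn comp_t) !(rmorphM comp_t) /= comp_tX !cC -[comp_t e]ee eL -/L.
  rewrite -wq -s1 -s2 trE.
  transitivity (w ^+ 2 + t ^+ n * w + L * (L ^+ 3 * s w ^+ 2 + L * t ^+ n * s w) +
     L ^+ 2 * (s (s w) ^+ 2 + L ^+ 2 * t ^+ n * s (s w)) + (L - L ^+ 4) * t ^+ n * s (s w)
     + 2%:R * (L ^+ 2 * w * s w + L * w * s (s w) + L ^+ 3 * s w * s (s w))).
    by ring.
  by rewrite (two_psk char2) mul0r addr0 L4 L3 subrr !mul0r addr0 mul1r.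
have [Q0 he] := artin_schreier_odd HQ eQ.
(* When [i = 2n] modulo 3, the factor of [q i] in [QE] is [3 = 1], so [Q = 0] forces [q i = 0]. *)
have Hq3 i : q i <> 0 -> [/\ odd i, (i < 2 * n)%N & (i %% 3 != (2 * n) %% 3)%N].
  move=> qi; have [oi i2] := Hq i qi; split=> //; apply/eqP => ei.
  have /eqP := QE i; rewrite Q0 (_ : (0 : ps k) i = 0) // eq_sym mulf_eq0 => /orP[/eqP//|].
  rewrite (@root3_modn _ l (n + i) 0 l3); last lia.
  have two : 1 + 1 = 0 :> k := pcharf0 char2.
  by rewrite expr0 expr1n two add0r oner_eq0.
(* If the trace is [t^n], then [w + t^n] satisfies the same equation and its trace differs by
   [3 t^n = t^n]. *)
case: he => e0; first by exists w, q; split=> //; rewrite ee e0 -/(comp_t _) rmorph0.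
exists (w + t ^+ n), q; split=> //.
- by rewrite rmorphD rmorphXn /= aw at_.
- by rewrite rmorphD rmorphXn /= bw bt.
- rewrite -wq; transitivity (w ^+ 2 + t ^+ n * w + 2%:R * (w * t ^+ n + t ^+ n * t ^+ n)); first by ring.
  by rewrite (two_psk char2) mul0r addr0.
have -> : trace_w (w + t ^+ n) = trace_w w + (t ^+ n + L ^+ 3 * t ^+ n + L ^+ 3 * t ^+ n).
  by rewrite !trE !rmorphD /= stn rmorphM /= sL stn; ring.
by rewrite ee e0 -/(comp_t _) comp_tX L3 mul1r !addrA xx add0r xx.
Qed.
End Minimal.
End Uniformizer.

Lemma normal_form : exists t l n w q,
  [/\ has_val 4 t, al t = t, be t = t & s t = ps_C l * t] /\
  [/\ l ^+ 3 = 1, l <> 1, (0 < n)%N & (n %% 3 != 2)%N] /\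
  [/\ al w = w, be w = w + t ^+ n, w ^+ 2 + t ^+ n * w = ps_comp t q &
      w + ps_C (l ^+ (2 * n)) * s w + ps_C (l ^+ n) * s (s w) = 0] /\
  [/\ forall x, al x = x -> exists a b, x = ps_comp t a + ps_comp t b * w,
      forall m x, vge m x -> vge (m + 2 * n - 1) (al x + x),
      has_val 1 q &
      forall i, q i <> 0 -> odd i /\ (i %% 3 != (2 * n) %% 3)%N].
Proof.
have [t [l [vt ft st l3 l1]]] := uniformizer_fix2.
have [N0 JN0] := jump_at_ex vt ft.
have Pex : exists N, (fun N => `[<jump_at t N>]) N by exists N0; apply/asboolP.
case: (ex_minnP Pex) => n /asboolP Jn min.
have Jmin N : (N < n)%N -> ~ jump_at t N.
  by move=> Nn /asboolP/min; lia.
have [w [q [aw bw wq tr Hq]]] := invariant_trace_ex vt ft st l3 Jn.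
have vq : has_val 1 q by apply: (has_val1_odd vt ft Jn Jmin aw bw wq) => i /Hq[].
have [at_ bt] := ft.
exists t, l, n, w, q; split=> //; split; [split=> //; [exact: n_gt0 Jn|]|split=> //; split=> //].
(* The coefficient of degree 1 of [q] is nonzero, so [1] is not congruent to [2n] modulo 3. *)
- by have [_ _] := Hq 1%N vq.2; lia.
- by move=> x; apply: fixal_decomp bw.
- exact: (jump_al vt ft Jn Jmin).
- by move=> i /Hq[].
Qed.
End Action.
(** Transport of the action *)

Lemma complete_is_dvr (k : closedFieldType) (R : idomainType) (red : {rmorphism R -> k}) (p : R) N (te : k -> R) :
  p ^+ N = 2%:R -> (0 < N)%N -> red p = 0 -> p <> 0 ->
  (forall a, red a = 0 -> exists b, a = p * b) ->
  (forall a, (forall n, exists b, a = p ^+ n * b) -> a = 0) ->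
  (forall a, red a <> 0 -> a \is a GRing.unit) -> (forall c, red (te c) = c) ->
  [/\ is_dvr R, [pchar R] =i pred0 & residue_map red].
Proof.
move=> pN N0 redp p0 pdiv psep runit rte.
have unit_red a : a \is a GRing.unit -> red a <> 0.
  move=> ua e; have := congr1 red (divrr ua).
  by rewrite rmorphM e mul0r rmorph1 => /esym/eqP; rewrite oner_eq0.
split.
- exists p; split; [exact/eqP | by apply/negP => /unit_red |].
  move=> x x0; apply: contrapT => nx; move/eqP: x0; apply; apply: psep.
  elim=> [|n [b eb]]; first by exists x; rewrite mul1r.
  have [rb|rb] := eqVneq (red b) 0.
    by have [b' eb'] := pdiv b rb; exists b'; rewrite exprSr -mulrA -eb'.
  by case: nx; exists b, n; split; [apply/runit/eqP | rewrite mulrC].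
- move=> c; apply/negP => /andP[pc /eqP c0].
  have two : 2%:R = 0 :> k by rewrite -(rmorph_nat red) -pN rmorphXn redp expr0n gtn_eqF.
  have [c2|oc] := even_prime pc.
    by move: c0; rewrite c2 -pN => /eqP; rewrite expf_eq0 => /andP[_ /eqP].
  have /eqP := congr1 red c0; rewrite rmorph_nat rmorph0 (divn_eq c 2) modn2 oc natrD natrM two.
  by rewrite mulr0 add0r oner_eq0.
split=> [y|x]; first by exists (te y).
by split=> [e|nx]; [apply/negP => /unit_red | apply: contrapT => /runit; apply/negP].
Qed.

Lemma lift_exists (k : closedFieldType) (al be s : {rmorphism ps k -> ps k}) :
  2%N \in [pchar k] ->
  (forall c, al (ps_C c) = ps_C c) -> (forall c, be (ps_C c) = ps_C c) ->
  (forall c, s (ps_C c) = ps_C c) ->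
  (forall x, al (al x) = x) -> (forall x, be (be x) = x) ->
  (forall x, al (be x) = be (al x)) -> (forall x, s (s (s x)) = x) ->
  (forall x, s (al x) = be (s x)) -> (forall x, s (be x) = al (be (s x))) ->
  (exists x, al x <> x) ->
  exists (R : idomainType) (red : {rmorphism R -> k}) (z : R)
    (E : comNzRingType) (K : E -> Prop) (pr : {rmorphism E -> ps k})
    (th : {rmorphism ps R -> E}) (io : {rmorphism R -> E}) (a b s' : {rmorphism E -> E}) (Z : E),
  [/\ is_dvr R, [pchar R] =i pred0, residue_map red, z ^+ 3 = 1 & z <> 1] /\
  [/\ subring_prop K, forall f, K (th f), K Z,
      [/\ forall e, K e -> K (a e), forall e, K e -> K (b e) & forall e, K e -> K (s' e)] &
      forall c, io c = th (ps_C c)] /\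
  [/\ forall e, a (a e) = e, forall e, b (b e) = e, forall e, a (b e) = b (a e),
      forall e, s' (a e) = b (s' e) & forall e, s' (b e) = a (b (s' e))] /\
  [/\ forall e, s' (s' (s' e)) = e,
      forall e, pr (a e) = al (pr e), forall e, pr (b e) = be (pr e) &
      forall e, pr (s' e) = s (pr e)] /\
  [/\ forall f, a (th f) = th f, forall f, b (th f) = th f,
      forall f, s' (th f) = th (ps_sub z f), injective th &
      forall e, K e -> a e = e -> b e = e -> exists f, e = th f] /\
  [/\ forall e, K e -> exists F, expands io Z K e F,
      forall F, exists2 e, K e & expands io Z K e F,
      forall e F F', expands io Z K e F -> expands io Z K e F' -> F = F',
      forall e e' F, expands io Z K e F -> expands io Z K e' F -> e = e' &
      forall e F, expands io Z K e F ->
        expands (@ps_C k) (pr Z) (fun=> True) (pr e) (ps_map red F)] /\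
  has_val 1 (pr Z).
Proof.
move=> char2 alC beC sC al2 be2 albe s3 sal sbe al_neq.
have [t [l [n [w [q [[vt alt bet st] [[l3 l1 n0 n2] [[alw bew wq wtr] [fixal jump vq Hq]]]]]]]]] :=
  normal_form char2 alC beC sC al2 be2 albe s3 sal sbe al_neq.
have [R [red [p [te [[pN redp p0 pdiv] [[psep pcomplete runit] [rte te1 teM]]]]]]] := complete_dvr char2 4.
pose z := te l; have rz : red z = l by rewrite /z rte.
have z3 : z ^+ 3 = 1 by rewrite /z !exprS expr0 mulr1 -!teM -te1 -l3 !exprS expr0 mulr1.
have z1 : z <> 1 by move=> e; apply: l1; rewrite -rz e rmorph1.
have [sq Hsq] := choice (@closed_sqrt k).
(* Zero coefficients are lifted to zero explicitly, because [te 0] is known only through its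
   reduction and multiplicativity. *)
pose sl i := if q i == 0 then 0 else te (sq (q i)).
have Hs i : sl i <> 0 -> odd i /\ (i %% 3 != (2 * n) %% 3)%N.
  by rewrite /sl; case: eqP => // qi _; apply: Hq.
have [K [c [b [Y [eK ac ab eKc [U0 eU0]]]]]] := lifting_seed pN z3 Hs n0 n2.
have [G [H [Phi [eF [U eT] [U1 [U2 [U3 [eG eH ePhi]]]]]]]] :=
  lifting_identity pN z3 (sum3_root1 z3 z1) eK ac ab eKc.
have redP f g : ps_map red (f + ps_C p * g) = ps_map red f.
  by rewrite rmorphD rmorphM /= ps_map_C redp rmorph0 mul0r addr0.
have rK : ps_map red K = psX k ^+ n by rewrite eU0 redP rmorphXn /= ps_map_X.
have rG : ps_map red G = psX k ^+ n by rewrite eG redP rK.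
have rH : ps_map red H = psX k ^+ n by rewrite eH redP rK.
have rPhi : ps_map red Phi = q.
  rewrite ePhi redP; apply: funext => i; rewrite ps_mapE /part /sl /=.
  by case: eqP => [->|_]; rewrite ?expr0n ?rmorph0 // rmorphXn rte Hsq.
rewrite -rz in st wtr.
have jinj : injective (@FracField.tofrac R) by move=> x y /eqP; rewrite tofrac_eq => /eqP.
have [E [K' [pr [th [io [a' [b' [s' [V0 [V1 [Z pkg]]]]]]]]]]] := lift_package char2 pN redp p0 pdiv psep
  pcomplete runit rte z3 alC beC sC al2 be2 albe s3 sal sbe (fun m x => @aut_vge k al al m x al2)
  (fun m x => @aut_vge k be be m x be2) vt alt bet st n0 alw bew vq wq wtr fixal jump eF eT
  rG rH rPhi jinj.
have [[h1 h2 [_ _ h3] h4 h5] [h6 [h7 [[h8 h9 h10 h11] [[_ _ _ h12 h13] h14]]]]] := pkg.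
exists R, red, z, E, K', pr, th, io, a', b', s', Z; split; last by do 5!split=> //.
by have [] := complete_is_dvr pN isT redp p0 pdiv psep runit rte.
Qed.

(** * Normal forms [a^x b^y s^i] and their multiplication *)

Section Words.
Variables (T : Type) (a b s : T -> T).
Definition word (w : bool * bool * nat) (e : T) : T :=
  iter w.1.1 a (iter w.1.2 b (iter w.2 s e)).

Lemma word_ind (Q : T -> Prop) w e : (forall x, Q x -> Q (a x)) -> (forall x, Q x -> Q (b x)) ->
  (forall x, Q x -> Q (s x)) -> Q e -> Q (word w e).
Proof.
move=> Qa Qb Qs Qe; have it (f : T -> T) n x : (forall x, Q x -> Q (f x)) -> Q x -> Q (iter n f x).
  by move=> Qf Qx; elim: n => //= n /Qf.
by do 3!apply: (it _ _ _) => //.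
Qed.

Hypotheses (a2 : forall e, a (a e) = e) (b2 : forall e, b (b e) = e) (ab : forall e, a (b e) = b (a e))
  (sa : forall e, s (a e) = b (s e)) (sb : forall e, s (b e) = a (b (s e)))
  (s3 : forall e, s (s (s e)) = e).

(** Conjugation by [s] on the exponents of [a^x b^y]: it sends [a] to [b] and [b] to [a b]. *)
Definition twist (v : bool * bool) := (v.2, v.1 (+) v.2).
Definition mulw (w w' : bool * bool * nat) :=
  let v := iter w.2 twist w'.1 in (w.1.1 (+) v.1, w.1.2 (+) v.2, (w.2 + w'.2) %% 3)%N.

Lemma iter_mod3 n e : iter n s e = iter (n %% 3) s e.
Proof.
rewrite {1}(divn_eq n 3) iterD; move: (iter (n %% 3) s e) => {}e.
by elim: (n %/ 3)%N => // m; rewrite mulSn iterD => ->; rewrite /= s3.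
Qed.

Lemma mulwE w w' e : word (mulw w w') e = word w (word w' e).
Proof.
case: w w' => [[x y] i] [[x' y'] j]; rewrite /word /mulw /= -iter_mod3 iterD.
have -> : iter i s (iter x' a (iter y' b (iter j s e))) =
    iter (iter i twist (x', y')).1 a (iter (iter i twist (x', y')).2 b (iter i s (iter j s e))).
  elim: i => [|i IH] //=; rewrite {}IH; case: (iter i twist (x', y')) => [[] []] /=;
  by rewrite ?sa ?sb ?sa ?ab ?b2 ?ab.
move: (iter i s _) => {}e; case: (iter i twist _) => u v.
by case: x y u v => [] [] [] [] /=; rewrite ?ab ?a2 ?b2 ?ab ?a2.
Qed.
End Words.

Lemma word_morph (T U : Type) (f : T -> U) (Q : T -> Prop) (a b s : T -> T) (a' b' s' : U -> U) w e :
  (forall x, Q x -> Q (a x)) -> (forall x, Q x -> Q (b x)) -> (forall x, Q x -> Q (s x)) ->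
  (forall x, Q x -> f (a x) = a' (f x)) -> (forall x, Q x -> f (b x) = b' (f x)) ->
  (forall x, Q x -> f (s x) = s' (f x)) -> Q e -> f (word a b s w e) = word a' b' s' w (f e).
Proof.
move=> Qa Qb Qs fa fb fs Qe.
have it (g : T -> T) g' n x : (forall x, Q x -> Q (g x)) -> (forall x, Q x -> f (g x) = g' (f x)) ->
    Q x -> Q (iter n g x) /\ f (iter n g x) = iter n g' (f x).
  by move=> Qg fg Qx; elim: n => //= n [Qn <-]; split; [apply: Qg | apply: fg].
have [Q1 e1] := it s s' w.2 e Qs fs Qe.
have [Q2 e2] := it b b' w.1.2 _ Qb fb Q1.
by have [_ e3] := it a a' w.1.1 _ Qa fa Q2; rewrite /word e3 e2 e1.
Qed.

(** * The alternating group as the set of normal forms *)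

Section AltFour.
Local Open Scope group_scope.
Let o0 : 'I_4 := Ordinal (isT : 0 < 4)%N.
Let o1 : 'I_4 := Ordinal (isT : 1 < 4)%N.
Let o2 : 'I_4 := Ordinal (isT : 2 < 4)%N.
Let o3 : 'I_4 := Ordinal (isT : 3 < 4)%N.
Local Notation lmul p := (fun x => p * x).
Definition klein_a : {perm 'I_4} := tperm o0 o1 * tperm o2 o3.
Definition klein_b : {perm 'I_4} := tperm o0 o2 * tperm o1 o3.
Definition cyc3 : {perm 'I_4} := tperm o0 o1 * tperm o0 o2.

Ltac perm4 := apply/permP => -[[|[|[|[|]]]] //= H]; apply/val_inj; rewrite ?permM !permE /=.
Lemma klein_a2 : klein_a * klein_a = 1. Proof. by perm4. Qed.
Lemma klein_b2 : klein_b * klein_b = 1. Proof. by perm4. Qed.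
Lemma klein_ab : klein_a * klein_b = klein_b * klein_a. Proof. by perm4. Qed.
Lemma cyc3_a : cyc3 * klein_a = klein_b * cyc3. Proof. by perm4. Qed.
Lemma cyc3_b : cyc3 * klein_b = klein_a * (klein_b * cyc3). Proof. by perm4. Qed.
Lemma cyc3_3 : cyc3 * (cyc3 * cyc3) = 1. Proof. by perm4. Qed.
Lemma klein_a_A4 : klein_a \in A4. Proof. by rewrite Alt_even odd_permM !odd_tperm. Qed.
Lemma klein_b_A4 : klein_b \in A4. Proof. by rewrite Alt_even odd_permM !odd_tperm. Qed.
Lemma cyc3_A4 : cyc3 \in A4. Proof. by rewrite Alt_even odd_permM !odd_tperm. Qed.

Definition pword w := word (lmul klein_a) (lmul klein_b) (lmul cyc3) w 1.

Lemma pword_A4 w : pword w \in A4.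
Proof.
by apply: (@word_ind _ _ _ _ (fun g => g \in A4)) => [x|x|x|]; rewrite ?group1 // => h; rewrite groupM ?klein_a_A4 ?klein_b_A4 ?cyc3_A4.
Qed.

Lemma mul_pword w w' : pword (mulw w w') = pword w * pword w'.
Proof.
rewrite /pword mulwE; first last.
- by move=> e; rewrite -[RHS]mul1g -cyc3_3 !mulgA.
- by move=> e; rewrite (mulgA cyc3) cyc3_b -(mulgA klein_a) -(mulgA klein_b).
- by move=> e; rewrite (mulgA cyc3) cyc3_a -(mulgA klein_b).
- by move=> e; rewrite (mulgA klein_a) klein_ab -(mulgA klein_b).
- by move=> e; rewrite mulgA klein_b2 mul1g.
- by move=> e; rewrite mulgA klein_a2 mul1g.
rewrite -/(pword w'); move: (pword w') => g.
have mor p x : True -> p * x * g = p * (x * g) by rewrite mulgA.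
have := @word_morph _ _ (fun x => x * g) (fun=> True) (lmul klein_a) (lmul klein_b) (lmul cyc3)
  (lmul klein_a) (lmul klein_b) (lmul cyc3) w 1.
by rewrite mul1g => h; apply/esym/h => // x; apply: mor.
Qed.

Let na := nth 0%N [:: 1; 0; 3; 2]%N.
Let nb := nth 0%N [:: 2; 3; 0; 1]%N.
Let ns := nth 0%N [:: 1; 2; 0; 3]%N.

(** Tables of natural numbers make the distinctness of the normal forms a computation. Products of
    permutations apply their left factor first, so the letters appear in reverse order. *)
Lemma pword_val w (v : 'I_4) : pword w v = iter w.2 ns (iter w.1.2 nb (iter w.1.1 na v)) :> nat.
Proof.
have it (p : {perm 'I_4}) g n x : iter n (lmul p) g x = g (iter n p x).
  by elim: n x => //= n IH x; rewrite permM IH -iterSr.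
have vl (p : {perm 'I_4}) f n x : (forall x, p x = f (x : nat) :> nat) -> iter n p x = iter n f x :> nat.
  by move=> pf; elim: n => //= n IH; rewrite pf IH.
rewrite /pword /word !it perm1 (vl cyc3 ns) ?(vl klein_b nb) ?(vl klein_a na) //.
all: by case=> -[|[|[|[|]]]] // H; rewrite permM !permE.
Qed.

Lemma pword_inj w w' : (w.2 < 3)%N -> (w'.2 < 3)%N -> pword w = pword w' -> w = w'.
Proof.
move=> i3 j3 e; have h (v : 'I_4) := pword_val w v; rewrite e in h.
have := pword_val w' o0; have := pword_val w' o1; have := pword_val w' o3; rewrite !h {h e}.
by move: w w' i3 j3 => [[[] []] [|[|[|]]]] // [[[] []] [|[|[|]]]].
Qed.

(** By counting: the 12 normal forms are distinct elements of a group of order 12. *)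
Lemma pword_ex g : g \in A4 -> exists2 w, (w.2 < 3)%N & pword w = g.
Proof.
pose f (u : bool * bool * 'I_3) := pword (u.1, u.2 : nat).
have fi : injective f.
  by move=> [u i] [v j] /(@pword_inj (u, i : nat) (v, j : nat) (ltn_ord i) (ltn_ord j))[-> /val_inj->].
suff -> : A4 = [set f u | u : bool * bool * 'I_3] by case/imsetP=> -[u i] _ ->; exists (u, i : nat); first exact: ltn_ord.
apply/esym/eqP; rewrite eqEcard card_imset //; apply/andP; split.
  by apply/subsetP => _ /imsetP[u _ ->]; apply: pword_A4.
have := @card_Alt 'I_4; rewrite card_ord => /(_ isT) h.
by rewrite !card_prod card_bool card_ord; move: h; rewrite !factS fact0; lia.
Qed.
End AltFour.

(** * Series invariant under rescaling by a cube root of unity *)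

Section Cubes.
Variable R : idomainType.
Local Notation X := (psX R).
Definition stretch (h : ps R) : ps R := fun i => if (3 %| i)%N then h (i %/ 3)%N else 0.

Lemma stretch_step h : stretch h = ps_C (h 0%N) + X ^+ 3 * stretch (drop 1 h).
Proof.
apply: funext => i; rewrite psDE psXnM /stretch /ps_C.
case: i => [|[|[|i]]] //=; rewrite ?div0n ?addr0 ?add0r //.
rewrite subSS subSS subSS subn0; have -> : (3 %| i.+3)%N = (3 %| i)%N by lia.
by case: ifP => // _; rewrite /drop; congr h; lia.
Qed.

Lemma ps_comp_cube h : ps_comp (X ^+ 3) h = stretch h.
Proof.
have X1 : vge 1 (X ^+ 3) by apply: vgeW (@vge_X R 3).
apply/esym/(ps_comp_uniq X1) => N; exists (stretch (drop N h)) => //.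
elim: N => [|N IH].
  by rewrite big_ord0 add0r mul1r; congr stretch; apply: funext => i; rewrite /drop addn0.
rewrite {1}IH (stretch_step (drop N h)) big_ord_recr /=; move: (X ^+ 3) => Y; rewrite exprSr.
have -> : drop 1 (drop N h) = drop N.+1 h by apply: funext => i; rewrite /drop -addnA add1n.
have -> : drop N h 0%N = h N by rewrite /drop add0n.
by move: (\sum_(i < N) _) (stretch _) => u v; ring.
Qed.

Lemma ps_sub_cube z f : z ^+ 3 = 1 -> z <> 1 -> ps_sub z f = f <-> exists h, ps_comp (X ^+ 3) h = f.
Proof.
move=> z3 z1; split=> [e|[h <-]].
  exists (fun i => f (3 * i)%N); rewrite ps_comp_cube; apply: funext => i; rewrite /stretch.
  case: ifP => [i3|/negbT i3]; first by congr f; lia.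
  have /eqP := congr1 (fun g : ps R => g i) e.
  rewrite /ps_sub -subr_eq0 -{2}[f i]mul1r -mulrBl mulf_eq0 => /orP[|/eqP-> //].
  rewrite subr_eq0 => /eqP zi; case: z1.
  have [e1|e1] : i %% 3 = 1 %[mod 3] \/ i %% 3 = 2 %[mod 3] by lia.
    by rewrite -[z]expr1 -(@root3_modn _ z i 1 z3) //; lia.
  rewrite -z3 exprSr -(@root3_modn _ z i 2 z3) ?zi ?mul1r //; lia.
rewrite ps_comp_cube; apply: funext => i; rewrite /ps_sub /stretch.
case: ifP => i3; last by rewrite mulr0.
by rewrite (@root3_modn _ z i 0 z3) ?expr0 ?mul1r //; lia.
Qed.
End Cubes.

Lemma alg_hom_rmorph (A : comNzRingType) (phi : ps A -> ps A) : ps_alg_hom phi ->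
  exists f : {rmorphism ps A -> ps A}, forall x, f x = phi x.
Proof.
case=> pD pM p1 _.
have add : zmod_morphism phi.
  by move=> x y; apply: (addIr (phi y)); rewrite subrK -[LHS]pD; congr phi; exact: subrK.
have mon : monoid_morphism phi by split; [exact: p1 | exact: pM].
pose f : {rmorphism ps A -> ps A} :=
  HB.pack phi (GRing.isZmodMorphism.Build _ _ phi add) (GRing.isMonoidMorphism.Build _ _ phi mon).
by exists f.
Qed.

Lemma rmorph_alg_hom (A : comNzRingType) (f : {rmorphism ps A -> ps A}) :
  (forall c, f (ps_C c) = ps_C c) -> ps_alg_hom f.
Proof.
move=> fC; split; [exact: rmorphD | exact: rmorphM | exact: rmorph1 |].
by move=> c g; rewrite !ps_scaleE rmorphM fC.
Qed.

Lemma alg_hom_C (A : comNzRingType) (phi : ps A -> ps A) c : ps_alg_hom phi -> phi (ps_C c) = ps_C c.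
Proof.
case=> _ _ p1 pZ; have -> : ps_C c = ps_scale c (ps_C 1) by rewrite ps_scaleE rmorph1 mulr1.
by rewrite pZ p1.
Qed.

Lemma word_rmorph (A : comNzRingType) (a b s : {rmorphism A -> A}) w :
  exists f : {rmorphism A -> A}, forall e, f e = word a b s w e.
Proof.
have it (g : {rmorphism A -> A}) n : exists f : {rmorphism A -> A}, forall e, f e = iter n g e.
  by elim: n => [|n [f Hf]]; [exists idfun | exists (g \o f) => e /=; rewrite Hf].
have [f1 h1] := it a w.1.1; have [f2 h2] := it b w.1.2; have [f3 h3] := it s w.2.
by exists (f1 \o f2 \o f3) => e; rewrite /= h1 h2 h3.
Qed.

Lemma ps_comp_rmorph (A : comNzRingType) (t : ps A) : vge 1 t ->
  exists f : {rmorphism ps A -> ps A}, f = ps_comp t :> (ps A -> ps A).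
Proof.
move=> t1; pose f : {rmorphism ps A -> ps A} := HB.pack (ps_comp t)
  (GRing.isZmodMorphism.Build _ _ (ps_comp t) (ps_comp_additive t1))
  (GRing.isMonoidMorphism.Build _ _ (ps_comp t) (ps_comp_monoid t1)).
by exists f.
Qed.

Section Transport.
Variables (k : closedFieldType) (rho : {perm 'I_4} -> ps k -> ps k).
Hypothesis Hrho : faithful_A4_action rho.
Variables (R : idomainType) (red : {rmorphism R -> k}) (z : R)
    (E : comNzRingType) (K : E -> Prop) (pr : {rmorphism E -> ps k})
    (th : {rmorphism ps R -> E}) (io : {rmorphism R -> E}) (a b s : {rmorphism E -> E}) (Z : E).
Hypotheses (red_surj : forall y, exists x, red x = y) (z3 : z ^+ 3 = 1) (z1 : z <> 1).
Hypotheses (Ks : subring_prop K) (Kth : forall f, K (th f)) (KZ : K Z)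
  (Ka : forall e, K e -> K (a e)) (Kb : forall e, K e -> K (b e)) (Kc : forall e, K e -> K (s e))
  (ioE : forall c, io c = th (ps_C c)).
Hypotheses (a2 : forall e, a (a e) = e) (b2 : forall e, b (b e) = e)
  (ab : forall e, a (b e) = b (a e)) (sa : forall e, s (a e) = b (s e))
  (sb : forall e, s (b e) = a (b (s e))) (s3 : forall e, s (s (s e)) = e).
Hypotheses (pra : forall e, pr (a e) = rho klein_a (pr e)) (prb : forall e, pr (b e) = rho klein_b (pr e))
  (prs : forall e, pr (s e) = rho cyc3 (pr e)).
Hypotheses (ath : forall f, a (th f) = th f) (bth : forall f, b (th f) = th f)
  (sth : forall f, s (th f) = th (ps_sub z f)) (th_inj : injective th)
  (Kfix : forall e, K e -> a e = e -> b e = e -> exists f, e = th f).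
Hypotheses (exT : forall e, K e -> exists F, expands io Z K e F)
  (exE : forall F, exists2 e, K e & expands io Z K e F)
  (unT : forall e F F', expands io Z K e F -> expands io Z K e F' -> F = F')
  (unE : forall e e' F, expands io Z K e F -> expands io Z K e' F -> e = e')
  (ex_pr : forall e F, expands io Z K e F ->
     expands (@ps_C k) (pr Z) (fun=> True) (pr e) (ps_map red F)).
Hypothesis vZ : has_val 1 (pr Z).

Local Notation act := (word a b s).

Lemma K_io c : K (io c). Proof. by rewrite ioE. Qed.
Lemma K_act w e : K e -> K (act w e).
Proof. exact: word_ind. Qed.

(** Evaluation of [F] at [Z], inverse to [taylor] on [K]; together they identify [K] with
    [R[[Z]]]. *)
Definition ev (F : ps R) : E := s2val (cid2 (exE F)).
Lemma K_eval F : K (ev F). Proof. exact: (s2valP (cid2 (exE F))). Qed.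
Lemma evP F : expands io Z K (ev F) F. Proof. exact: (s2valP' (cid2 (exE F))). Qed.

Lemma taylor_ex e : exists F, K e -> expands io Z K e F.
Proof. by have [/exT[F HF]|nK] := EM (K e); [exists F | exists 0 => /nK]. Qed.
Definition taylor (e : E) : ps R := projT1 (choice taylor_ex) e.
Lemma taylorP e : K e -> expands io Z K e (taylor e). Proof. exact: (projT2 (choice taylor_ex)). Qed.

Lemma taylorK e : K e -> ev (taylor e) = e.
Proof. by move=> Ke; apply: unE (evP _) (taylorP Ke). Qed.
Lemma ev_inj : injective ev.
Proof. by move=> F F' e; have := evP F'; rewrite -e => h; apply: unT (evP F) h. Qed.
Lemma evD F F' : ev (F + F') = ev F + ev F'.
Proof. exact: unE (evP _) (expandsD Ks (evP F) (evP F')). Qed.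
Lemma evM F F' : ev (F * F') = ev F * ev F'.
Proof. exact: unE (evP _) (expandsM Ks K_io KZ (evP F) (evP F')). Qed.
Lemma evC c : ev (ps_C c) = io c.
Proof. exact: unE (evP _) (expandsC Z Ks K_io c). Qed.
Lemma pr_ev F : pr (ev F) = ps_comp (pr Z) (ps_map red F).
Proof. exact: (ps_comp_uniq vZ.1 (ex_pr (evP F))). Qed.

Lemma alg_hom_taylor (f : ps R -> E) : (forall F, K (f F)) -> (forall F F', f (F + F') = f F + f F') ->
  (forall F F', f (F * F') = f F * f F') -> (forall c, f (ps_C c) = io c) ->
  ps_alg_hom (taylor \o f).
Proof.
move=> Kf fD fM fC; have fK F : ev ((taylor \o f) F) = f F by rewrite /= taylorK.
split=> [F F'|F F'||c F]; apply: ev_inj.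
- by rewrite fK [LHS]fD [RHS]evD !fK.
- by rewrite fK [LHS]fM [RHS]evM !fK.
- by rewrite fK fC evC.
- by rewrite fK !ps_scaleE fM evM !fK fC evC.
Qed.

Lemma index_ex g : exists w : bool * bool * nat, (w.2 < 3)%N /\ (g \in A4 -> pword w = g).
Proof.
have [/pword_ex[w w3 <-]|nA] := boolP (g \in A4); first by exists w.
by exists (false, false, 0%N).
Qed.
Definition index g := projT1 (cid (index_ex g)).
Lemma index_lt g : ((index g).2 < 3)%N. Proof. by case: (projT2 (cid (index_ex g))). Qed.
Lemma indexK g : g \in A4 -> pword (index g) = g. Proof. by case: (projT2 (cid (index_ex g))). Qed.
Lemma index_pword w : (w.2 < 3)%N -> index (pword w) = w.
Proof. by move=> w3; apply: pword_inj (index_lt _) w3 _; rewrite indexK ?pword_A4. Qed.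

Lemma rho_mul g h : g \in A4 -> h \in A4 -> rho (g * h)%g = rho g \o rho h.
Proof. by have [_ + _ _] := Hrho; apply. Qed.
Lemma pr_act w e : pr (act w e) = rho (pword w) (pr e).
Proof.
rewrite (@word_morph _ _ pr (fun=> True) _ _ _ (rho klein_a) (rho klein_b) (rho cyc3)) //.
have [rho1 _ _ _] := Hrho.
rewrite /pword (@word_morph _ _ rho (fun g => g \in A4) _ _ _ (fun f => rho klein_a \o f)
  (fun f => rho klein_b \o f) (fun f => rho cyc3 \o f)) ?rho1 ?group1 //.
- by rewrite (@word_morph _ _ (fun f : ps k -> ps k => f (pr e)) (fun=> True) _ _ _ (rho klein_a) (rho klein_b) (rho cyc3)).
- by move=> g Ag; rewrite groupM ?klein_a_A4.
- by move=> g Ag; rewrite groupM ?klein_b_A4.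
- by move=> g Ag; rewrite groupM ?cyc3_A4.
- by move=> g Ag; rewrite rho_mul ?klein_a_A4.
- by move=> g Ag; rewrite rho_mul ?klein_b_A4.
- by move=> g Ag; rewrite rho_mul ?cyc3_A4.
Qed.

Definition lifted_rho (g : {perm 'I_4}) : ps R -> ps R := taylor \o (act (index g) \o ev).
Lemma ev_rho g F : ev (lifted_rho g F) = act (index g) (ev F).
Proof. by rewrite /lifted_rho /= taylorK //; apply: K_act; apply: K_eval. Qed.

Lemma act_io w c : act w (io c) = io c.
Proof.
by apply: (@word_ind _ _ _ _ (fun e => e = io c)) => // e ->; rewrite ioE ?ath ?bth ?sth ?ps_sub_C.
Qed.

Lemma pr_surj x : exists2 e, K e & pr e = x.
Proof.
have [F ->] := ps_comp_onto x vZ; have [f Hf] := choice (fun i => red_surj (F i)).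
exists (ev f); first exact: K_eval.
by rewrite pr_ev; congr ps_comp; apply: funext => i; apply: Hf.
Qed.

Lemma lifted_faithful : faithful_A4_action lifted_rho.
Proof.
have [rho1 _ _ rho_inj] := Hrho.
have index1 : index 1%g = (false, false, 0%N) := @index_pword (false, false, 0%N) isT.
split.
- by apply: funext => F; apply: ev_inj; rewrite ev_rho index1.
- move=> g h Ag Ah; apply: funext => F; apply: ev_inj; rewrite /= !ev_rho.
  rewrite -(mulwE a2 b2 ab sa sb s3).
  have := @index_pword (mulw (index g) (index h)) (ltn_mod _ 3).
  by rewrite mul_pword !indexK // => ->.
- move=> g Ag; have [f Hf] := word_rmorph a b s (index g).
  apply: alg_hom_taylor => [F|F F'|F F'|c] /=.
  + by apply: K_act; apply: K_eval.
  + by rewrite evD -!Hf rmorphD.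
  + by rewrite evM -!Hf rmorphM.
  + by rewrite evC act_io.
move=> g Ag e; apply: rho_inj => //; apply: funext => x; have [u Ku <-] := pr_surj x.
by rewrite -[in LHS](indexK Ag) -pr_act -(taylorK Ku) -ev_rho e.
Qed.

(** The Klein group leaves the image of [R[[T]]], on which the 3-cycle rescales [T] by [z]; so the
    parameter of the fixed ring is [T^3]. *)
Lemma lifted_fixed : fixed_ring_is_ps lifted_rho.
Proof.
pose psi (h : ps R) := th (ps_comp (psX R ^+ 3) h).
have X3 : has_val 3 (psX R ^+ 3) by have := has_val_exp 3 (has_valX R); rewrite mul1n.
have X1 : vge 1 (psX R ^+ 3) := vgeW (isT : 1 <= 3)%N X3.1.
have [cf Hcf] := ps_comp_rmorph X1.
have Kpsi h : K (psi h) by apply: Kth.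
exists (taylor \o psi); split.
- apply: alg_hom_taylor => // [F F'|F F'|c].
  + by rewrite /psi -Hcf !rmorphD.
  + by rewrite /psi -Hcf !rmorphM.
  + by rewrite /psi (ps_comp_C X1) ioE.
- move=> h h' /(congr1 ev); rewrite /= !taylorK // => /th_inj e.
  apply/eqP; rewrite -subr_eq0; apply/eqP/(ps_comp_inj X3) => //.
  by rewrite -Hcf rmorphB /= Hcf e subrr.
move=> F; split=> [fixF|[h <-] g Ag]; last first.
  apply: ev_inj; rewrite ev_rho /= taylorK //.
  apply: (@word_ind _ _ _ _ (fun e => e = psi h)) => [e ->|e ->|e ->|//]; rewrite /psi.
  + exact: ath.
  + exact: bth.
  by rewrite sth; congr (th _); apply/(ps_sub_cube _ z3 z1); exists h.
have fx w : (w.2 < 3)%N -> act w (ev F) = ev F.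
  by move=> w3; rewrite -[w in LHS]index_pword // -ev_rho fixF ?pword_A4.
have [m em] := Kfix (K_eval F) (fx (true, false, 0%N) isT) (fx (false, true, 0%N) isT).
have sm : ps_sub z m = m by apply: th_inj; rewrite -sth -em; apply: (fx (false, false, 1%N)).
have [h eh] := (ps_sub_cube m z3 z1).1 sm.
by exists h; apply: ev_inj; rewrite /= taylorK // /psi eh em.
Qed.

(** The isomorphism substitutes the reduction of [Z], a uniformizer of [k[[z]]], for the
    variable. *)
Lemma lifted_reduction : exists phi, ps_alg_iso phi /\
  forall g F, g \in A4 -> phi (ps_map red (lifted_rho g F)) = rho g (phi (ps_map red F)).
Proof.
have [cf Hcf] := ps_comp_rmorph vZ.1.
exists (ps_comp (pr Z)); split; last first.
  by move=> g F Ag; rewrite -!pr_ev ev_rho pr_act indexK.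
split.
  by rewrite -Hcf; apply: rmorph_alg_hom => c; rewrite Hcf (ps_comp_C vZ.1).
have [f Hf] := choice (fun y => ps_comp_onto y vZ).
have inj : injective (ps_comp (pr Z)).
  move=> F F' e; apply/eqP; rewrite -subr_eq0; apply/eqP/(ps_comp_inj vZ) => //.
  by rewrite -Hcf rmorphB /= Hcf e subrr.
exists f => [x|y]; last by rewrite -Hf.
by apply: inj; rewrite -Hf.
Qed.
End Transport.

Theorem theorem1 (k : closedFieldType) (char2 : 2%N \in [pchar k])
    (rho : {perm 'I_4} -> ps k -> ps k) :
  A4_galois_ps rho ->
  exists (R : idomainType) (red : {rmorphism R -> k})
         (rhoR : {perm 'I_4} -> ps R -> ps R) (phi : ps k -> ps k),
    [/\ is_dvr R, [pchar R] =i pred0 & residue_map red] /\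
    [/\ A4_galois_ps rhoR,
        ps_alg_iso phi &
        forall g F, g \in A4 ->
          phi (ps_map red (rhoR g F)) = rho g (phi (ps_map red F))].
Proof.
move=> [Hrho _]; have [rho1 rhoM rhoH rho_inj] := Hrho.
have [al eal] := alg_hom_rmorph (rhoH _ klein_a_A4); have [be ebe] := alg_hom_rmorph (rhoH _ klein_b_A4).
have [s es] := alg_hom_rmorph (rhoH _ cyc3_A4).
have mulE g h x : g \in A4 -> h \in A4 -> rho g (rho h x) = rho (g * h)%g x.
  by move=> Ag Ah; rewrite rhoM.
have fix1 x : rho 1%g x = x by rewrite rho1.
have [A1 A2 A3] := And3 klein_a_A4 klein_b_A4 cyc3_A4; have [A33 A23] := (groupM A3 A3, groupM A2 A3).
have [||||||||||R [red [z [E [K [pr [th [io [a [b [s' [Z pkg]]]]]]]]]]]] := @lift_exists k al be s char2.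
- by move=> c; rewrite eal alg_hom_C //; apply: rhoH.
- by move=> c; rewrite ebe alg_hom_C //; apply: rhoH.
- by move=> c; rewrite es alg_hom_C //; apply: rhoH.
- by move=> x; rewrite !eal mulE // klein_a2.
- by move=> x; rewrite !ebe mulE // klein_b2.
- by move=> x; rewrite !eal !ebe !mulE // klein_ab.
- by move=> x; rewrite !es (mulE cyc3 cyc3 x) // (mulE _ _ _ A3 A33) cyc3_3.
- by move=> x; rewrite ?es ?eal ?ebe ?es !mulE // cyc3_a.
- by move=> x; rewrite ?es ?eal ?ebe ?es (mulE klein_b cyc3) // (mulE _ _ _ A1 A23) !mulE // cyc3_b.
- apply: contrapT => H; suff : klein_a = 1%g by move/(congr1 (fun p : {perm 'I_4} => val (p ord0))); rewrite permM !permE.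
  apply: rho_inj => //; apply: funext => x; rewrite -eal; apply: contrapT => nx; apply: H; by exists x.
case: pkg => -[dvr ch res z3 z1] [[Ks Kth KZ [Ka Kb Kc] ioE]]
  [[a2 b2 ab sa sb]] [[s3 pra prb prs]] [[ath bth sth th_inj Kfix]] [[exT exE unT unE ex_pr]] vZ.
have pra' e : pr (a e) = rho klein_a (pr e) by rewrite pra eal.
have prb' e : pr (b e) = rho klein_b (pr e) by rewrite prb ebe.
have prs' e : pr (s' e) = rho cyc3 (pr e) by rewrite prs es.
have [phi [iso eqv]] := lifted_reduction Hrho Ka Kb Kc pra' prb' prs' exT exE unE ex_pr vZ.
exists R, red, (lifted_rho a b s' exT exE), phi; split=> //.
split=> //; split.
  exact: (lifted_faithful Hrho res.1 Ks Kth KZ Ka Kb Kc ioE a2 b2 ab sa sb s3 pra' prb' prs' ath bth sth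
    exT exE unT unE ex_pr vZ).
exact: (lifted_fixed z3 z1 Ks Kth KZ Ka Kb Kc ioE ath bth sth th_inj Kfix exT exE unT unE).
Qed.
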